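(* Let $X$ be a complex Banach space, $1<\alpha<2$, $r>0$, $\omega>0$, $\mathcal{C}=C([-r,0],X)$, $\varphi\in\mathcal{C}$, and let $A:D(A)\subseteq X\to X$ be a densely defined linear operator that is sectorial of type $\mu<0$ with angle $\theta$ satisfying $0<\theta\le\pi(1-\frac{\alpha}{2})$, with constants $M,C>0$ as in the context. Assume that: (i) $f,g\in PSAP_{\omega,r}(\mathcal{C},X)$ and $f(\cdot,0),g(\cdot,0)\in C_b([0,\infty),X)$; (ii) there exist $L_g,L_f\in C_b([0,\infty),\mathbb{R}^+)$ such that for all $\psi,\phi\in\mathcal{C}$ and all $t\in[0,\infty)$, $$\|g(t,\psi)-g(t,\phi)\|\le L_g(t)\|\psi-\phi\|_{\mathcal{C}},\qquad \|f(t,\psi)-f(t,\phi)\|\le L_f(t)\|\psi-\phi\|_{\mathcal{C}};$$ (iii) $$\|L_g\|_{C_b([0,\infty),\mathbb{R}^+)}+\|L_f\|_{C_b([0,\infty),\mathbb{R}^+)}\,\frac{CM|\mu|^{-1/\alpha}\pi}{\alpha\sin(\pi/\alpha)}<1.$$ Then the system $$\frac{d}{dt}D(t,u_t)=\int_0^t\frac{(t-s)^{\alpha-2}}{\Gamma(\alpha-1)}A D(s,u_s)\,ds+f(t,u_t),\quad t\ge0,\qquad u_0=\varphi,$$ where $D(t,\psi)=\psi(0)-g(t,\psi)$, has a unique mild solution $u$ with $u|_{[0,\infty)}\in PSAP_{\omega,r}(X)$.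
   Context: Function spaces. $\mathbb{R}^+=[0,\infty)$. $C_b([a,\infty),X)$ and $C_b([0,\infty),\mathbb{R}^+)$ denote the bounded continuous functions with the sup norm; $\mathcal{C}=C([-r,0],X)$ carries the sup norm $\|\cdot\|_{\mathcal{C}}$. For $u:[-r,\infty)\to X$ and $t\ge0$, the history $u_t:[-r,0]\to X$ is $u_t(\theta)=u(t+\theta)$. Pseudo $S$-asymptotic periodicity. $PSAP_\omega(X)$ is the set of $u\in C_b([0,\infty),X)$ with $\lim_{t\to\infty}\frac1t\int_0^t\|u(s+\omega)-u(s)\|ds=0$. $PSAP_{\omega,r}(X)$ is the set of $u\in PSAP_\omega(X)$ with $$\lim_{T\to\infty}\frac1T\int_r^T\sup_{\tau\in[s-r,s]}\|u(\tau+\omega)-u(\tau)\|ds=0.$$ $PSAP_{\omega,r}(\mathcal{C},X)$ is the set of $F\in C([0,\infty)\times\mathcal{C},X)$ such that for all $L>0$, $$\lim_{T\to\infty}\frac1T\int_r^T\sup_{\tau\in[s-r,s]}\ \sup_{\|x\|_{\mathcal{C}}\le L}\|F(\tau+\omega,x)-F(\tau,x)\|ds=0.$$ Sectorial operators and solution operator. A closed linear operator $A$ is sectorial of type $\mu\in\mathbb{R}$ with angle $\theta$, $0<\theta<\frac\pi2$, and constant $M>0$ if its spectrum is contained in $\mu+S_\theta=\{\mu+\lambda:\lambda\in\mathbb{C}\setminus\{0\},|\arg(-\lambda)|<\theta\}$ and $\|(\lambda I-A)^{-1}\|\le\frac{M}{|\lambda-\mu|}$ for all $\lambda\notin\mu+S_\theta$,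 $\lambda\ne\mu$. A closed linear operator $A$ generates a solution operator if there are $\nu\in\mathbb{R}$ and a strongly continuous $S_\alpha:\mathbb{R}^+\to\mathcal{B}(X)$ with $\{\lambda^\alpha:\mathrm{Re}\,\lambda>\nu\}\subseteq\rho(A)$ and $\lambda^{\alpha-1}(\lambda^\alpha I-A)^{-1}x=\int_0^\infty e^{-\lambda t}S_\alpha(t)x\,dt$ for all $\mathrm{Re}\,\lambda>\nu$, $x\in X$; here $\lambda^\alpha=|\lambda|^\alpha e^{\alpha i\arg\lambda}$, $-\pi<\arg\lambda<\pi$. Then $S_\alpha(0)=I$. It is known (Cuesta) that an operator $A$ sectorial of type $\mu<0$ with $0<\theta\le\pi(1-\frac\alpha2)$ generates a solution operator $S_\alpha$, and that there is a constant $C>0$ with $$\|S_\alpha(t)\|\le\frac{CM}{1+|\mu|t^\alpha},\qquad t\ge0.$$ $M$ and $C$ denote these constants. Mild solution. A function $u\in C_b([-r,\infty),X)$ is a mild solution of the system if $u_0=\varphi$ and for all $t\ge0$ $$u(t)=S_\alpha(t)[\varphi(0)-g(0,\varphi)]+g(t,u_t)+\int_0^tS_\alpha(t-s)f(s,u_s)\,ds.$$ *)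

(* Defs.v *)
From HB Require Import structures.
From mathcomp Require Import all_boot all_order all_algebra.
From mathcomp Require Import complex.
From mathcomp Require Import all_classical all_reals all_analysis.
Set Implicit Arguments.
Unset Strict Implicit.
Unset Printing Implicit Defensive.
Import Order.TTheory GRing.Theory Num.Theory numFieldNormedType.Exports.
Local Open Scope classical_set_scope.
Local Open Scope ring_scope.
Local Open Scope complex_scope.

(* The library norm of a complex normed module takes its values in R[i]
   (on the nonnegative real axis); [nrm] is the same norm, valued in R. *)
Definition nrm (R : realType) (V : normedZmodType R[i]) (x : V) : R :=
  complex.Re `|x|.

Section ComplexFunctions.
Variable R : realType.
Implicit Type z : R[i].

Definition cexp z : R[i] :=
  (expR (complex.Re z))%:C * (cos (complex.Im z) +i* sin (complex.Im z)).

(* Principal argument, in ]-pi, pi]; the value at z = 0 is irrelevant. *)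
Definition carg z : R :=
  let a := acos (complex.Re z / nrm z) in
  if 0 <= complex.Im z then a else - a.

(* |z|^a e^(i a arg z), to be used for z off the half-line ]-oo, 0]. *)
Definition cpow z (a : R) : R[i] :=
  (nrm z `^ a)%:C * (cos (a * carg z) +i* sin (a * carg z)).

Definition sector (mu theta : R) : set R[i] :=
  [set z | z - mu%:C != 0 /\ `|carg (- (z - mu%:C))| < theta].

End ComplexFunctions.

(* Vector-valued Riemann integral over [a, b], a <= b, as the limit of tagged
   Riemann sums when the mesh tends to 0; every vector-valued integrand used
   below is continuous. *)
Section VectorIntegral.
Variables (R : realType) (X : completeNormedModType R[i]).

Definition is_rint (h : R -> X) (a b : R) (y : X) : Prop :=
  a <= b /\
  forall e : R, 0 < e -> exists2 d : R, 0 < d &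
    forall (n : nat) (t c : nat -> R),
      t 0%N = a -> t n = b ->
      (forall i, (i < n)%N -> t i <= c i <= t i.+1 /\ t i.+1 - t i < d) ->
      nrm (\sum_(i < n) (t i.+1 - t i)%:C *: h (c i) - y) < e.

Definition is_rint_oo (h : R -> X) (a : R) (y : X) : Prop :=
  exists2 J : R -> X, (forall b, a <= b -> is_rint h a b (J b)) &
    J b @[b --> +oo] --> y.

End VectorIntegral.

(* An unbounded operator is a domain [D] together with a total map [A] whose
   values outside [D] are never used. *)
Section Operators.
Variables (R : realType) (X : completeNormedModType R[i]).
Implicit Types (D : set X) (A : X -> X).

Definition opnorm (T : X -> X) : \bar R :=
  ereal_sup [set (nrm (T x))%:E | x in [set x | nrm x <= 1]].

Definition linear_operator D A : Prop :=
  D 0 /\ forall (a : R[i]) x y, D x -> D y ->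
    D (a *: x + y) /\ A (a *: x + y) = a *: A x + A y.

Definition closed_operator D A : Prop :=
  closed [set p : X * X | D p.1 /\ p.2 = A p.1].

(* [T] is the resolvent (z I - A)^-1, defined on all of X and bounded. *)
Definition is_resolvent D A (z : R[i]) (T : X -> X) : Prop :=
  [/\ forall y, D (T y) /\ z *: T y - A (T y) = y,
      forall x, D x -> T (z *: x - A x) = x &
      (opnorm T < +oo)%E].

Definition resolvent_set D A : set R[i] :=
  [set z | exists T, is_resolvent D A z T].

Definition spectrum D A : set R[i] := ~` resolvent_set D A.

Definition sectorial D A (mu theta M : R) : Prop :=
  [/\ linear_operator D A, closed_operator D A,
      0 < theta < pi / 2 /\ 0 < M,
      spectrum D A `<=` sector mu theta &
      forall z T, ~ sector mu theta z -> z != mu%:C -> is_resolvent D A z T ->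
        (opnorm T <= (M / nrm (z - mu%:C))%:E)%E].

(* The powers of z refer to -pi < arg z < pi, hence the two conditions
   excluding ]-oo, 0], which matter only when nu < 0. *)
Definition solution_operator D A (alpha : R) (S : R -> {linear X -> X}) : Prop :=
  [/\ forall t, 0 <= t -> continuous (S t),
      forall x, {within `[0, +oo[, continuous (fun t => S t x)} &
      exists nu : R, forall z : R[i],
        nu < complex.Re z -> z != 0 -> carg z < pi ->
        exists2 T, is_resolvent D A (cpow z alpha) T &
          forall x, is_rint_oo (fun t => cexp (- (z * t%:C)) *: S t x) 0
            (cpow z (alpha - 1) *: T x)].

End Operators.

(* Elements of C([-r, 0], X) are represented by total functions R -> X, of
   which only the values on [-r, 0] are meaningful.  Continuity of
   F : [0, oo[ x C([-r, 0], X) -> X in the sup norm forces F to depend only on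
   these values, so this is the same as working with functions on [-r, 0]. *)
Section Spaces.
Variables (R : realType) (X : completeNormedModType R[i]).
Implicit Types (u psi : R -> X) (F : R -> (R -> X) -> X).

Definition hist_space (r : R) : set (R -> X) :=
  [set psi | {within `[- r, 0], continuous psi}].

Definition hist_norm (r : R) psi : R :=
  sup [set nrm (psi th) | th in `[- r, 0]].

Definition hist u (t : R) : R -> X := fun th => u (t + th).

Definition Cb (a : R) u : Prop :=
  {within `[a, +oo[, continuous u} /\
  exists K : R, forall t, a <= t -> nrm (u t) <= K.

(* (1/T) int_a^T h(s) ds --> 0, with an extended-real Lebesgue integral since
   the suprema below may be infinite and are only semicontinuous in s. *)
Definition mean_null (a : R) (h : R -> \bar R) : Prop :=
  ((T^-1)%:E * \int[@lebesgue_measure R]_(s in `[a, T]) h s)%E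
    @[T --> +oo] --> 0%E.

Definition PSAP (omega : R) u : Prop :=
  Cb 0 u /\ mean_null 0 (fun s => (nrm (u (s + omega) - u s))%:E).

Definition PSAPr (omega r : R) u : Prop :=
  PSAP omega u /\
  mean_null r (fun s => ereal_sup
    [set (nrm (u (tau + omega) - u tau))%:E | tau in `[s - r, s]]).

Definition continuous_hist (r : R) F : Prop :=
  forall t0 psi0, 0 <= t0 -> hist_space r psi0 ->
  forall e : R, 0 < e -> exists2 d : R, 0 < d &
    forall t psi, 0 <= t -> hist_space r psi ->
      `|t - t0| < d -> hist_norm r (fun th => psi th - psi0 th) < d ->
      nrm (F t psi - F t0 psi0) < e.

Definition PSAPr_hist (omega r : R) F : Prop :=
  continuous_hist r F /\
  forall L : R, 0 < L ->
    mean_null r (fun s => ereal_sup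
      [set ereal_sup [set (nrm (F (tau + omega) x - F tau x))%:E |
                        x in [set x | hist_space r x /\ hist_norm r x <= L]]
      | tau in `[s - r, s]]).

Definition mild_solution (r : R) (S : R -> {linear X -> X}) F G
    (phi u : R -> X) : Prop :=
  [/\ Cb (- r) u,
      forall th, - r <= th <= 0 -> hist u 0 th = phi th &
      forall t, 0 <= t ->
        exists2 I : X,
          is_rint (fun s => S (t - s) (F s (hist u s))) 0 t I &
          u t = S t (phi 0 - G 0 phi) + G t (hist u t) + I].

End Spaces.

Section ScalarSpace.
Variable R : realType.

(* C_b([0, oo[, R^+) and its norm *)
Definition Cb_nonneg (L : R -> R) : Prop :=
  [/\ {within `[0, +oo[, continuous L},
      forall t, 0 <= t -> 0 <= L t &
      exists K : R, forall t, 0 <= t -> L t <= K].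

Definition Cb_norm (L : R -> R) : R := sup [set `|L t| | t in `[0, +oo[].

End ScalarSpace.

(* Main.v *)
Require Import Defs.
From mathcomp Require Import all_boot all_order all_algebra.
From mathcomp Require Import complex.
From mathcomp Require Import all_classical all_reals all_analysis.
From mathcomp Require Import measurable_realfun.
From mathcomp Require Import ring lra zify.
Import Order.TTheory GRing.Theory Num.Theory numFieldNormedType.Exports.
Local Open Scope classical_set_scope.
Local Open Scope ring_scope.
Local Open Scope complex_scope.

(** A mild solution is a fixed point of the operator sending [u] to the right-hand
    side of its defining equation. As the norm of [S t] is at most
    k(t) = C M / (1 + |mu| t^alpha), this operator is Lipschitz for the sup norm,
    with constant ||Lg|| + ||Lf|| int_0^oo k; and since
    int_0^oo dt / (1 + t^alpha) = (pi / alpha) / sin (pi / alpha), the smallness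
    hypothesis says that it is a contraction. Picard iteration gives the solution
    ([fixed_point_exists]) and the same estimate its uniqueness
    ([fixed_point_unique]). The pseudo periodicity is carried along the iteration:
    the functions whose increments u (t + omega) - u t have null means are
    preserved by the operator ([volterra_null]) and closed under uniform limits.
    The increments are estimated on the iterates rather than on the fixed point,
    because each use of the equation lengthens the window over which suprema are
    taken.

    The sharp constant. It suffices to have, for each eps > 0, a function whose
    increments dominate the lower sums of k and stay below the integral plus eps
    ([kernel_majorant]). Expand 1 / (1 + t^alpha) in powers of t^alpha on [0, 1]
    and of t^-alpha on [1, oo[, stopping after a positive term; integrating termwise
    and setting a = 1 / alpha leaves a partial sum of
    a sum_n (-1)^n (1 / (n + a) + 1 / (n + 1 - a)), which is compared with
    a pi / sin (pi a) ([csc_series_le]). For that comparison, iterating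
    3 csc 3x = csc x - csc (x + pi/3) + csc (x + 2 pi/3) writes csc (m x), for m a
    power of 3, as a finite alternating sum of cosecants ([csc_sum]); its terms,
    paired symmetrically, decrease, so any even number of them stays below the
    whole, and m goes to infinity.

    Null means. The hypotheses bound means of suprema over sliding windows, which
    are only semicontinuous functions of time. They are traded for [block_null]:
    on the blocks of length r / 2 the function is bounded by the terms of a
    sequence with small Cesaro means ([block_null_of_mean],
    [mean_null_of_blocks]). This notion passes to every quantity that
    depends, up to a small error, on a bounded past ([block_null_causal]), in
    particular to convolutions with [S], whose kernel has small tails
    ([Sconv_increment_null]).

    Continuity at time 0. The right-hand side of the equation meets the initial
    history continuously only because [S 0] is the identity
    ([solution_operator_0]). For x in the domain, l times the Laplace transform of
    S(.) x at l tends to S 0 x as l grows, and equals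
    l^alpha (l^alpha - A)^-1 x = x + (l^alpha - A)^-1 A x, which tends to x by the
    resolvent estimate; the domain is dense. *)


Set Implicit Arguments.
Unset Strict Implicit.
Unset Printing Implicit Defensive.

(** * Norms, completeness and continuity *)

Lemma le_eps (R : realType) (x y : R) : (forall e : R, 0 < e -> x <= y + e) -> x <= y.
Proof. by move=> h; apply/ler_addgt0Pr => e; exact: h. Qed.

Section Norm.
Variables (R : realType) (V : normedZmodType R[i]).
Implicit Types x y : V.

Lemma nrmE x : (nrm x)%:C = `|x|.
Proof. by rewrite /nrm; apply: RRe_real; apply: normr_real. Qed.

Lemma nrm_ge0 x : 0 <= nrm x.
Proof. by rewrite -lecR nrmE normr_ge0. Qed.

Lemma nrm0 : nrm (0 : V) = 0.
Proof. by apply: complexI; rewrite nrmE normr0. Qed.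

Lemma nrm_eq0 x : nrm x = 0 -> x = 0.
Proof. by move=> h; apply/eqP; rewrite -normr_eq0 -nrmE h. Qed.

Lemma nrmN x : nrm (- x) = nrm x.
Proof. by rewrite /nrm normrN. Qed.

Lemma nrmB x y : nrm (x - y) = nrm (y - x).
Proof. by rewrite /nrm distrC. Qed.

Lemma nrmD x y : nrm (x + y) <= nrm x + nrm y.
Proof. by rewrite -lecR rmorphD /= !nrmE ler_normD. Qed.

Lemma nrm_sum (I : Type) (s : seq I) (P : pred I) (F : I -> V) :
  nrm (\sum_(i <- s | P i) F i) <= \sum_(i <- s | P i) nrm (F i).
Proof.
elim/big_rec2: _ => [|i y x _ h]; first by rewrite nrm0.
by apply: (le_trans (nrmD _ _)); rewrite lerD2l.
Qed.

Lemma nrm_dist y x z : nrm (x - z) <= nrm (x - y) + nrm (y - z).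
Proof. by rewrite -[x - z](subrKA y); apply: nrmD. Qed.

End Norm.

Section NormedModule.
Variables (R : realType) (X : completeNormedModType R[i]).
Implicit Types x y : X.

Lemma nrmZ (a : R) x : nrm (a%:C *: x) = `|a| * nrm x.
Proof.
apply: complexI; rewrite rmorphM /= !nrmE normrZ; congr (_ * _).
by rewrite normc_def /= expr0n addr0 sqrtr_sqr.
Qed.

Lemma nrmZ_ge0 (a : R) x : 0 <= a -> nrm (a%:C *: x) = a * nrm x.
Proof. by move=> a0; rewrite nrmZ ger0_norm. Qed.

Lemma nrm_small x : (forall e : R, 0 < e -> nrm x <= e) -> x = 0.
Proof.
move=> h; apply/nrm_eq0/eqP; rewrite eq_le nrm_ge0 andbT.
by apply/ler_addgt0Pl => e e0; rewrite addr0; exact: h.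
Qed.

(** Limits in [X] are governed by positive radii in R[i], which are exactly
    the positive reals. *)
Lemma cvg_nrm {T : Type} {F : set_system T} {FF : Filter F} (u : T -> X) (l : X) :
  u @ F --> l <-> forall e : R, 0 < e -> \forall t \near F, nrm (u t - l) < e.
Proof.
rewrite cvgrPdist_lt; split=> h e e0.
  have := h e%:C; rewrite ltcR => /(_ e0); apply: filterS => t.
  by rewrite -nrmE ltcR nrmB.
have eE : e = (complex.Re e)%:C.
  by rewrite RRe_real //; apply: gtr0_real.
move: e0; rewrite eE ltcR => /h; apply: filterS => t.
by rewrite -[`|_|]nrmE ltcR nrmB.
Qed.

Lemma nrm_complete (u : nat -> X) :
  (forall e : R, 0 < e ->
     exists N, forall n m, (N <= n)%N -> (N <= m)%N -> nrm (u n - u m) < e) ->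
  exists l, forall e : R, 0 < e ->
     exists N, forall n, (N <= n)%N -> nrm (u n - l) < e.
Proof.
move=> cu; have : cauchy (u @ \oo).
  apply/cauchy_ballP => e e0.
  have eE : e = (complex.Re e)%:C by rewrite RRe_real //; apply: gtr0_real.
  move: (e0); rewrite eE ltcR => /cu [N hN].
  exists (u @` [set n | (N <= n)%N], u @` [set n | (N <= n)%N]) => /=.
    by split; exists N => // n Nn; exists n.
  move=> [_ _] /= [[n Nn <-] [m Nm <-]]; rewrite -ball_normE /ball_ /= -[`|_|]nrmE ltcR.
  exact: hN.
move=> /cauchy_cvg /cvg_ex [l /cvg_nrm hl]; exists l => e /hl [N _ hN].
by exists N => n; exact: hN.
Qed.

(** Epsilon-delta continuity relative to [A], in terms of the real-valued norm;
    equivalent to [{within A, continuous h}] by [within_cont_on]. *)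
Definition cont_on (A : set R) (h : R -> X) := forall t0, A t0 ->
  forall e : R, 0 < e -> exists2 d : R, 0 < d &
    forall t, A t -> `|t - t0| < d -> nrm (h t - h t0) < e.

Lemma within_cont_on (A : set R) (h : R -> X) :
  {within A, continuous h} <-> cont_on A h.
Proof.
rewrite subspace_continuousP; split=> ch t0 At0; last first.
  apply/cvg_nrm => e /(ch t0 At0) [d d0 hd]; rewrite near_withinE.
  apply/nbhs_ballP; exists d => //= t; rewrite -ball_normE /ball_ /= distrC => td At.
  exact: hd.
move=> e e0; have /cvg_nrm /(_ e e0) := ch t0 At0.
rewrite near_withinE => /nbhs_ballP [d /= d0 hd]; exists d => // t At td.
by apply: hd => //; rewrite -ball_normE /ball_ /= distrC.
Qed.

Lemma cont_onS (A B : set R) (h : R -> X) : A `<=` B -> cont_on B h -> cont_on A h.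
Proof.
move=> AB hB t0 /AB Bt0 e /(hB t0 Bt0) [d d0 hd].
by exists d => // t /AB; exact: hd.
Qed.

(** The Heine-Cantor theorem: by the near-covering form of compactness of the
    segment, a radius valid near each point yields one valid everywhere. *)
Lemma unif_cont (a b : R) (h : R -> X) : cont_on `[a, b] h ->
  forall e : R, 0 < e -> exists2 d : R, 0 < d &
    forall s t, s \in `[a, b] -> t \in `[a, b] -> `|s - t| < d ->
      nrm (h s - h t) < e.
Proof.
move=> ch e e0.
have /compact_near_coveringP cov := @segment_compact R a b.
have := cov R (0^'+)
  (fun (d : R) (s : R) => s \in `[a, b] -> forall t, t \in `[a, b] -> `|s - t| < d ->
      nrm (h s - h t) < e) _.
case.
  move=> s0 s0ab; have e20 : 0 < e / 2 by rewrite divr_gt0.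
  have [d d0 hd] := ch s0 s0ab _ e20.
  have d20 : 0 < d / 2 by rewrite divr_gt0.
  exists (ball s0 (d / 2), [set x : R | x < d / 2]).
    split; first by apply/nbhs_ballP; exists (d / 2).
    by apply: nbhs_right_lt.
  move=> [s x] /= [+ xd] sab t tab st; rewrite -ball_normE /ball_ /= => ss0.
  apply: (le_lt_trans (nrm_dist (h s0) _ _)).
  rewrite (splitr e) ltrD //.
    by apply: hd => //; rewrite distrC; apply: (lt_trans ss0); lra.
  rewrite nrmB; apply: hd => //.
  have := ler_distD s t s0; rewrite (distrC t s) (distrC s s0) => /le_lt_trans; apply.
  lra.
move=> d /= d0 hd; exists (d / 2); first by rewrite divr_gt0.
move=> s t sab tab st; apply: (hd (d / 2)) => //=.
  by rewrite sub0r normrN ger0_norm; lra.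
lra.
Qed.

End NormedModule.

(** * The Riemann integral *)

Section Partitions.
Variable R : realType.
Implicit Types (a b d : R) (t : nat -> R).

Lemma partition_le n t : (forall i, (i < n)%N -> t i <= t i.+1) ->
  forall i j, (i <= j <= n)%N -> t i <= t j.
Proof.
move=> ht i; elim=> [|j IH]; first by rewrite leqn0 => /andP[/eqP ->].
move=> /andP[]; rewrite leq_eqVlt => /predU1P[<- //|ij jn].
by apply: (le_trans (IH _) (ht _ jn)); rewrite -ltnS ij ltnW.
Qed.

Lemma fine_partition a b d : a <= b -> 0 < d ->
  exists n t, [/\ t 0%N = a, t n = b &
    forall i, (i < n)%N -> t i <= t i.+1 /\ t i.+1 - t i < d].
Proof.
move=> ab d0; pose n := (Num.truncn ((b - a) / d)).+1.
have n0 : (0 : R) < n%:R by rewrite ltr0n.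
have step i : (a + i.+1%:R * ((b - a) / n%:R)) - (a + i%:R * ((b - a) / n%:R))
    = (b - a) / n%:R.
  by rewrite -[i.+1]addn1 natrD; ring.
exists n, (fun i => a + i%:R * ((b - a) / n%:R)); split.
- by rewrite mul0r addr0.
- by rewrite mulrCA divff ?gt_eqF // mulr1 addrC subrK.
move=> i _; rewrite step; split.
  by rewrite -subr_ge0 step divr_ge0 ?subr_ge0 // ltW.
rewrite ltr_pdivrMr // mulrC -ltr_pdivrMr //.
by apply: truncnS_gt.
Qed.

End Partitions.

Section Rint.
Variables (R : realType) (X : completeNormedModType R[i]).
Implicit Types (h : R -> X) (a b d e : R) (y : X).

Lemma realcB (x y : R) : (x - y)%:C = x%:C - y%:C.
Proof. by rewrite rmorphB. Qed.

Lemma sub_sub (V : zmodType) (x y z w : V) : x - y - (z - w) = x - z - (y - w).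
Proof. by rewrite !opprB [w - z]addrC addrACA [- y + w]addrC. Qed.

Lemma eq_is_rint h1 h2 a b y : (forall s, a <= s <= b -> h1 s = h2 s) ->
  is_rint h1 a b y -> is_rint h2 a b y.
Proof.
move=> h12 [ab hy]; split=> // e /hy [d d0 hd]; exists d => // n t c ta tb tc.
suff -> : \sum_(i < n) (t i.+1 - t i)%:C *: h2 (c i) =
          \sum_(i < n) (t i.+1 - t i)%:C *: h1 (c i) by exact: hd.
apply: eq_bigr => i _; rewrite h12 //.
have [/andP[tc1 tc2] _] := tc _ (ltn_ord i).
have mono : forall i, (i < n)%N -> t i <= t i.+1.
  by move=> j /tc[/andP[h1' h2'] _]; apply: le_trans h1' h2'.
rewrite -ta -tb (le_trans _ tc1) /=.
  by rewrite (le_trans tc2) // (partition_le mono) // ltn_ord /=.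
by rewrite (partition_le mono) //= ltnW.
Qed.

(** Tags may be chosen at will, which is how the value of an integral is
    computed or estimated from its Riemann sums. *)
Lemma is_rint_tags h a b y (P : R -> R -> R -> Prop) :
  (forall u v, a <= u -> u <= v -> v <= b -> exists2 c, u <= c <= v & P u v c) ->
  is_rint h a b y ->
  forall e, 0 < e -> exists n t c, [/\ t 0%N = a, t n = b,
    forall i, (i < n)%N -> [/\ t i <= c i <= t i.+1, a <= t i, t i.+1 <= b &
       P (t i) (t i.+1) (c i)] &
    nrm (\sum_(i < n) (t i.+1 - t i)%:C *: h (c i) - y) < e].
Proof.
move=> hP [ab hy] e /hy [d d0 hd].
have [n [t [ta tb ht]]] := fine_partition ab d0.
have mono : forall i, (i < n)%N -> t i <= t i.+1 by move=> i /ht[].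
have bnd i : (i < n)%N -> a <= t i /\ t i.+1 <= b.
  move=> ni; split; [rewrite -ta|rewrite -tb]; apply: (partition_le mono).
    by rewrite /= ltnW.
  by rewrite ni leqnn.
have /choice [c hc] : forall i, exists c, (i < n)%N ->
    t i <= c <= t i.+1 /\ P (t i) (t i.+1) c.
  move=> i; case: (ltnP i n) => ni; last by exists 0.
  have [ati tib] := bnd _ ni.
  by have [c c1 c2] := hP _ _ ati (mono _ ni) tib; exists c.
exists n, t, c; split=> //.
  by move=> i ni; have [h1 h2] := hc _ ni; have [h3 h4] := bnd _ ni.
apply: hd => // i ni; have [h1 h2] := hc _ ni; split=> //.
by have [] := ht _ ni.
Qed.

Lemma is_rintB h1 h2 a b y1 y2 : is_rint h1 a b y1 -> is_rint h2 a b y2 ->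
  is_rint (fun s => h1 s - h2 s) a b (y1 - y2).
Proof.
move=> [ab hy1] [_ hy2]; split=> // e e0.
have e20 : 0 < e / 2 by rewrite divr_gt0.
have [d1 d10 hd1] := hy1 _ e20; have [d2 d20 hd2] := hy2 _ e20.
exists (Num.min d1 d2); first by rewrite lt_min d10.
move=> n t c ta tb tc; rewrite (splitr e).
have -> : \sum_(i < n) (t i.+1 - t i)%:C *: (h1 (c i) - h2 (c i)) - (y1 - y2) =
    (\sum_(i < n) (t i.+1 - t i)%:C *: h1 (c i) - y1) +
    - (\sum_(i < n) (t i.+1 - t i)%:C *: h2 (c i) - y2).
  under eq_bigr do rewrite scalerBr.
  by rewrite sumrB sub_sub.
apply: (le_lt_trans (nrmD _ _)); rewrite nrmN ltrD //.
  by apply: hd1 => // i /tc[h1' h2']; split=> //; rewrite (lt_le_trans h2') // ge_min lexx.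
by apply: hd2 => // i /tc[h1' h2']; split=> //; rewrite (lt_le_trans h2') // ge_min lexx orbT.
Qed.

(** The mean value inequality for integrals: with the tags supplied by the second
    hypothesis, the Riemann sums of [g] are at most the increment of [G]. The
    hypothesis holds for instance if [G] has derivative [g]. *)
Lemma is_rint_le h (g G : R -> R) a b y :
  (forall s, a <= s <= b -> nrm (h s) <= g s) ->
  (forall u v, a <= u -> u <= v -> v <= b ->
     exists2 c, u <= c <= v & (v - u) * g c <= G v - G u) ->
  is_rint h a b y -> nrm y <= G b - G a.
Proof.
move=> hg hG hy; apply: le_eps => e e0.
have [n [t [c [ta tb htc hs]]]] := is_rint_tags hG hy e0.
have -> : y = \sum_(i < n) (t i.+1 - t i)%:C *: h (c i)
             - (\sum_(i < n) (t i.+1 - t i)%:C *: h (c i) - y).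
  by rewrite opprB addrC subrK.
apply: (le_trans (nrmD _ _)); rewrite nrmN lerD //; last exact: ltW.
apply: (le_trans (nrm_sum _ _ _)).
rewrite -ta -tb -(telescope_sumr (fun i => G (t i)) (leq0n n)) big_mkord; apply: ler_sum => i _.
have [/andP[c1 c2] h1 h2 h3] := htc _ (ltn_ord i).
have t0 : 0 <= t i.+1 - t i by rewrite subr_ge0 (le_trans c1 c2).
apply: le_trans h3; rewrite nrmZ_ge0 // ler_wpM2l // hg //.
by rewrite (le_trans h1 c1) (le_trans c2 h2).
Qed.

(** The difference of two values is an integral of the zero function. *)
Lemma is_rint_unique h a b y1 y2 : is_rint h a b y1 -> is_rint h a b y2 -> y1 = y2.
Proof.
move=> h1 h2; apply/eqP; rewrite -subr_eq0; apply/eqP/nrm_small => e e0.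
have := is_rint_le (g := fun=> 0) (G := fun=> 0) _ _ (is_rintB h1 h2).
rewrite subrr => hle; apply: (le_trans (hle _ _)); last exact: ltW.
  by move=> s _; rewrite subrr nrm0.
by move=> u v _ uv _; exists u; [rewrite lexx|rewrite mulr0].
Qed.

(** Reversing a tagged partition of [[0, T]] gives another one, with the same
    sum. *)
Lemma is_rint_rev h T y : is_rint h 0 T y -> is_rint (fun s => h (T - s)) 0 T y.
Proof.
move=> [T0 hy]; split=> // e /hy [d d0 hd]; exists d => // n t c t0 tn htc.
have := hd n (fun i => T - t (n - i)%N) (fun i => T - c (n - i.+1)%N).
rewrite subn0 tn subrr subnn t0 subr0 => /(_ erefl erefl).
set S1 := \sum_(i < n) _; set S2 := \sum_(i < n) _.
have -> : S1 = S2; last first.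
  apply=> i ni; have nin : (n - i.+1 < n)%N by rewrite ltn_subrL (leq_ltn_trans _ ni).
  have := htc _ nin; rewrite -subSn // subSS => -[/andP[h1 h2] h3].
  split; first by apply/andP; split; lra.
  lra.
rewrite /S1 (reindex_inj rev_ord_inj) /=; apply: eq_bigr => i _.
have e1 : (n - (n - i.+1))%N = i.+1 by rewrite subKn.
have e2 : (n - (n - i.+1).+1)%N = i by rewrite -subSn // subSS subKn // ltnW.
by rewrite e1 e2; congr (_%:C *: _); rewrite opprB addrC addrA subrK addrC.
Qed.

(** ** Existence, through a primitive that is the limit of those of step functions *)

(** [J] is, up to [e] per unit of length and at scale [d], a primitive of [h].
    The point [c] is arbitrary in [[u, v]] so that it can be any tag. *)
Definition approx_prim h a b d e (J : R -> X) :=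
  forall u c v, a <= u -> u <= c -> c <= v -> v <= b -> v - u < d ->
    nrm ((v - u)%:C *: h c - (J v - J u)) <= (v - u) * e.

(** The defects of an approximate primitive add up, so that any two approximate
    primitives of the same function are close, being close to the same Riemann
    sum. *)
Lemma approx_prim_sum h a b d e J n t c : approx_prim h a b d e J ->
  (forall i, (i < n)%N -> t i <= c i <= t i.+1 /\ t i.+1 - t i < d) ->
  a <= t 0%N -> t n <= b ->
  nrm (\sum_(i < n) (t i.+1 - t i)%:C *: h (c i) - (J (t n) - J (t 0%N)))
    <= (t n - t 0%N) * e.
Proof.
move=> hJ htc a0 tb.
have mono : forall i, (i < n)%N -> t i <= t i.+1.
  by move=> j /htc[/andP[h1' h2'] _]; apply: le_trans h1' h2'.
rewrite -(telescope_sumr (fun i => J (t i)) (leq0n n)) -(telescope_sumr t (leq0n n)).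
rewrite !big_mkord -sumrB mulr_suml; apply: (le_trans (nrm_sum _ _ _)).
apply: ler_sum => i _; have [/andP[h1 h2] h3] := htc _ (ltn_ord i).
apply: hJ => //.
  by rewrite (le_trans a0) // (partition_le mono) //= ltnW.
by rewrite (le_trans _ tb) // (partition_le mono) // ltn_ord /=.
Qed.

(** For u <= v, the increment between [u] and [v] of the map x |-> min x s' - min x s is
    the length of [[u, v]] inside [[s, s']]; it vanishes unless the two meet. *)
Lemma increment_min (u v s s' : R) : u <= v -> s <= s' ->
  0 <= (Num.min v s' - Num.min v s) - (Num.min u s' - Num.min u s) /\
  ((Num.min v s' - Num.min v s) - (Num.min u s' - Num.min u s) != 0 ->
    u < s' /\ s < v).
Proof.
move=> uv ss; case: (leP v s') => h1; case: (leP v s) => h2;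
  case: (leP u s') => h3; case: (leP u s) => h4; split; try lra;
  by move=> h; split; rewrite ltNge; apply/negP => h5; move/eqP: h; lra.
Qed.

Lemma ler_wpM2l_neq0 (w x z : R) : 0 <= w -> (w != 0 -> x <= z) -> w * x <= w * z.
Proof.
by move=> w0 h; have [->|/h] := eqVneq w 0; rewrite ?mul0r // => /(ler_wpM2l w0).
Qed.

(** The exact primitive of the step function taking on each cell of a fine
    partition the value of [h] at the left end. *)
Lemma step_prim h a b : a <= b -> cont_on `[a, b] h ->
  forall e, 0 < e -> exists d, exists2 J : R -> X, 0 < d & approx_prim h a b d e J.
Proof.
move=> ab /unif_cont ch e /ch [d d0 hd].
have d20 : 0 < d / 2 by rewrite divr_gt0.
have [n [t [ta tb ht]]] := fine_partition ab d20.
have mono : forall i, (i < n)%N -> t i <= t i.+1 by move=> i /ht[].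
exists (d / 2), (fun x => \sum_(i < n) (Num.min x (t i.+1) - Num.min x (t i))%:C *: h (t i)) => //.
move=> u c v au uc cv vb vu.
have sumE x : a <= x <= b ->
    \sum_(i < n) (Num.min x (t i.+1) - Num.min x (t i)) = x - a.
  move=> /andP[ax xb].
  rewrite -(big_mkord xpredT (fun i => Num.min x (t i.+1) - Num.min x (t i))).
  by rewrite (telescope_sumr (fun i => Num.min x (t i))) // ta tb (min_idPl xb) (min_idPr ax).
have vuE : v - u = \sum_(i < n) ((Num.min v (t i.+1) - Num.min v (t i))
     - (Num.min u (t i.+1) - Num.min u (t i))).
  rewrite sumrB !sumE; [ring| |].
    by rewrite au (le_trans uc) // (le_trans cv).
  by rewrite vb (le_trans au) // (le_trans uc).
rewrite vuE -sumrB rmorph_sum scaler_suml -sumrB mulr_suml.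
apply: (le_trans (nrm_sum _ _ _)); apply: ler_sum => i _.
rewrite -scalerBl -realcB -scalerBr.
have [h0 h1] := increment_min (le_trans uc cv) (mono _ (ltn_ord i)).
rewrite nrmZ_ge0 //; apply: ler_wpM2l_neq0 => // /h1[h2 h3].
apply/ltW/hd.
- by rewrite in_itv /= (le_trans au uc) (le_trans cv vb).
- rewrite in_itv /= -ta -tb; apply/andP; split; apply: (partition_le mono).
    exact: ltnW.
  by rewrite leqnn andbT ltnW.
- have [_ h4] := ht _ (ltn_ord i).
  rewrite ltr_norml; apply/andP; split; lra.
Qed.

(** Approximate primitives with errors tending to 0 form a Cauchy sequence at every
    point, since two of them are compared through a common Riemann sum; their limit is
    a primitive, which makes the integral additive over intervals. *)
Lemma primitive_exists h a b : a <= b -> cont_on `[a, b] h ->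
  exists J : R -> X, forall u v, a <= u -> u <= v -> v <= b -> is_rint h u v (J v - J u).
Proof.
move=> ab ch.
have /choice [dJ hdJ] : forall n : nat, exists dJ : R * (R -> X),
    0 < dJ.1 /\ approx_prim h a b dJ.1 (n.+1%:R^-1) dJ.2.
  move=> n; have n0 : (0 : R) < n.+1%:R^-1 by rewrite invr_gt0.
  by have [d [J h1 h2]] := step_prim ab ch n0; exists (d, J).
pose J n x := (dJ n).2 x - (dJ n).2 a.
have JP n : approx_prim h a b (dJ n).1 (n.+1%:R^-1) (J n).
  move=> u c v au uc cv vb vu.
  have -> : J n v - J n u = (dJ n).2 v - (dJ n).2 u by rewrite /J opprB addrA subrK.
  exact: (hdJ n).2.
have Jcmp n m x : a <= x <= b ->
    nrm (J n x - J m x) <= (b - a) * (n.+1%:R^-1 + m.+1%:R^-1).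
  move=> /andP[ax xb].
  have d0 : 0 < Num.min (dJ n).1 (dJ m).1 by rewrite lt_min (hdJ n).1 (hdJ m).1.
  have [N [t [ta tx ht]]] := fine_partition ax d0.
  have part k : Num.min (dJ n).1 (dJ m).1 <= (dJ k).1 ->
      nrm (\sum_(i < N) (t i.+1 - t i)%:C *: h (t i) - J k x) <= (b - a) * k.+1%:R^-1.
    move=> dk; have := approx_prim_sum (c := t) (n := N) (t := t) (JP k).
    rewrite ta tx [J k a]/J subrr subr0 => hk; apply: (le_trans (hk _ _ _)) => //.
      move=> i /ht[h1 h2]; rewrite lexx h1; split=> //.
      exact: lt_le_trans h2 dk.
    by rewrite ler_wpM2r ?invr_ge0 // lerD2r.
  rewrite mulrDr; apply: (le_trans (nrm_dist (\sum_(i < N) (t i.+1 - t i)%:C *: h (t i)) _ _)).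
  by rewrite lerD //; [rewrite nrmB|]; apply: part; rewrite ge_min lexx ?orbT.
have small e : 0 < e -> exists N, forall n, (N <= n)%N -> (b - a) * n.+1%:R^-1 < e.
  move=> e0; exists (Num.truncn ((b - a) / e)) => n Nn.
  rewrite ltr_pdivrMr ?ltr0n // mulrC -ltr_pdivrMr //.
  by apply: (lt_le_trans (truncnS_gt _)); rewrite ler_nat.
have /choice [L hL] : forall x, exists l, a <= x <= b -> forall e, 0 < e ->
    exists N, forall n, (N <= n)%N -> nrm (J n x - l) < e.
  move=> x; case: (boolP (a <= x <= b)) => xab; last by exists 0.
  have [|l hl] := @nrm_complete _ X (J ^~ x); last by exists l.
  move=> e e0; have e20 : 0 < e / 2 by rewrite divr_gt0.
  have [N hN] := small _ e20; exists N => n m Nn Nm.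
  apply: (le_lt_trans (Jcmp n m x xab)); rewrite mulrDr (splitr e).
  by apply: ltrD; apply: hN.
have LJ x n : a <= x <= b -> nrm (L x - J n x) <= (b - a) * n.+1%:R^-1.
  move=> xab; apply: le_eps => e e0.
  have e20 : 0 < e / 2 by rewrite divr_gt0.
  have [N1 hN1] := hL _ xab _ e20; have [N2 hN2] := small _ e20.
  set k := maxn N1 N2.
  apply: (le_trans (nrm_dist (J k x) _ _)).
  have h1 := hN1 k (leq_maxl _ _); have h2 := hN2 k (leq_maxr _ _).
  have h3 := Jcmp k n x xab; rewrite nrmB.
  rewrite mulrDr in h3; move: h1 h2 h3; move: (nrm _) (nrm _) (_ * k.+1%:R^-1) (_ * n.+1%:R^-1) => A1 A2 A3 A4 ? ? ?. lra.
exists L => u v au uv vb; split=> // e e0.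
have e40 : 0 < e / 4 by rewrite divr_gt0.
have [N hN] := small _ e40.
exists (dJ N).1; first exact: (hdJ N).1.
move=> n t c tu tv htc.
have := approx_prim_sum (JP N) htc; rewrite tu tv => /(_ au vb) h1.
have h2 := LJ u N; have h3 := LJ v N; have h4 := hN N (leqnn _).
have h5 : (v - u) * N.+1%:R^-1 <= (b - a) * N.+1%:R^-1.
  by rewrite ler_wpM2r ?invr_ge0 //; lra.
apply: (le_lt_trans (nrm_dist (J N v - J N u) _ _)).
have h6 : nrm (J N v - J N u - (L v - L u)) <= nrm (L v - J N v) + nrm (L u - J N u).
  rewrite sub_sub (nrmB (L v)) (nrmB (L u)).
  by apply: (le_trans (nrmD _ _)); rewrite nrmN.
have ua : a <= u <= b by rewrite au (le_trans uv vb).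
have va : a <= v <= b by rewrite vb (le_trans au uv).
move: (h2 ua) (h3 va) h1 h4 h5 h6 => {h2 h3}.
move: (nrm (L u - _)) (nrm (L v - _)) ((b - a) * _) ((v - u) * _) => A1 A2 A3 A4.
move: (nrm _) (nrm _) => B1 B2 ? ? ? ? ? ?; lra.
Qed.

Lemma is_rint_exists h a b : a <= b -> cont_on `[a, b] h -> exists y, is_rint h a b y.
Proof.
by move=> ab /(primitive_exists ab) [J hJ]; exists (J b - J a); exact: hJ.
Qed.

(** All three integrals are increments of the same primitive. *)
Lemma is_rint_chasles h a b c y1 y2 y : a <= b -> b <= c -> cont_on `[a, c] h ->
  is_rint h a b y1 -> is_rint h b c y2 -> is_rint h a c y -> y = y1 + y2.
Proof.
move=> ab bc /(primitive_exists (le_trans ab bc)) [J hJ] h1 h2 h3.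
rewrite (is_rint_unique h1 (hJ _ _ _ ab bc)) //.
rewrite (is_rint_unique h2 (hJ _ _ ab bc _)) //.
rewrite (is_rint_unique h3 (hJ _ _ _ (le_trans ab bc) _)) //.
by rewrite [RHS]addrC addrA subrK.
Qed.

End Rint.

(** * The cosecant series *)

Section Cosecant.
Variable R : realType.
Implicit Types (d : nat -> R) (a x : R).

(** Consecutive terms pair off from the first one on; a last unpaired term is
    positive. *)
Lemma alternating_sum_ge0 n d : (forall i, (i < n)%N -> 0 <= d i) ->
  (forall i, (i.+1 < n)%N -> d i.+1 <= d i) ->
  0 <= \sum_(i < n) (-1) ^+ i * d i.
Proof.
have [k] := ubnP n; elim: k n d => // k IH [|[|n]] d nk d0 dd.
- by rewrite big_ord0.
- by rewrite big_ord_recl big_ord0 expr0 mul1r addr0 d0.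
rewrite 2!big_ord_recl /= expr0 mul1r expr1 mulN1r addrA addr_ge0 //.
  by rewrite subr_ge0 dd.
under eq_bigr => i _ do rewrite /bump /= add1n add1n !exprS mulrA mulN1r opprK mul1r.
apply: (IH n (fun i => d i.+2)).
- by rewrite ltnS in nk; apply: ltnW.
- by move=> i ni; apply: d0; rewrite !ltnS.
- by move=> i ni; apply: dd; rewrite !ltnS.
Qed.

Lemma alternating_sum_le p q d : (forall i, (i < p.*2 + q)%N -> 0 <= d i) ->
  (forall i, (i.+1 < p.*2 + q)%N -> d i.+1 <= d i) ->
  \sum_(i < p.*2) (-1) ^+ i * d i <= \sum_(i < p.*2 + q) (-1) ^+ i * d i.
Proof.
move=> d0 dd; rewrite big_split_ord /= lerDl.
under eq_bigr => i _ do rewrite exprD -mul2n exprM sqrrN expr1n expr1n mul1r.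
rewrite mul2n; apply: (alternating_sum_ge0 (d := fun i => d (p.*2 + i)%N)) => i ni.
  by apply: d0; rewrite ltn_add2l.
by rewrite addnS; apply: dd; rewrite -addnS ltn_add2l.
Qed.

(** c = cos (pi/3) satisfies (c + 1) (2 c - 1)^2 = 0, because
    4 c^3 - 3 c = cos pi = -1. *)
Lemma pi3 : cos (pi / 3 : R) = 2^-1 /\ sin (pi / 3 : R) ^+ 2 = 3 / 4.
Proof.
have p0 := @pi_gt0 R.
have c0 : 0 < cos (pi / 3 : R).
  by apply: cos_gt0_pihalf; apply/andP; split; lra.
have e3 : pi = pi / 3 + (pi / 3 + pi / 3) :> R by lra.
have : cos (pi / 3 + (pi / 3 + pi / 3)) = -1 :> R by rewrite -e3 cospi.
rewrite !(cosD, sinD).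
have s2 := sin2cos2 (pi / 3 : R); move: c0 s2.
set c := cos _; set s := sin _ => c0 s2 h.
have cE : c = 2^-1.
  have : (c + 1) * (2 * c - 1) ^+ 2 = 0.
    have -> : (c + 1) * (2 * c - 1) ^+ 2 = c * (c * c - s ^+ 2) - 2 * s ^+ 2 * c + 1.
      by rewrite s2; ring.
    have -> : c * (c * c - s ^+ 2) - 2 * s ^+ 2 * c = -1 by rewrite -h; ring.
    by rewrite addNr.
  move=> /eqP; rewrite mulf_eq0 expf_eq0 /= => /orP[/eqP|/eqP]; lra.
split; first exact: cE.
by rewrite s2 cE; lra.
Qed.

(** With s = sin x, p = sin (x + pi/3) and p - s = sin (x + 2 pi/3), this is the
    triplication formula for the cosecant. Both sides also agree when a
    denominator vanishes, as 1/0 = 0. *)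
Lemma csc_triple_alg (s p : R) : s ^+ 2 = 3 / 4 - p * (p - s) ->
  s^-1 - p^-1 + (p - s)^-1 = 3 / (4 * s * p * (p - s)).
Proof.
move=> pq.
have [->|sn] := eqVneq s 0; first by rewrite invr0 add0r subr0 addNr mulr0 !mul0r invr0 mulr0.
have [->|pn] := eqVneq p 0; first by rewrite invr0 subr0 sub0r invrN subrr mulr0 mul0r invr0 mulr0.
have [ps|qn] := eqVneq (p - s) 0.
  have -> : p = s by apply/eqP; rewrite -subr_eq0 ps.
  by rewrite !subrr mulr0 invr0 mulr0 addr0.
apply/eqP; rewrite -subr_eq0; apply/eqP.
have -> : s^-1 - p^-1 + (p - s)^-1 - 3 / (4 * s * p * (p - s)) =
  (p * (p - s) + s ^+ 2 - 3 / 4) / (s * p * (p - s)).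
  by field; rewrite sn pn qn.
by rewrite pq addrCA subrr addr0 subrr mul0r.
Qed.

Lemma csc_triple x :
  (sin x)^-1 - (sin (x + pi / 3))^-1 + (sin (x + pi / 3 + pi / 3))^-1
    = 3 / sin (3 * x).
Proof.
have [c3 s3] := pi3.
have -> : 3 * x = x + (x + x) by lra.
rewrite -(addrA x) !(sinD, cosD) c3.
move: s3 (sin2cos2 x); set t := sin (pi / 3); set s := sin x; set c := cos x.
move=> t2 s2.
set p := s * 2^-1 + c * t.
have -> : s * (2^-1 * 2^-1 - t * t) + c * (t * 2^-1 + 2^-1 * t) = p - s.
  by rewrite /p -[t * t]expr2 t2; field.
have -> : s * (c * c - s * s) + c * (s * c + c * s) = 4 * s * p * (p - s).
  rewrite /p.
  have -> : 4 * s * (s / 2 + c * t) * (s / 2 + c * t - s) =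
    s * (4 * c ^+ 2 * t ^+ 2 - s ^+ 2) by field.
  by rewrite t2; field.
have pq : s ^+ 2 = 3 / 4 - p * (p - s).
  have -> : p * (p - s) = c ^+ 2 * t ^+ 2 - s ^+ 2 / 4 by rewrite /p; field.
  rewrite t2; move: s2; move: (s ^+ 2) (c ^+ 2) => ? ? ?; lra.
exact: csc_triple_alg.
Qed.

Lemma signr_mulnD (m k i : nat) : odd m -> (-1) ^+ (k + i * m) = (-1) ^+ k * (-1) ^+ i :> R.
Proof. by move=> om; rewrite exprD mulnC exprM -[(-1) ^+ m]signr_odd om expr1. Qed.

(** Iterated triplication: the sum over k < 3 m splits according to the quotient
    of k by m, and since m is odd the three parts carry the signs of [csc_triple]. *)
Lemma csc_sum j x :
  \sum_(k < 3 ^ j) (-1) ^+ k * (sin (x + k%:R * (pi / (3 ^ j)%:R)))^-1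
    = (3 ^ j)%:R / sin ((3 ^ j)%:R * x).
Proof.
elim: j x => [|j IH] x; first by rewrite expn0 big_ord_recl big_ord0 !mul1r mul0r !addr0.
have m0 : (3 ^ j)%:R != 0 :> R by rewrite pnatr_eq0 expn_eq0.
have mE : (3 ^ j.+1)%:R = 3 * (3 ^ j)%:R :> R by rewrite expnS natrM.
have om : odd (3 ^ j) by rewrite oddX orbT.
rewrite mE -mulrA [3 * ((3 ^ j)%:R * x)]mulrCA -mulrA -(IH (3 * x)) mulr_sumr.
have -> : (3 ^ j.+1 = 3 ^ j + 3 ^ j + 3 ^ j)%N by rewrite expnS; lia.
rewrite !big_split_ord /= -!big_split /=; apply: eq_bigr => k _.
set h := pi / (3 * (3 ^ j)%:R).
have hE : (3 ^ j)%:R * h = pi / 3 by rewrite /h; field; rewrite m0.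
have h3 : pi / (3 ^ j)%:R = 3 * h by rewrite /h; field; rewrite m0.
have -> : 3 * x + k%:R * (pi / (3 ^ j)%:R) = 3 * (x + k%:R * h) by rewrite h3; ring.
rewrite [RHS]mulrCA -csc_triple.
have s1 : (-1) ^+ (3 ^ j + k) = - (-1) ^+ k :> R.
  by have := signr_mulnD k 1 om; rewrite mul1n addnC expr1 mulrN1.
have s2 : (-1) ^+ (3 ^ j + 3 ^ j + k) = (-1) ^+ k :> R.
  by have := signr_mulnD k 2 om; rewrite mulSn mul1n addnC sqrrN expr1n mulr1.
rewrite s1 s2 !natrD; move: (h) (pi / 3) hE => {h3} h q hE.
rewrite !(mulrDl _ _ h) hE !(mulrDr ((-1) ^+ k)) mulrN mulNr.
by congr (_ * (sin _)^-1 - _ * (sin _)^-1 + _ * (sin _)^-1); ring.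
Qed.

End Cosecant.

Section CosecantSeries.
Variable R : realType.
Implicit Types (a x h : R).

Lemma csc_ge0 x : 0 < x < pi -> 0 <= (sin x)^-1.
Proof. by move=> /sin_gt0_pi h; rewrite invr_ge0 ltW. Qed.

Lemma csc_le x y : 0 < x -> x <= y -> y <= pi / 2 -> (sin y)^-1 <= (sin x)^-1.
Proof.
move=> x0 xy yp; have p0 := @pi_gt0 R.
have sx : 0 < sin x by apply: sin_gt0_pi; apply/andP; split; lra.
have sy : 0 < sin y by apply: sin_gt0_pi; apply/andP; split; lra.
rewrite lef_pV2 ?posrE //.
move: xy; rewrite le_eqVlt => /predU1P[-> //|xy].
by apply/ltW; rewrite ltr_sin // in_itv /=; apply/andP; split; lra.
Qed.

(** Since (2 M + 1) h = pi, the terms n and 2 M - n have the same sign, and their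
    arguments are (n + a) h and pi - (n + 1 - a) h; the term M stays alone. *)
Lemma csc_pairing M h a : (M.*2.+1)%:R * h = pi ->
  \sum_(k < M.*2.+1) (-1) ^+ k * (sin (a * h + k%:R * h))^-1 =
  \sum_(n < M) (-1) ^+ n * ((sin ((n%:R + a) * h))^-1 + (sin ((n.+1%:R - a) * h))^-1)
  + (-1) ^+ M * (sin ((M%:R + a) * h))^-1.
Proof.
move=> hM; have -> : (M.*2.+1 = M.+1 + M)%N by lia.
rewrite big_split_ord /= big_ord_recr /= addrAC; congr (_ + _); last first.
  by congr (_ * (sin _)^-1); ring.
rewrite [X in _ + X](reindex_inj rev_ord_inj) -big_split /=; apply: eq_bigr => n _.
rewrite mulrDr; congr (_ + _); first by congr (_ * (sin _)^-1); ring.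
have nM := ltn_ord n.
have e : (M.+1 + (M - n.+1) + n = M.*2)%N by lia.
congr (_ * _^-1).
  have : (-1) ^+ (M.+1 + (M - n.+1) + n) = 1 :> R by rewrite e -signr_odd odd_double.
  by rewrite exprD => h1; apply: (mulIf (negbT (signr_eq0 R n))); rewrite h1 -expr2 sqrr_sign.
have eR : (M.+1 + (M - n.+1))%:R + n%:R + 1 = (M.*2.+1)%:R :> R.
  by rewrite -natrD e -natr1.
have -> : a * h + (M.+1 + (M - n.+1))%:R * h = - ((n.+1%:R - a) * h) + pi.
  by rewrite -hM -eR -[n.+1%:R]natr1; ring.
by rewrite sinDpi sinN opprK.
Qed.

(** The paired terms decrease as long as their arguments stay in ]0, pi/2], and
    the lone middle term is below the last pair: it is at most the first member if
    a <= 1/2, and at most the second one otherwise, after reflection at pi/2. *)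
Lemma csc_finite_bound N M h a : 0 < a < 1 -> (N.*2 <= M)%N ->
  (M.*2.+1)%:R * h = pi ->
  \sum_(n < N.*2) (-1) ^+ n * ((sin ((n%:R + a) * h))^-1 + (sin ((n.+1%:R - a) * h))^-1)
  <= \sum_(k < M.*2.+1) (-1) ^+ k * (sin (a * h + k%:R * h))^-1.
Proof.
move=> /andP[a0 a1] NM hM; rewrite csc_pairing //.
have p0 := @pi_gt0 R.
have h0 : 0 < h by rewrite -(pmulr_rgt0 _ (ltr0Sn R M.*2)) hM.
have hM2 : (2 * M%:R + 1) * h = pi by rewrite -hM -[M.*2.+1%:R]natr1 -[M.*2]mul2n natrM.
pose D n := if (n < M)%N then
    (sin ((n%:R + a) * h))^-1 + (sin ((n.+1%:R - a) * h))^-1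
  else (sin ((M%:R + a) * h))^-1.
have lt_pi (c : R) : 0 < c -> c < 2 * M%:R + 1 -> 0 < c * h < pi.
  by move=> c0 cM; rewrite mulr_gt0 //= -hM2 ltr_pM2r.
have natM n : (n < M)%N -> n%:R + 1 <= M%:R :> R by rewrite natr1 ler_nat.
have M0 : 0 <= M%:R :> R by [].
have S1 n : n.+1%:R = n%:R + 1 :> R by rewrite natr1.
have D0 n : (n <= M)%N -> 0 <= D n.
  move=> nM; rewrite /D; case: ltnP => [/natM nM'|_]; last first.
    by apply/csc_ge0/lt_pi; lra.
  have n0 : 0 <= n%:R :> R by [].
  by apply: addr_ge0; apply/csc_ge0/lt_pi; rewrite ?(S1 n); lra.
have cscle (c c' : R) : 0 < c -> c <= c' -> c' <= M%:R + 2^-1 ->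
    (sin (c' * h))^-1 <= (sin (c * h))^-1.
  move=> c0 cc cM; apply: csc_le; first exact: mulr_gt0.
    by rewrite ler_pM2r.
  have -> : pi / 2 = (M%:R + 2^-1) * h by rewrite -hM2; field.
  by rewrite ler_pM2r.
have DD n : (n < M)%N -> D n.+1 <= D n.
  move=> nM; have n0 : 0 <= n%:R :> R by [].
  have nM' := natM _ nM; rewrite /D nM; case: ltnP => nM1.
    have := natM _ nM1; rewrite (S1 n) => nM2.
    by apply: lerD; apply: cscle; rewrite ?(S1 n.+1) ?(S1 n); lra.
  have nE : M = n.+1 by apply/eqP; rewrite eqn_leq nM nM1.
  case: (leP a 2^-1) => a2.
    apply: (@le_trans _ _ (sin ((n%:R + a) * h))^-1).
      by apply: cscle; rewrite ?nE ?(S1 n.+1) ?(S1 n); lra.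
    by rewrite lerDl; apply/csc_ge0/lt_pi; rewrite ?nE ?(S1 n.+1) ?(S1 n); lra.
  apply: (@le_trans _ _ (sin ((n.+1%:R - a) * h))^-1); last first.
    by rewrite lerDr; apply/csc_ge0/lt_pi; rewrite ?nE ?(S1 n.+1) ?(S1 n); lra.
  have -> : sin ((M%:R + a) * h) = sin ((M%:R + 1 - a) * h).
    have -> : (M%:R + a) * h = - ((M%:R + 1 - a) * h) + pi by rewrite -hM2; ring.
    by rewrite sinDpi sinN opprK.
  by apply: cscle; rewrite ?nE ?(S1 n.+1) ?(S1 n); lra.
have -> : \sum_(n < M) (-1) ^+ n * ((sin ((n%:R + a) * h))^-1 + (sin ((n.+1%:R - a) * h))^-1)
  + (-1) ^+ M * (sin ((M%:R + a) * h))^-1 = \sum_(n < N.*2 + (M.+1 - N.*2)) (-1) ^+ n * D n.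
  rewrite subnKC; last by rewrite ltnW.
  rewrite big_ord_recr /= /D ltnn; congr (_ + _); apply: eq_bigr => n _.
  by rewrite ltn_ord.
under eq_bigr => n _.
  have -> : (sin ((n%:R + a) * h))^-1 + (sin ((n.+1%:R - a) * h))^-1 = D n.
    by rewrite /D (leq_trans (ltn_ord n) NM).
  over.
apply: alternating_sum_le; rewrite subnKC ?(leq_trans NM) //.
Qed.

Lemma cvg_csc0 : x / sin x @[x --> (0 : R)^'] --> (1 : R).
Proof.
have [dv dE] := is_derive_sin (0 : R).
have cvs : (fun h => h^-1 *: (sin (h *: 1 + 0) - sin (0 : R))) @ (0 : R)^' --> (1 : R).
  suff : (fun h => h^-1 *: (sin (h *: 1 + 0) - sin (0 : R))) @ (0 : R)^' --> 'D_1 (@sin R) 0.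
    by rewrite dE cos0.
  exact: dv.
have := cvgV (oner_neq0 R) cvs; rewrite invr1 => cvi.
suff -> : (fun x : R => x / sin x) =
    (fun h => (h^-1 *: (sin (h *: 1 + 0) - sin (0 : R)))^-1) by exact: cvi.
apply/funext => h.
by rewrite sin0 subr0 addr0 /GRing.scale /= mulr1 invfM invrK.
Qed.

Lemma cvg_mul_csc (h : nat -> R) (c : R) : (forall j, h j != 0) ->
  h j @[j --> \oo] --> 0 -> c != 0 -> h j / sin (c * h j) @[j --> \oo] --> c^-1.
Proof.
move=> hj0 h0 c0.
have hc : c * h j @[j --> \oo] --> 0^'.
  have : c * h j @[j --> \oo] --> c * 0 by apply: cvgMr.
  rewrite mulr0 => ch B hB; have [k _ hk] := ch _ hB; exists k => // j /hk /=; apply.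
  exact: (mulf_neq0 c0 (hj0 j)).
have -> : (fun j => h j / sin (c * h j)) = (fun j => c^-1 * (c * h j / sin (c * h j))).
  by apply/funext => j; rewrite !mulrA mulVf // mul1r.
rewrite -[X in _ --> X]mulr1; apply: cvgMr; exact: (cvg_comp _ _ hc cvg_csc0).
Qed.

(** Multiply [csc_finite_bound] by h = pi / 3^j, evaluate its right-hand side by
    [csc_sum], and let j tend to infinity: h / sin (c h) tends to 1 / c. *)
Lemma csc_series_le N a : 0 < a < 1 ->
  \sum_(n < N.*2) (-1) ^+ n * ((n%:R + a)^-1 + (n.+1%:R - a)^-1) <= pi / sin (pi * a).
Proof.
move=> a01; have /andP[a0 a1] := a01; have p0 := @pi_gt0 R.
pose h j : R := pi / (3 ^ j)%:R.
have h_neq0 j : h j != 0 by rewrite gt_eqF // divr_gt0 // ltr0n expn_gt0.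
have h0 : h j @[j --> \oo] --> 0.
  rewrite -(mulr0 pi); apply: cvgMr.
  under eq_fun do rewrite natrX -exprVn.
  by apply: cvg_expr; rewrite ger0_norm //; lra.
pose T (j : nat) := \sum_(n < N.*2) (-1) ^+ n *
  (h j / sin ((n%:R + a) * h j) + h j / sin ((n.+1%:R - a) * h j)).
have cT : T j @[j --> \oo] -->
    \sum_(n < N.*2) (-1) ^+ n * ((n%:R + a)^-1 + (n.+1%:R - a)^-1).
  apply: cvg_big => [|n _]; first exact: add_continuous.
  apply: cvgMr; apply: cvgD; apply: cvg_mul_csc => //.
    by rewrite gt_eqF // ltr_wpDl.
  by rewrite gt_eqF // subr_gt0 (lt_le_trans a1) // ler1n.
rewrite -(cvg_lim _ cT) //; apply: limr_le; first exact: cvgP cT.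
near=> j.
have m3 : (0 < 3 ^ j)%N by rewrite expn_gt0.
pose M := (3 ^ j)./2.
have mE : (3 ^ j = M.*2.+1)%N.
  by rewrite -[LHS]odd_double_half oddX orbT.
have NM : (N.*2 <= M)%N.
  have : (N * 4 <= j)%N by near: j; exists (N * 4)%N.
  have := ltn_expl j (isT : (1 < 3)%N); rewrite {1}mE.
  by move: (M) => {mE m3} M'; lia.
have hM : M.*2.+1%:R * h j = pi.
  by rewrite -mE /h mulrC divfK // pnatr_eq0 -lt0n.
have := csc_finite_bound a01 NM hM.
rewrite -mE.
have -> : a * h j = pi * a / (3 ^ j)%:R by rewrite /h; ring.
have m0 : (3 ^ j)%:R != 0 :> R by rewrite pnatr_eq0 -lt0n.
rewrite csc_sum [_ * (_ / _)]mulrC divfK // => le1.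
have hj : 0 < h j by rewrite divr_gt0 // ltr0n.
have -> : T j = h j * \sum_(n < N.*2) (-1) ^+ n *
    ((sin ((n%:R + a) * h j))^-1 + (sin ((n.+1%:R - a) * h j))^-1).
  by rewrite mulr_sumr; apply: eq_bigr => n _; rewrite [RHS]mulrCA (mulrDr (h j)).
apply: (le_trans (ler_wpM2l (ltW hj) le1)).
by rewrite /h mulrA divfK.
Unshelve. all: by end_near. Qed.

End CosecantSeries.

(** * A majorant of the primitive of the kernel *)

Section Kernel.
Variable R : realType.
Implicit Types (t u v al mu eps : R) (e : nat -> R).

(** Termwise primitive of the alternating sum of the powers t^(e n - 1). *)
Definition power_sum L e t := \sum_(n < L) (-1) ^+ n * ((e n)^-1 * t `^ (e n)).

Lemma power_sum_MVT L e u v : (forall n, e n != 0) -> 0 < u -> u < v ->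
  exists2 c, u < c < v &
    power_sum L e v - power_sum L e u = (v - u) * \sum_(n < L) (-1) ^+ n * c `^ (e n - 1).
Proof.
move=> e0 u0 uv.
pose F (n : 'I_L) (t : R) := ((-1) ^+ n * (e n)^-1) *: (t `^ (e n)) : R.
have WE : power_sum L e = \sum_(n < L) F n.
  apply/funext => t; rewrite fct_sumE; apply: eq_bigr => n _.
  by rewrite /F /GRing.scale /= mulrA.
have dW t : 0 < t -> is_derive t 1 (power_sum L e) (\sum_(n < L) (-1) ^+ n * t `^ (e n - 1)).
  move=> t0; rewrite WE; apply: is_derive_sum => n; rewrite /F.
  apply: is_derive_eq; first by apply: is_deriveZ; exact: is_derive1_powR.
  by rewrite /GRing.scale /= -mulrA mulKf.
have [||c] := @MVT R (power_sum L e) (fun t => \sum_(n < L) (-1) ^+ n * t `^ (e n - 1)) u v uv.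
- move=> t; rewrite in_itv /= => /andP[ut _]; apply: dW; exact: lt_trans ut.
- apply: continuous_in_subspaceT => t; rewrite inE /= in_itv /= => /andP[ut _].
  apply: differentiable_continuous; apply/derivable1_diffP.
  by have [] := dW t (lt_le_trans u0 ut).
rewrite in_itv /= => cuv ->; exists c => //; exact: mulrC.
Qed.

(** The product of the sum by 1 + y is 1 + y^(2N+1), the number of terms being
    odd. *)
Lemma geometric_sign_ge N (y : R) : 0 <= y ->
  (1 + y)^-1 <= \sum_(n < N.*2.+1) (-1) ^+ n * y ^+ n.
Proof.
move=> y0; have y1 : 0 < 1 + y by rewrite ltr_wpDr.
rewrite -div1r ler_pdivrMr //.
have -> : (\sum_(n < N.*2.+1) (-1) ^+ n * y ^+ n) * (1 + y) = 1 + y ^+ N.*2.+1.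
  have := subrX1 (- y) N.*2.+1.
  under [X in _ = _ * X -> _]eq_bigr => n _ do rewrite exprNn.
  rewrite exprNn -signr_odd /= odd_double expr1 mulN1r => h.
  have -> : 1 + y ^+ N.*2.+1 = - (- y ^+ N.*2.+1 - 1) by ring.
  by rewrite h; ring.
by rewrite lerDl exprn_ge0.
Qed.

(** Exponents of the primitives of the expansions of 1 / (1 + t^al) in powers of
    t^al, used on [0, 1], and of t^-al, used on [1, oo[. *)
Definition expo0 al (n : nat) : R := al * n%:R + 1.
Definition expo1 al (n : nat) : R := 1 - al * n.+1%:R.

Lemma expo0_neq0 al n : 1 < al -> expo0 al n != 0.
Proof. by move=> al1; rewrite gt_eqF // ltr_wpDl // mulr_ge0 //; lra. Qed.

Lemma expo1_lt0 al n : 1 < al -> expo1 al n < 0.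
Proof.
move=> al1; rewrite subr_lt0; apply: (lt_le_trans al1).
by rewrite ler_peMr ?ler1n //; lra.
Qed.

(** A derivative above 1 / (1 + t^al) suffices, this function being
    nonincreasing. *)
Lemma power_sum_ge (W : R -> R) al u v : 1 < al -> 0 < u -> u <= v ->
  (u < v -> exists2 c, u < c < v & W v - W u >= (v - u) / (1 + c `^ al)) ->
  (v - u) / (1 + v `^ al) <= W v - W u.
Proof.
move=> al1 u0; rewrite le_eqVlt => /predU1P[-> _|uv /(_ uv) [c /andP[uc cv]]].
  by rewrite !subrr mul0r.
apply: le_trans; apply: ler_wpM2l; first by rewrite subr_ge0 ltW.
rewrite lef_pV2 ?posrE ?ltr_wpDr ?powR_ge0 // lerD2l.
by apply: ge0_ler_powR => //; rewrite ?nnegrE; lra.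
Qed.

Lemma power_sum0_ge N al u v : 1 < al -> 0 < u -> u <= v ->
  (v - u) / (1 + v `^ al) <=
    power_sum N.*2.+1 (expo0 al) v - power_sum N.*2.+1 (expo0 al) u.
Proof.
move=> al1 u0 uv; apply: power_sum_ge => // {}uv.
have [c /andP[uc cv] ->] := power_sum_MVT N.*2.+1 (fun n => expo0_neq0 n al1) u0 uv.
exists c; first by rewrite uc.
have c0 : 0 < c by apply: lt_trans uc.
apply: ler_wpM2l; first by rewrite subr_ge0 ltW.
under eq_bigr => n _ do rewrite /expo0 addrK powRrM powR_mulrn ?powR_ge0 //.
apply: le_trans (geometric_sign_ge N (powR_ge0 _ _)); exact: lexx.
Qed.

Lemma power_sum1_ge N al u v : 1 < al -> 0 < u -> u <= v ->
  (v - u) / (1 + v `^ al) <=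
    power_sum N.*2.+1 (expo1 al) v - power_sum N.*2.+1 (expo1 al) u.
Proof.
move=> al1 u0 uv; apply: power_sum_ge => // {}uv.
have [c /andP[uc cv] ->] := power_sum_MVT N.*2.+1
  (fun n => ltr0_neq0 (expo1_lt0 n al1)) u0 uv.
exists c; first by rewrite uc.
have c0 : 0 < c by apply: lt_trans uc.
apply: ler_wpM2l; first by rewrite subr_ge0 ltW.
have y0 : 0 < c `^ al by apply: powR_gt0.
have -> : \sum_(n < N.*2.+1) (-1) ^+ n * c `^ (expo1 al n - 1) =
    (c `^ al)^-1 * \sum_(n < N.*2.+1) (-1) ^+ n * ((c `^ al)^-1) ^+ n.
  rewrite mulr_sumr; apply: eq_bigr => n _; rewrite mulrCA; congr (_ * _).
  have -> : expo1 al n - 1 = - (al * n.+1%:R) by rewrite /expo1; ring.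
  by rewrite powRN powRrM powR_mulrn ?powR_ge0 // exprVn exprS invfM.
have y0' : 0 < (c `^ al)^-1 by rewrite invr_gt0.
have := ler_wpM2l (ltW y0') (geometric_sign_ge N (ltW y0')).
apply: le_trans; rewrite -invfM mulrDr mulr1 divff ?gt_eqF // addrC; exact: lexx.
Qed.

Lemma power_sum_ge0 N al t : 1 < al -> 0 <= t <= 1 ->
  0 <= power_sum N (expo0 al) t.
Proof.
move=> al1 /andP[t0 t1]; rewrite /power_sum.
have pos n : 0 < expo0 al n by rewrite /expo0 ltr_wpDl // mulr_ge0 //; lra.
apply: (alternating_sum_ge0 (d := fun n => (expo0 al n)^-1 * t `^ (expo0 al n))) => n _.
  by rewrite mulr_ge0 ?powR_ge0 ?invr_ge0 // ltW.
have le : expo0 al n <= expo0 al n.+1.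
  by rewrite /expo0 lerD2r ler_wpM2l ?ler_nat //; lra.
apply: ler_pM; [by rewrite invr_ge0 ltW|exact: powR_ge0|by rewrite lef_pV2 ?posrE|].
move: t0; rewrite le_eqVlt => /predU1P[<-|t0]; first by rewrite !powR0 ?gt_eqF.
by apply: ger_powR => //; rewrite t0.
Qed.

Lemma power_sum_le0 N al t : 1 < al -> 1 <= t -> power_sum N (expo1 al) t <= 0.
Proof.
move=> al1 t1; rewrite /power_sum -oppr_ge0 -sumrN.
under eq_bigr => n _ do rewrite -mulrN -mulNr -invrN.
have pos n : 0 < - expo1 al n by rewrite oppr_gt0 expo1_lt0.
apply: (alternating_sum_ge0 (d := fun n => (- expo1 al n)^-1 * t `^ (expo1 al n))) => n _.
  by rewrite mulr_ge0 ?powR_ge0 ?invr_ge0 // ltW.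
have le : expo1 al n.+1 <= expo1 al n.
  by rewrite /expo1 lerD2l lerN2 ler_wpM2l ?ler_nat //; lra.
apply: ler_pM; [by rewrite invr_ge0 ltW|exact: powR_ge0| |].
  by rewrite lef_pV2 ?posrE // lerN2.
exact: ler_powR.
Qed.


(** The two primitives are glued at 1. The first one vanishes at 0 and the second
    one is nonpositive, so all increments are below the difference of their
    values at 1, which is 1 / al times a partial sum of the cosecant series. *)
Lemma unit_kernel_majorant al eps : 1 < al -> 0 < eps ->
  exists G : R -> R,
    (forall u v, 0 <= u -> u <= v -> (v - u) / (1 + v `^ al) <= G v - G u) /\
    (forall u v, 0 <= u -> u <= v -> G v - G u <= pi / (al * sin (pi / al)) + eps).
Proof.
move=> al1 eps0; have al0 : 0 < al by lra.
pose N := (Num.truncn eps^-1).+1.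
pose P := power_sum N.*2.+1 (expo0 al); pose F := power_sum N.*2.+1 (expo1 al).
pose G t := if t <= 1 then P t else P 1 + (F t - F 1).
have P0 : P 0 = 0.
  rewrite /P /power_sum big1 // => n _.
  by rewrite powR0 ?expo0_neq0 // !mulr0.
have Pge u v : 0 <= u -> u <= v -> v <= 1 -> (v - u) / (1 + v `^ al) <= P v - P u.
  rewrite le_eqVlt => /predU1P[<-|u0]; last by move=> uv _; exact: power_sum0_ge.
  rewrite P0 !subr0 le_eqVlt => /predU1P[<-|v0 v1]; first by rewrite P0 mul0r.
  (* the mean value theorem needs a positive left end *)
  apply: le_eps => e e0; pose w := Num.min v e.
  have w0 : 0 < w by rewrite lt_min v0.
  have wv : w <= v by rewrite ge_min lexx.
  have we : w <= e by rewrite ge_min lexx orbT.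
  have h1 := power_sum0_ge N al1 w0 wv.
  have h2 : 0 <= P w by apply: power_sum_ge0 => //; rewrite ltW //= (le_trans wv).
  have k1 : (1 + v `^ al)^-1 <= 1.
    by rewrite invf_le1 ?lerDl ?powR_ge0 // ltr_wpDr ?powR_ge0.
  have k2 : w * (1 + v `^ al)^-1 <= w by rewrite ler_piMr // ltW.
  move: h1 h2 k2; rewrite mulrBl -/P; move: (v / _) (w / _) (P v) (P w) => A1 A2 A3 A4; lra.
have Fge u v : 1 <= u -> u <= v -> (v - u) / (1 + v `^ al) <= F v - F u.
  by move=> u1; apply: power_sum1_ge => //; lra.
have Gge u v : 0 <= u -> u <= v -> (v - u) / (1 + v `^ al) <= G v - G u.
  move=> u0 uv; rewrite /G; case: (leP v 1) => v1.
    by rewrite (le_trans uv v1); exact: Pge.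
  case: (leP u 1) => u1; last first.
    have := Fge u v (ltW u1) uv; move: (_ / _) (F v) (F u) (F 1) (P 1) => *; lra.
  have h1 := Fge 1 v (lexx _) (ltW v1).
  have h2 := Pge u 1 u0 u1 (lexx _).
  have h3 : (1 - u) / (1 + v `^ al) <= (1 - u) / (1 + 1 `^ al).
    apply: ler_wpM2l; first by rewrite subr_ge0.
    rewrite lef_pV2 ?posrE ?ltr_wpDr ?powR_ge0 // lerD2l.
    by apply: ge0_ler_powR; rewrite ?nnegrE; lra.
  have -> : (v - u) / (1 + v `^ al) = (v - 1) / (1 + v `^ al) + (1 - u) / (1 + v `^ al).
    by rewrite -mulrDl; congr (_ / _); ring.
  move: h1 h2 h3; move: (_ / (1 + v `^ al)) ((1 - u) / (1 + v `^ al)) (_ / (1 + 1 `^ al)).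
  move: (F v) (F 1) (P 1) (P u) => *; lra.
exists G; split=> // u v u0 uv.
have F1 : F 1 <= 0 by apply: power_sum_le0.
have Pu : 0 <= P (Num.min u 1).
  by apply: power_sum_ge0 => //; rewrite ge_min lexx orbT le_min u0 ler01.
have mono w t : 0 <= w -> w <= t -> G w <= G t.
  move=> w0 wt; rewrite -subr_ge0; apply: le_trans (Gge _ _ w0 wt).
  by rewrite divr_ge0 ?subr_ge0 // addr_ge0 // powR_ge0.
have Gu : 0 <= G u by have := mono 0 u (lexx _) u0; rewrite {1}/G ler01 P0.
have Gv : G v <= P 1 - F 1.
  rewrite /G; case: (leP v 1) => v1; last first.
    by have := power_sum_le0 N.*2.+1 al1 (ltW v1); rewrite -/F; lra.
  have := Pge v 1 (le_trans u0 uv) v1 (lexx _).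
  have : 0 <= (1 - v) / (1 + 1 `^ al).
    by rewrite divr_ge0 ?subr_ge0 // addr_ge0 // powR_ge0.
  move: (_ / _) => *; lra.
suff : P 1 - F 1 <= pi / (al * sin (pi / al)) + eps by lra.
pose a := al^-1; have a0 : 0 < a by rewrite invr_gt0.
have a1 : a < 1 by rewrite invf_lt1.
have -> : P 1 - F 1 = a * \sum_(n < N.*2.+1) (-1) ^+ n * ((n%:R + a)^-1 + (n.+1%:R - a)^-1).
  rewrite mulr_sumr /P /F /power_sum -sumrB; apply: eq_bigr => n _.
  rewrite !powR1 !mulr1 -mulrBr mulrCA; congr (_ * _).
  have ala : al * a = 1 by rewrite mulfV ?gt_eqF.
  have -> : expo0 al n = al * (n%:R + a) by rewrite mulrDr ala.
  have -> : expo1 al n = - (al * (n.+1%:R - a)) by rewrite mulrBr ala opprB.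
  by rewrite invrN opprK !invfM -/a -mulrDr.
have aa : 0 < a < 1 by rewrite a0.
rewrite big_ord_recr /= mulrDr lerD //.
  have -> : pi / (al * sin (pi / al)) = a * (pi / sin (pi * a)).
    by rewrite /a invfM mulrCA.
  by rewrite ler_pM2l // csc_series_le.
rewrite -signr_odd odd_double expr0 mul1r.
have N0 : 0 < N%:R :> R by rewrite ltr0n.
have NE : eps^-1 < N%:R by apply: truncnS_gt.
have NV : N%:R^-1 < eps by rewrite -[eps]invrK ltf_pV2 ?posrE ?invr_gt0.
have N2 : N.*2%:R = 2 * N%:R :> R by rewrite -mul2n natrM.
have N3 : N.*2.+1%:R = 2 * N%:R + 1 :> R by rewrite -N2 natr1.
have b1 : (N.*2%:R + a)^-1 <= (2 * N%:R)^-1.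
  by rewrite lef_pV2 ?posrE; lra.
have b2 : (N.*2.+1%:R - a)^-1 <= (2 * N%:R)^-1.
  by rewrite N3 lef_pV2 ?posrE; lra.
have b3 : (2 * N%:R)^-1 + (2 * N%:R)^-1 = N%:R^-1 :> R by field; rewrite gt_eqF.
have S0 : (N.*2%:R + a)^-1 + (N.*2.+1%:R - a)^-1 <= eps.
  by apply: le_trans (ltW NV); rewrite -b3 lerD.
apply: le_trans S0; rewrite ler_piMl ?(ltW a1) //.
by apply: addr_ge0; rewrite invr_ge0 ?N2 ?N3; lra.
Qed.

(** The substitution t |-> |mu|^(1/al) t reduces to the case |mu| = 1. *)
Lemma kernel_majorant al mu eps : 1 < al -> mu < 0 -> 0 < eps ->
  exists G : R -> R,
    (forall u v, 0 <= u -> u <= v -> (v - u) / (1 + `|mu| * v `^ al) <= G v - G u) /\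
    (forall u v, 0 <= u -> u <= v ->
       G v - G u <= `|mu| `^ (- al^-1) * pi / (al * sin (pi / al)) + eps).
Proof.
move=> al1 mu0 eps0; have al0 : al != 0 by rewrite gt_eqF //; lra.
have m0 : 0 < `|mu| by rewrite normr_gt0 lt_eqF.
pose c := `|mu| `^ al^-1; have c0 : 0 < c by apply: powR_gt0.
have [G [G1 G2]] := unit_kernel_majorant al1 (mulr_gt0 eps0 c0).
exists (fun t => G (c * t) / c); split=> u v u0 uv.
  have cu : 0 <= c * u by rewrite mulr_ge0 // ltW.
  have cuv : c * u <= c * v by rewrite ler_pM2l.
  have := G1 _ _ cu cuv.
  rewrite powRM ?(ltW c0) ?(le_trans u0) // -powRrM mulVf // powRr1 ?(ltW m0) //.
  by rewrite -mulrBl ler_pdivlMr // -mulrBr -mulrA mulrC.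
have cu : 0 <= c * u by rewrite mulr_ge0 // ltW.
have cuv : c * u <= c * v by rewrite ler_pM2l.
have := G2 _ _ cu cuv; rewrite -mulrBl ler_pdivrMr // [(_ + eps) * c]mulrDl powRN -/c.
suff -> : c^-1 * pi / (al * sin (pi / al)) * c = pi / (al * sin (pi / al)) by [].
by rewrite [LHS]mulrC !mulrA mulfV ?gt_eqF // mul1r.
Qed.

End Kernel.

(** * The solution operator at time 0 *)

Section RealPoints.
Variable R : realType.
Implicit Types l t a : R.

Lemma nrm_real l : nrm (l%:C : R[i]) = `|l|.
Proof. by rewrite /nrm normc_def /= expr0n addr0 sqrtr_sqr. Qed.

Lemma carg_ge0 l : 0 < l -> carg (l%:C) = 0.
Proof.
move=> l0; rewrite /carg nrm_real /= lexx ger0_norm ?(ltW l0) // divff ?gt_eqF //.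
exact: acos1.
Qed.

Lemma carg_lt0 l : 0 < l -> carg (- l%:C) = pi.
Proof.
move=> l0; rewrite /carg nrmN nrm_real /= oppr0 lexx ger0_norm ?(ltW l0) //.
by rewrite mulNr divff ?gt_eqF // acosN1.
Qed.

Lemma cpow_real l a : 0 < l -> cpow (l%:C) a = (l `^ a)%:C.
Proof.
move=> l0; rewrite /cpow carg_ge0 // nrm_real ger0_norm ?(ltW l0) //.
by rewrite mulr0 cos0 sin0 mulr1.
Qed.

Lemma cexp_real t : cexp (t%:C) = (expR t)%:C.
Proof. by rewrite /cexp /= cos0 sin0 mulr1. Qed.

(** The negative real axis seen from mu has argument pi, outside a sector of angle
    below pi/2. *)
Lemma notin_sector mu theta l : mu < l -> theta < pi / 2 -> ~ sector mu theta l%:C.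
Proof.
move=> ml tp [_]; rewrite -realcB carg_lt0 ?subr_gt0 // => h.
have p0 := @pi_gt0 R; move: h; rewrite ger0_norm ?(ltW p0) // => h; lra.
Qed.

Lemma MVT_le (F f : R -> R) : (forall x : R, is_derive x (1 : R) F (f x)) ->
  forall u v, u <= v -> exists2 c, u <= c <= v & (v - u) * f c = F v - F u.
Proof.
move=> dF u v uv; have [|c cuv ->] := @MVT_segment R F f u v uv (fun x _ => dF x).

  apply: continuous_subspaceT => t; apply: differentiable_continuous.
  by apply/derivable1_diffP; have [] := dF t.
by move: cuv; rewrite in_itv /= => cuv; exists c => //; exact: mulrC.
Qed.

Lemma is_derive_mull l (x : R) : is_derive x (1 : R) (fun t => l * t) l.
Proof.
have := @is_deriveZ R R R id l x 1 1 (is_derive_id x 1).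
by rewrite /GRing.scale /= mulr1.
Qed.

Lemma is_derive_expR_scale l (x : R) :
  is_derive x (1 : R) (fun t => expR (l * t)) (l * expR (l * x)).
Proof.
rewrite mulrC; exact: (is_derive1_comp (is_derive_expR _) (is_derive_mull _ _)).
Qed.

(** The explicit primitive by which [laplace_initial_value] estimates the Laplace
    transform of a function growing at most linearly. *)
Lemma is_derive_laplace_majorant l eps c (x : R) : l != 0 ->
  is_derive x (1 : R) (fun t => - (expR (- l * t) * (eps / l + c / l ^+ 2 + c / l * t)))
    (expR (- l * x) * (eps + c * x)).
Proof.
move=> l0.
have dp := @is_deriveD R R R _ _ x 1 _ _ (is_derive_cst (eps / l + c / l ^+ 2) x 1)
  (is_derive_mull (c / l) x).
have dm := @is_deriveN R R R _ x 1 _ (is_deriveM (is_derive_expR_scale (- l) x) dp).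
apply: (is_derive_eq dm).
have -> : (cst (eps / l + c / l ^+ 2) + [eta *%R (c / l)]) x =
  eps / l + c / l ^+ 2 + c / l * x by [].
rewrite /GRing.scale /=; field; exact: l0.
Qed.

End RealPoints.

Section SolutionOperator.
Variables (R : realType) (X : completeNormedModType R[i]).

(** [opnorm] only tests the unit ball; homogeneity under real scalars is enough to
    rescale. *)
Lemma opnorm_le (T : X -> X) (c : R) :
  (forall (a : R) x, T (a%:C *: x) = a%:C *: T x) -> (opnorm T <= c%:E)%E ->
  forall x, nrm (T x) <= c * nrm x.
Proof.
move=> Th Tc x; have [x0|nx] := eqVneq (nrm x) 0.
  have -> : x = 0%:C *: x by rewrite (nrm_eq0 x0) scaler0.
  by rewrite Th !nrmZ normr0 !mul0r mulr0.
have nx0 : 0 < nrm x by rewrite lt_def nx nrm_ge0.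
have : ((nrm (T ((nrm x)^-1%:C *: x)))%:E <= c%:E)%E.
  apply: le_trans Tc; apply: ereal_sup_ubound; exists ((nrm x)^-1%:C *: x) => //=.
  by rewrite nrmZ_ge0 ?invr_ge0 ?nrm_ge0 // mulVf.
by rewrite lee_fin Th nrmZ_ge0 ?invr_ge0 ?nrm_ge0 // mulrC ler_pdivrMr.
Qed.

(** The left inverse property applied to the linear combination of the images. *)
Lemma resolvent_linear (D : set X) (A : X -> X) z T : linear_operator D A ->
  is_resolvent D A z T -> forall a x y, T (a *: x + y) = a *: T x + T y.
Proof.
move=> [D0 linA] [T1 T2 _] a x y.
have [Dx Ex] := T1 x; have [Dy Ey] := T1 y.
have [Dxy Exy] := linA a _ _ Dx Dy.
rewrite -[RHS]T2 // Exy -{1}Ex -{1}Ey; congr T.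
by rewrite !scalerDr scalerN !scalerA [a * z]mulrC opprD addrACA.
Qed.

(** With the tags given by the mean value property, Riemann sums telescope to the
    increment of [P]. *)
Lemma is_rint_scale (p P : R -> R) (x : X) a b : a <= b ->
  (forall u v, u <= v -> exists2 c, u <= c <= v & (v - u) * p c = P v - P u) ->
  cont_on `[a, b] (fun t => (p t)%:C *: x) ->
  is_rint (fun t => (p t)%:C *: x) a b ((P b - P a)%:C *: x).
Proof.
move=> ab hP cp; have [y hy] := is_rint_exists ab cp.
suff -> : (P b - P a)%:C *: x = y by [].
apply/eqP; rewrite -subr_eq0; apply/eqP/nrm_small => e e0.
have hP' u v : a <= u -> u <= v -> v <= b ->
    exists2 c, u <= c <= v & (v - u) * p c = P v - P u by move=> _ uv _; exact: hP.
have [n [t [c [ta tb htc hs]]]] := is_rint_tags hP' hy e0.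
suff <- : \sum_(i < n) (t i.+1 - t i)%:C *: ((p (c i))%:C *: x) = (P b - P a)%:C *: x.
  exact: ltW.
rewrite -ta -tb -(telescope_sumr (fun i => P (t i)) (leq0n n)) big_mkord rmorph_sum scaler_suml.
apply: eq_bigr => i _; have [_ _ _ <-] := htc _ (ltn_ord i).
by rewrite scalerA -rmorphM.
Qed.

Lemma cont_on_scale (A : set R) (p : R -> R) (h : R -> X) :
  {in A, continuous p} -> cont_on A h -> cont_on A (fun t => (p t)%:C *: h t).
Proof.
move=> cp ch t0 At0 e e0.
pose c := (nrm (h t0) + 1 + (`|p t0| + 1)).
have c0 : 0 < c.
  by rewrite /c; move: (nrm_ge0 (h t0)) (normr_ge0 (p t0)); move: (nrm _) `|_| => *; lra.
pose e1 := Num.min 1 (e / c).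
have e10 : 0 < e1 by rewrite lt_min ltr01 divr_gt0.
have [d1 d10 hd1] := ch t0 At0 e1 e10.
have /cvgrPdist_lt /(_ _ e10) := cp t0 (mem_set At0).
move=> /nbhs_ballP [d2 /= d20 hd2].
exists (Num.min d1 d2); first by rewrite lt_min d10.
move=> t At; rewrite lt_min => /andP[td1 td2].
have h1 := hd1 t At td1.
have h2 : `|p t0 - p t| < e1 by apply: hd2; rewrite -ball_normE /ball_ /= distrC.
have -> : (p t)%:C *: h t - (p t0)%:C *: h t0 =
   (p t)%:C *: (h t - h t0) + (p t - p t0)%:C *: h t0.
  by rewrite scalerBr realcB scalerBl addrA subrK.
apply: (le_lt_trans (nrmD _ _)); rewrite !nrmZ (distrC (p t)).
have pt : `|p t| <= `|p t0| + 1.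
  have := ler_distD 0 (p t) (p t0); rewrite !subr0 sub0r normrN => _.
  have -> : p t = p t0 - (p t0 - p t) by ring.
  apply: (le_trans (ler_normB _ _)); rewrite lerD2l ltW // (lt_le_trans h2) //.
  by rewrite ge_min lexx.
have e1c : e1 * c <= e by rewrite -ler_pdivlMr // ge_min lexx orbT.
apply: lt_le_trans e1c; rewrite /c mulrDr addrC.
apply: ler_ltD.
  apply: (@le_trans _ _ (e1 * nrm (h t0))).
    by rewrite ler_wpM2r ?nrm_ge0 // ltW.
  by rewrite ler_wpM2l ?lerDl // ltW.
apply: (@le_lt_trans _ _ ((`|p t0| + 1) * nrm (h t - h t0))).
  by rewrite ler_wpM2r ?nrm_ge0.
by rewrite mulrC ltr_pM2r // ltr_wpDl.
Qed.


Lemma expR_scale_continuous (l : R) : continuous (fun t : R => expR (l * t)).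
Proof.
move=> t; apply: differentiable_continuous; apply/derivable1_diffP.
by have [] := is_derive_expR_scale l t.
Qed.

(** The mass of l e^(-l t) concentrates at 0, so l times the Laplace transform
    of a function continuous at 0 is close to its value there. *)
Lemma laplace_initial_value (h : R -> X) (l eps c : R) (y : X) :
  0 < l -> 0 <= eps -> 0 <= c -> cont_on `[0, +oo[ h ->
  (forall t, 0 <= t -> nrm (h t - h 0) <= eps + c * t) ->
  is_rint_oo (fun t => cexp (- (l%:C * t%:C)) *: h t) 0 y ->
  nrm (l%:C *: y - h 0) <= eps + c / l.
Proof.
move=> l0 eps0 c0 ch hh [J hJ Jy].
pose p t := expR (- l * t).
have pE t : cexp (- (l%:C * t%:C)) = (p t)%:C.
  by rewrite /p mulNr -rmorphM -rmorphN cexp_real.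
pose Q t := - (p t * (eps / l + c / l ^+ 2 + c / l * t)).
have lN : - l != 0 by rewrite oppr_eq0 gt_eqF.
have cp : cont_on [set: R] (fun t => (p t)%:C *: h 0).
  apply: cont_on_scale => [t _|t _ e e0]; first exact: expR_scale_continuous.
  by exists 1 => // t' _ _; rewrite subrr nrm0.
have pP u v : u <= v -> exists2 k, u <= k <= v & (v - u) * p k = - (p v / l) - - (p u / l).
  move=> uv; have [k kuv h1] := MVT_le (is_derive_expR_scale (- l)) uv.
  exists k => //; apply: (mulfI lN); rewrite mulrCA h1 /p; field; exact: lt0r_neq0.
have bnd b : 0 <= b -> nrm (J b - ((1 - p b) / l)%:C *: h 0) <= eps / l + c / l ^+ 2.
  move=> b0.
  have h1 : is_rint (fun t => (p t)%:C *: h t) 0 b (J b).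
    by have := hJ b b0; apply: eq_is_rint => s _; rewrite pE.
  have h2 := is_rint_scale b0 pP (cont_onS (@subsetT _ _) cp).
  have -> : (1 - p b) / l = - (p b / l) - - (p 0 / l).
    by rewrite /p mulr0 expR0; field; exact: lt0r_neq0.
  have Qle : Q b - Q 0 <= eps / l + c / l ^+ 2.
    rewrite /Q /p !mulr0 expR0 mul1r addr0 opprK -/(p b) gerDr oppr_le0.
    by rewrite mulr_ge0 ?expR_ge0 // !addr_ge0 ?mulr_ge0 ?invr_ge0 ?exprn_ge0 // ltW.
  apply: le_trans Qle.
  apply: (is_rint_le (g := fun t => p t * (eps + c * t)) _ _ (is_rintB h1 h2)).
    move=> s /andP[s0 _]; rewrite -scalerBr nrmZ_ge0 ?expR_ge0 //.
    by rewrite ler_wpM2l ?expR_ge0 // hh.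
  move=> u v _ uv _.
  have [k kuv h3] := MVT_le (fun x => is_derive_laplace_majorant eps c x (lt0r_neq0 l0)) uv.
  by exists k => //; rewrite h3.
have lim : nrm (y - (l^-1)%:C *: h 0) <= eps / l + c / l ^+ 2.
  apply: le_eps => e e0; have e20 : 0 < e / 2 by rewrite divr_gt0.
  move/cvg_nrm : Jy => /(_ _ e20) [b0 [_ hb0]].
  pose K := nrm (h 0) / l; have K0 : 0 <= K by rewrite divr_ge0 ?nrm_ge0 // ltW.
  pose b := Num.max (b0 + 1) (Num.max 0 (K / (e / 2) / l)).
  have bb0 : b0 < b by rewrite lt_max ltrDl ltr01.
  have b_ge0 : 0 <= b by rewrite /b !le_max lexx orbT.
  have bK : K / (e / 2) / l <= b by rewrite /b !le_max lexx !orbT.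
  have h1 := hb0 b bb0; have h2 := bnd b b_ge0.
  have h3 : nrm (((1 - p b) / l)%:C *: h 0 - (l^-1)%:C *: h 0) <= e / 2.
    rewrite -scalerBl -realcB nrmZ.
    have -> : (1 - p b) / l - l^-1 = - (p b / l) by field; exact: lt0r_neq0.
    rewrite normrN ger0_norm; last by rewrite divr_ge0 ?expR_ge0 // ltW.
    rewrite mulrAC -mulrA -/K /p mulNr expRN mulrC ler_pdivrMr ?expR_gt0 //.
    rewrite mulrC -ler_pdivrMr //; apply: le_trans (expR_ge1Dx _).
    have : K / (e / 2) <= l * b by rewrite [l * b]mulrC -ler_pdivrMr.
    by move=> h4; apply: (le_trans h4); rewrite lerDr.
  apply: (le_trans (nrm_dist (J b) _ _)).
  have := nrm_dist (((1 - p b) / l)%:C *: h 0) (J b) ((l^-1)%:C *: h 0).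
  move: h1 h2 h3; rewrite (nrmB y).
  move: (nrm (J b - y)) (nrm (J b - _ *: h 0)) (nrm (_ *: h 0 - _)) (nrm (J b - _)) (eps / l) (c / l ^+ 2).
  by move=> *; lra.
have -> : l%:C *: y - h 0 = l%:C *: (y - (l^-1)%:C *: h 0).
  by rewrite scalerBr scalerA -rmorphM /= mulfV ?lt0r_neq0 // scale1r.
rewrite nrmZ_ge0 ?(ltW l0) //; apply: (le_trans (ler_wpM2l (ltW l0) lim)).
by rewrite le_eqVlt; apply/orP; left; apply/eqP; field; exact: lt0r_neq0.
Qed.

(** Initial value theorem for the Laplace transform on the domain of [A], as
    l tends to infinity along the real axis, then density. The linear bound on
    S t x - S 0 x holds near 0 by continuity and further away because S is bounded. *)
Lemma solution_operator_0 (D : set X) (A : X -> X) (alpha mu theta M K : R)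
    (S : R -> {linear X -> X}) :
  1 < alpha -> dense D -> mu < 0 -> sectorial D A mu theta M ->
  solution_operator D A alpha S ->
  (forall t x, 0 <= t -> nrm (S t x) <= K * nrm x) ->
  forall x, S 0 x = x.
Proof.
move=> al0 dD mu0 [linA _ [/andP[th0 thp] M0] _ sec] [_ Sc [nu hnu]] SK.
have K1 : 0 <= `|K| by [].
have SK' t x : 0 <= t -> nrm (S t x) <= `|K| * nrm x.
  by move=> t0; apply: (le_trans (SK t x t0)); rewrite ler_wpM2r ?nrm_ge0 // ler_norm.
have SD x : D x -> S 0 x = x.
  move=> Dx; apply/eqP; rewrite -subr_eq0; apply/eqP/nrm_small => e e0.
  have e30 : 0 < e / 3 by rewrite divr_gt0.
  have /within_cont_on cS := Sc x.
  have [|d d0 hd] := cS 0 _ _ e30; first by rewrite /= in_itv /= lexx.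
  pose c := 2 * (`|K| * nrm x) / d.
  have Kx : 0 <= `|K| * nrm x by rewrite mulr_ge0 ?nrm_ge0.
  have c0 : 0 <= c by apply: divr_ge0; [exact: mulr_ge0|exact: ltW].
  have hh t : 0 <= t -> nrm (S t x - S 0 x) <= e / 3 + c * t.
    move=> t0; case: (ltP t d) => td.
      apply: (@le_trans _ _ (e / 3)); last by rewrite lerDl mulr_ge0.
      by apply/ltW/hd; rewrite ?subr0 ?ger0_norm //= in_itv /= t0.
    apply: (le_trans (nrmD _ _)); rewrite nrmN.
    have h1 := SK' t x t0; have h2 := SK' 0 x (lexx _).
    have h3 : 2 * (`|K| * nrm x) <= c * t.
      rewrite /c -mulrA; apply: ler_peMr; first exact: mulr_ge0.
      by rewrite mulrC ler_pdivlMr ?mul1r.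
    move: h1 h2 h3; move: (nrm (S t x)) (nrm (S 0 x)) (`|K| * nrm x) (c * t) => *; lra.
  clearbody c.
  pose l := 1 + `|nu| + 3 * c / e + 3 * (M * nrm (A x)) / e.
  have MA : 0 <= M * nrm (A x) by rewrite mulr_ge0 ?nrm_ge0 // ltW.
  have p1 : 0 <= 3 * c / e by apply: divr_ge0; [exact: mulr_ge0|exact: ltW].
  have p2 : 0 <= 3 * (M * nrm (A x)) / e by apply: divr_ge0; [exact: mulr_ge0|exact: ltW].
  have p3 := ler_norm nu; have p4 := normr_ge0 nu.
  have l1 : 1 <= l by rewrite /l; move: p1 p2 p4; move: (_ / e) (_ / e) `|_| => *; lra.
  have l0 : 0 < l by apply: lt_le_trans l1.
  have lnu : nu < l by rewrite /l; move: p1 p2 p3; move: (_ / e) (_ / e) `|_| => *; lra.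
  have lc : c / l <= e / 3.
    have : 3 * c / e <= l by rewrite /l; move: p1 p2 p4; move: (_ / e) (_ / e) `|_| => *; lra.
    by rewrite !ler_pdivrMr // [e / 3 * l]mulrAC ler_pdivlMr // [c * 3]mulrC [e * l]mulrC.
  have lM : M * nrm (A x) / l <= e / 3.
    have : 3 * (M * nrm (A x)) / e <= l by rewrite /l; move: p1 p2 p4; move: (_ / e) (_ / e) `|_| => *; lra.
    by rewrite !ler_pdivrMr // [e / 3 * l]mulrAC ler_pdivlMr // [_ * 3]mulrC [e * l]mulrC.
  have [|||T resT lapT] := hnu l%:C.
  - by [].
  - by rewrite eq_complex /= gt_eqF.
  - by rewrite carg_ge0 // pi_gt0.
  have := lapT x; rewrite cpow_real // => lap.
  rewrite cpow_real // in resT.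
  have wl : l <= l `^ alpha by apply: le1r_powR => //; exact: ltW.
  have w0 : 0 < l `^ alpha by apply: lt_le_trans wl.
  have muw : mu < l `^ alpha by apply: lt_trans w0.
  have opT : (opnorm T <= (M / (l `^ alpha - mu))%:E)%E.
    have := sec _ _ (notin_sector muw thp) _ resT.
    rewrite -realcB nrm_real ger0_norm ?subr_ge0 ?(ltW muw) //; apply.
    by rewrite (inj_eq (@complexI R)) gt_eqF.
  have Tlin := resolvent_linear linA resT.
  have T0 : T 0 = 0.
    by have := Tlin 1 0 0; rewrite !scale1r addr0 => /esym/eqP; rewrite addrC -subr_eq0 addrK => /eqP.
  have Tle := opnorm_le (fun a v => etrans (congr1 T (esym (addr0 _))) (etrans (Tlin a%:C v 0) (etrans (congr1 _ T0) (addr0 _)))) opT.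
  have Tx : (l `^ alpha)%:C *: T x + T (- A x) = x.
    by rewrite -Tlin; have [_ h _] := resT; exact: h.
  have yE : l%:C *: ((l `^ (alpha - 1))%:C *: T x) = x - T (- A x).
    rewrite scalerA -rmorphM /= mulr_powRB1 ?(ltW l0) ?(lt_trans ltr01) //.
    by apply/esym/eqP; rewrite subr_eq Tx.
  have e3 : 0 <= e / 3 by exact: ltW.
  have := laplace_initial_value l0 e3 c0 cS hh lap; rewrite yE => h1.
  have h2 : nrm (T (- A x)) <= e / 3.
    apply: (le_trans (Tle _)); rewrite nrmN; apply: le_trans lM.
    rewrite mulrAC ler_wpM2l // lef_pV2 ?posrE ?subr_gt0 //.
    by apply: (le_trans wl); lra.
  have -> : S 0 x - x = - (x - T (- A x) - S 0 x) + - T (- A x).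
    by rewrite !opprB [RHS]addrAC addrA subrK.
  apply: (le_trans (nrmD _ _)); rewrite !nrmN.
  move: h1 h2 lc; move: (nrm _) (nrm _) (c / l) => *; lra.
move=> x; apply/eqP; rewrite -subr_eq0; apply/eqP/nrm_small => e e0.
pose d := e / (`|K| + 1); have d0 : 0 < d by rewrite divr_gt0 // ltr_wpDl.
have dC : 0 < d%:C by rewrite ltcR.
have bx : ball x d%:C !=set0 by exists x; exact: ballxx.
have [y [yx Dy]] := dD _ bx (ball_open x _).
move: yx; rewrite -ball_normE /ball_ /= -[`|_|]nrmE ltcR => yx.
have -> : S 0 x - x = S 0 (x - y) - (x - y).
  by rewrite linearB /= (SD y Dy) opprB addrA subrK.
apply: (le_trans (nrmD _ _)); rewrite nrmN.
have h1 := SK' 0 (x - y) (lexx _).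
have h2 : (`|K| + 1) * nrm (x - y) <= e.
  by rewrite mulrC -ler_pdivlMr ?ltr_wpDl // ltW.
rewrite mulrDl mul1r in h2; apply: le_trans h2; rewrite lerD2r; exact: h1.
Qed.

End SolutionOperator.

(** * Null means, block by block *)

Section Blocks.
Variables (R : realType) (h : R).
Hypothesis h0 : 0 < h.
Implicit Types (w p : R -> R) (a : nat -> R).

Definition block (j : nat) (s : R) : Prop := j%:R * h <= s <= j.+1%:R * h.

Lemma block_of s : 0 <= s -> exists j, j%:R * h <= s < j.+1%:R * h.
Proof.
move=> s0; exists (Num.truncn (s / h)).
have sh : 0 <= s / h by rewrite divr_ge0 // ltW.
have /andP[h1 h2] := truncn_itv sh.
by rewrite -ler_pdivlMr // h1 -ltr_pdivrMr.
Qed.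

Lemma block_inj i j s : i%:R * h <= s < i.+1%:R * h -> j%:R * h <= s < j.+1%:R * h -> i = j.
Proof.
move=> /andP[i1 i2] /andP[j1 j2].
have := le_lt_trans i1 j2; have := le_lt_trans j1 i2.
by rewrite !ltr_pM2r // !ltr_nat !ltnS => ? ?; apply/eqP; rewrite eqn_leq; apply/andP.
Qed.

Definition mean_small (e : R) a := exists N, forall n, (N <= n)%N -> \sum_(j < n) a j <= e * n%:R.

(** The sequence is allowed to depend on [e], so that functions with a limit 0, or
    approximated by null functions, are null without a diagonal argument. *)
Definition block_null (w : R -> R) := forall e, 0 < e -> exists a,
  [/\ forall j, 0 <= a j, forall j s, block j s -> w s <= a j & mean_small e a].

Lemma block_ge0 j s : block j s -> 0 <= s.
Proof. by move=> /andP[+ _]; apply: le_trans; rewrite mulr_ge0 // ltW. Qed.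

Lemma block_null_approx w :
  (forall e, 0 < e -> exists2 w', block_null w' & forall s, 0 <= s -> w s <= w' s + e) ->
  block_null w.
Proof.
move=> hw e e0; have e20 : 0 < e / 2 by rewrite divr_gt0.
have [w' bw' ww'] := hw _ e20; have [a [a0 wa [N hN]]] := bw' _ e20.
exists (fun j => a j + e / 2); split=> [j|j s js|].
- by rewrite addr_ge0 // ltW.
- by apply: (le_trans (ww' s (block_ge0 js))); rewrite lerD2r wa.
exists N => n Nn; rewrite big_split /= sumr_const card_ord -[X in _ + X]mulr_natr.
by rewrite {2}(splitr e) mulrDl lerD2r hN.
Qed.

Lemma block_null_le w w' : (forall s, 0 <= s -> w s <= w' s) -> block_null w' -> block_null w.
Proof.
move=> ww' bw'; apply: block_null_approx => e e0; exists w' => // s s0.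
by apply: (le_trans (ww' s s0)); rewrite lerDl ltW.
Qed.

Lemma block_nullD w1 w2 : block_null w1 -> block_null w2 -> block_null (fun s => w1 s + w2 s).
Proof.
move=> b1 b2 e e0; have e20 : 0 < e / 2 by rewrite divr_gt0.
have [a1 [a10 wa1 [N1 hN1]]] := b1 _ e20; have [a2 [a20 wa2 [N2 hN2]]] := b2 _ e20.
exists (fun j => a1 j + a2 j); split=> [j|j s js|]; first exact: addr_ge0.
  by rewrite lerD ?wa1 ?wa2.
exists (maxn N1 N2) => n; rewrite geq_max => /andP[n1 n2].
by rewrite big_split /= {1}(splitr e) mulrDl lerD ?hN1 ?hN2.
Qed.

Lemma nat_large (x : R) : exists N, forall n, (N <= n)%N -> x <= n%:R.
Proof.
exists (Num.truncn x).+1 => n Nn; apply: (@le_trans _ _ (Num.truncn x).+1%:R).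
  by apply/ltW/truncnS_gt.
by rewrite ler_nat.
Qed.

Lemma block_null_cvg0 w (B : R) : (forall s, 0 <= s -> w s <= B) ->
  (forall e, 0 < e -> exists T, forall s, T <= s -> w s <= e) -> block_null w.
Proof.
move=> wB w0 e e0; have e20 : 0 < e / 2 by rewrite divr_gt0.
have [T hT] := w0 _ e20; have [J hJ] := nat_large (T / h).
pose B' := Num.max B 0; have B0 : 0 <= B' by rewrite le_max lexx orbT.
pose a j := (if (j < J)%N then B' else 0) + e / 2.
exists a; split=> [j|j s js|].
- by rewrite addr_ge0 ?(ltW e20) //; case: ifP.
- rewrite /a; case: ltnP => jJ.
    apply: (le_trans (wB s (block_ge0 js))).
    by apply: (@le_trans _ _ B'); rewrite ?lerDl ?le_max ?lexx // ltW.
  rewrite add0r; apply: hT; case/andP: js => js _; apply: le_trans js.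
  by rewrite -ler_pdivrMr // hJ.
have [N hN] := nat_large (J%:R * B' / (e / 2)).
have Jsum n : \sum_(j < n) (if (j < J)%N then B' else 0) <= J%:R * B'.
  have : forall m, \sum_(j < m) (if (j < J)%N then B' else 0) = (minn m J)%:R * B'.
    elim=> [|m IH]; first by rewrite big_ord0 min0n mul0r.
    rewrite big_ord_recr /= IH; case: ltnP => mJ.
      by rewrite (minn_idPl mJ) -natr1 mulrDl mul1r.
    by rewrite addr0 (minn_idPr (leq_trans mJ (leqnSn _))).
  by move=> ->; rewrite ler_wpM2r // ler_nat geq_minr.
exists N => n /hN hn; rewrite big_split /= sumr_const card_ord -[X in _ + X]mulr_natr.
rewrite {2}(splitr e) mulrDl lerD2r; apply: (le_trans (Jsum n)).
by rewrite [leRHS]mulrC -ler_pdivrMr.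
Qed.

Definition delay (i : nat) a (j : nat) : R := if (i <= j)%N then a (j - i)%N else 0.

(** The delayed partial sum misses the last [i] terms. *)
Lemma delay_sum i a n : (forall j, 0 <= a j) ->
  \sum_(j < n) delay i a j <= \sum_(j < n) a j.
Proof.
move=> a0.
have -> : \sum_(j < n) delay i a j = \sum_(j < n - i) a j.
  elim: n => [|n IH]; first by rewrite sub0n !big_ord0.
  rewrite big_ord_recr /= IH /delay; case: leqP => ni.
    by rewrite subSn // big_ord_recr.
  rewrite addr0; have /eqP -> : (n.+1 - i == 0)%N by rewrite subn_eq0.
  by have /eqP -> : (n - i == 0)%N by rewrite subn_eq0 ltnW.
rewrite -!(big_mkord xpredT) (@big_cat_nat _ _ _ (n - i)%N 0%N n) ?leq_subr //= lerDl.
exact: sumr_ge0.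
Qed.

(** A quantity controlled, up to a small error, by the values of a null function
    over a bounded past is null: a bounded past meets boundedly many blocks. *)
Lemma block_null_causal p w : block_null p ->
  (forall e, 0 < e -> exists N c, 0 <= c /\ forall t m, 0 <= t -> 0 <= m ->
     (forall s, 0 <= s -> t - N%:R * h <= s <= t -> p s <= m) -> w t <= c * m + e) ->
  block_null w.
Proof.
move=> bp hw e e0; have e20 : 0 < e / 2 by rewrite divr_gt0.
have [N [c [c0 hc]]] := hw _ e20.
have k0 : 0 < (c + 1) * N.+1%:R by rewrite mulr_gt0 // ltr_wpDl.
have [|a [a0 pa [L hL]]] := bp (e / 2 / ((c + 1) * N.+1%:R)); first by rewrite divr_gt0.
pose b j := \sum_(i < N.+1) delay i a j.
have d0 i j : 0 <= delay i a j by rewrite /delay; case: ifP.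
have b0 j : 0 <= b j by apply: sumr_ge0.
exists (fun j => c * b j + e / 2); split=> [j|j t jt|].
- by rewrite addr_ge0 ?mulr_ge0 // ltW.
- apply: hc => //; first exact: block_ge0 jt.
  move=> s s0 /andP[ts st]; have [i /andP[i1 i2]] := block_of s0.
  case/andP: jt => jt1 jt2.
  suff [k [kj kN ks]] : exists k, [/\ (k <= j)%N, (j - k <= N)%N & block k s].
    apply: (le_trans (pa _ _ ks)).
    have jkN : (j - k < N.+1)%N by [].
    rewrite /b (bigD1 (Ordinal jkN)) //= {1}/delay leq_subr subKn // lerDl.
    exact: sumr_ge0.
  have iN : (j <= i + N)%N.
    rewrite -ltnS -(ltr_nat R) -(ltr_pM2r h0) -addSn natrD mulrDl.
    apply: (@le_lt_trans _ _ (s + N%:R * h)); last by rewrite ltrD2r.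
    by apply: (le_trans jt1); rewrite -lerBlDr.
  have ij : (i <= j.+1)%N.
    by rewrite -(ler_nat R) -(ler_pM2r h0); apply: (le_trans i1); apply: le_trans jt2.
  move: ij; rewrite leq_eqVlt => /predU1P[ij|]; last first.
    rewrite ltnS => ij; exists i; split=> //; first by rewrite leq_subLR.
    by rewrite /block i1 ltW.
  exists j; split; rewrite ?subnn //; rewrite /block (le_trans st jt2) andbT.
  by apply: le_trans i1; rewrite ij ler_pM2r // ler_nat.
exists L => n Ln; rewrite big_split /= sumr_const card_ord -[X in _ + X]mulr_natr.
rewrite {2}(splitr e) mulrDl lerD2r -mulr_sumr /b exchange_big /=.
have h1 : \sum_(i < N.+1) \sum_(j < n) delay i a j <= N.+1%:R * \sum_(j < n) a j.
  apply: (@le_trans _ _ (\sum_(i < N.+1) \sum_(j < n) a j)).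
    by apply: ler_sum => i _; exact: delay_sum.
  by rewrite sumr_const card_ord mulr_natl.
have s0 : 0 <= \sum_(j < n) a j by apply: sumr_ge0.
apply: (@le_trans _ _ ((c + 1) * (N.+1%:R * \sum_(j < n) a j))).
  apply: ler_pM => //; last by rewrite lerDl.
  by apply: sumr_ge0 => i _; apply: sumr_ge0.
have := hL n Ln; rewrite mulrA -[leRHS]mulrAC => h2.
by rewrite -ler_pdivlMl // mulrC.
Qed.

End Blocks.

(** * From sliding windows to blocks and back *)

Section MeanNull.
Variables (R : realType) (h : R).
Hypothesis h0 : 0 < h.
Implicit Types (c b : nat -> R) (q : R -> \bar R).
Local Notation mu := (@lebesgue_measure R).

(** The integral of a nonnegative function being the supremum of the integrals
    of the simple functions below it, it is monotone without measurability. *)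
Lemma ge0_le_lower_integral (D : set R) (f1 f2 : R -> \bar R) :
  (forall x, D x -> (0 <= f1 x)%E) -> (forall x, D x -> (f1 x <= f2 x)%E) ->
  (\int[mu]_(x in D) f1 x <= \int[mu]_(x in D) f2 x)%E.
Proof.
move=> f10 f12; have f20 x : D x -> (0 <= f2 x)%E.
  by move=> Dx; apply: le_trans (f10 x Dx) (f12 x Dx).
rewrite !ge0_integralE //; apply: ge_ereal_sup => _ [g gf <-].
apply: ereal_sup_ubound; exists g => // x; apply: le_trans (gf x) _.
by rewrite /patch; case: ifP => // /set_mem; exact: f12.
Qed.

Definition step n c (x : R) : R :=
  \sum_(j < n) c j * \1_(`[j%:R * h, j.+1%:R * h[%classic) x.

Lemma step_ge0 n c x : (forall j, 0 <= c j) -> 0 <= step n c x.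
Proof. by move=> c0; apply: sumr_ge0 => j _; rewrite mulr_ge0. Qed.

(** The blocks being half-open, a point belongs to exactly one of them. *)
Lemma step_at n c j x : (j < n)%N -> j%:R * h <= x < j.+1%:R * h -> step n c x = c j.
Proof.
move=> jn jx; rewrite /step (bigD1 (Ordinal jn)) //= indicE mem_set //= ?in_itv //=.
rewrite mulr1 big1 ?addr0 // => i ij; rewrite indicE memNset ?mulr0 //=.
rewrite in_itv /= => ix; move/eqP: ij; apply; apply/val_inj.
exact: (block_inj h0 ix jx).
Qed.

Lemma step_out n c x : (forall j, (j < n)%N -> ~ (j%:R * h <= x < j.+1%:R * h)) -> step n c x = 0.
Proof.
move=> nx; rewrite /step big1 // => j _; rewrite indicE memNset ?mulr0 //= in_itv /=.
exact: nx.
Qed.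

Lemma integral_step (D : set R) n c : measurable D -> (forall j, 0 <= c j) ->
  (\int[mu]_(x in D) (step n c x)%:E =
   \sum_(j < n) (c j)%:E * mu (`[(j%:R * h)%R, (j.+1%:R * h)%R[%classic `&` D))%E.
Proof.
move=> mD c0.
under eq_integral => x _ do rewrite /step -sumEFin.
rewrite ge0_integral_sum //; last 2 first.
- by move=> j; apply/measurable_EFinP; apply: measurable_funM.
- by move=> j x _; rewrite lee_fin mulr_ge0.
apply: eq_bigr => j _.
under eq_integral => x _ do rewrite EFinM.
rewrite ge0_integralZl_EFin //; last first.
  apply/measurable_EFinP; apply: measurable_indic; exact: measurable_itv.
by rewrite integral_indic //; exact: measurable_itv.
Qed.

Lemma measure_block j :
  mu `[(j%:R * h)%R, (j.+1%:R * h)%R[%classic = h%:E.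
Proof.
rewrite lebesgue_measure_itv /= lte_fin ltr_pM2r // ltr_nat ltnSn.
by rewrite -EFinB -natr1 mulrDl mul1r addrAC subrr add0r.
Qed.

Lemma integral_step_le (D : set R) n c : measurable D -> (forall j, 0 <= c j) ->
  (\int[mu]_(x in D) (step n c x)%:E <= (h * \sum_(j < n) c j)%:E)%E.
Proof.
move=> mD c0; rewrite integral_step // mulr_sumr -sumEFin; apply: lee_sum => j _.
rewrite [h * c j]mulrC EFinM; apply: lee_wpmul2l; first by rewrite lee_fin.
rewrite -(measure_block j); apply: le_measure; rewrite ?inE //.
by apply: measurableI => //; exact: measurable_itv.
Qed.

Lemma integral_step_eq (D : set R) n c : measurable D -> (forall j, 0 <= c j) ->
  (forall j, (j < n)%N -> c j != 0 -> `[j%:R * h, j.+1%:R * h[ `<=` D) ->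
  (\int[mu]_(x in D) (step n c x)%:E = (h * \sum_(j < n) c j)%:E)%E.
Proof.
move=> mD c0 cD; rewrite integral_step // mulr_sumr -sumEFin; apply: eq_bigr => j _.
rewrite [h * c j]mulrC EFinM; have [->|cj] := eqVneq (c j) 0; first by rewrite !mul0e.
by rewrite setIidl ?measure_block //; exact: cD.
Qed.

Lemma ereal_squeeze0 (x : \bar R) (e : R) : (0 <= x)%E -> (x <= e%:E)%E ->
  exists2 y : R, x = y%:E & 0 <= y <= e.
Proof. by case: x => [y| |] //; rewrite !lee_fin => y0 ye; exists y; rewrite ?y0. Qed.

(** Up to time T the integral is at most h times the sum of the first T/h + 1
    block bounds. *)
Lemma mean_null_of_blocks (a : R) q : 0 <= a -> (forall s, a <= s -> (0 <= q s)%E) ->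
  (forall e, 0 < e -> exists b, [/\ forall j, 0 <= b j,
     forall j s, a <= s -> block h j s -> (q s <= (b j)%:E)%E & mean_small e b]) ->
  mean_null a q.
Proof.
move=> a0 q0 hq U hU.
have /nbhs_ballP [d /= d0 dU] : nbhs (0 : R) (fun r => U r%:E) := hU.
have d20 : 0 < d / 4 by rewrite divr_gt0.
have [b [b0 qb [N hN]]] := hq _ d20.
pose k : R := N%:R * h + h.
have Nh0 : 0 <= N%:R * h by rewrite mulr_ge0 // ltW.
exists k; split; first exact: num_real.
move=> T kT; have hT : h <= T by rewrite ltW // (le_lt_trans _ kT) // lerDr.
have T0 : 0 < T by apply: lt_le_trans hT.
pose n := (Num.truncn (T / h)).+1.
have Th : 0 <= T / h by rewrite divr_ge0 // ltW.
have /andP[n1 n2] := truncn_itv Th.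
have Nn : (N <= n)%N.
  apply: ltnW; rewrite -(ltr_nat R); apply: le_lt_trans n2.
  by rewrite ler_pdivlMr // ltW // (le_lt_trans _ kT) // lerDl ltW.
have int0 : (0 <= \int[mu]_(s in `[a, T]) q s)%E.
  by apply: integral_ge0 => s /=; rewrite in_itv /= => /andP[/q0].
have intle : (\int[mu]_(s in `[a, T]) q s <= (h * (d / 4 * n%:R))%:E)%E.
  apply: (@le_trans _ _ (\int[mu]_(s in `[a, T]) (step n b s)%:E)%E).
    apply: ge0_le_lower_integral => s /=; rewrite in_itv /= => /andP[as_ sT]; first exact: q0.
    have s0 : 0 <= s by apply: le_trans as_.
    have [j js] := block_of h0 s0.
    rewrite (@step_at n b j s) //.
      by apply: qb => //; case/andP: js => js1 js2; rewrite /block js1 ltW.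
    rewrite -(ltr_nat R); case/andP: js => js1 _.
    apply: le_lt_trans n2; rewrite ler_pdivlMr //; exact: le_trans js1 sT.
  apply: (le_trans (integral_step_le _ _ b0)) => //.
  by rewrite lee_fin ler_pM2l // hN.
have hn : h * (d / 4 * n%:R) <= T * (d / 2).
  have : h * n%:R <= 2 * T.
    have : h * n%:R <= T + h.
      rewrite /n -natr1 mulrDr mulr1 lerD2r mulrC -ler_pdivlMr //.
    lra.
  move=> hnT; have := ler_wpM2l (ltW d20) hnT.
  by rewrite mulrCA => /le_trans; apply; rewrite le_eqVlt; apply/orP; left; apply/eqP; field.
have [y yE /andP[y0 yd]] := ereal_squeeze0 int0 (le_trans intle (lee_tofin hn)).
rewrite /= yE -EFinM; apply: dU; rewrite -ball_normE /ball_ /= sub0r normrN ger0_norm.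
  by rewrite mulrC ltr_pdivrMr // (le_lt_trans yd) // mulrC ltr_pM2r //; lra.
by rewrite mulr_ge0 // invr_ge0 ltW.
Qed.

(** A window of length 2h ending in the block j + 1 contains the whole block j, so
    the supremum over block j is at most the integrand on block j + 1: that is why
    blocks have half the length of windows. *)
Lemma block_null_of_mean (p : R -> R) q B : (forall s, 0 <= s -> 0 <= p s <= B) ->
  (forall s t, 2 * h <= s -> s - 2 * h <= t <= s -> ((p t)%:E <= q s)%E) ->
  mean_null (2 * h) q -> block_null h p.
Proof.
move=> pB pq mq e e0.
pose V j := [set p t | t in [set t | block h j t]].
have Vne j : V j !=set0.
  exists (p (j%:R * h)), (j%:R * h) => //=; rewrite /block lexx /= ler_pM2r //.
  by rewrite ler_nat.
have Vub j : has_ubound (V j).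
  by exists B => _ [t jt <-]; have /andP[] := pB t (block_ge0 h0 jt).
pose a j := sup (V j).
have pa j t : block h j t -> p t <= a j.
  by move=> jt; apply: ub_le_sup => //; exists t.
have a0 j : 0 <= a j.
  have [_ [t jt _]] := Vne j.
  by apply: le_trans (pa j t jt); have /andP[] := pB t (block_ge0 h0 jt).
have e20 : 0 < e / 2 by rewrite divr_gt0.
exists a; split=> //.
have [U0 hU0] : exists k : R, forall T, k < T ->
   ((T^-1)%:E * \int[mu]_(s in `[(2 * h)%R, T]) q s <= (e / 2)%:E)%E.
  have hq : nbhs (0%:E : \bar R) [set x | (x <= (e / 2)%:E)%E].
    change (nbhs (0 : R) (fun r : R => (r%:E <= (e / 2)%:E)%E)).
    apply/nbhs_ballP; exists (e / 2) => //= x.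
    rewrite -ball_normE /ball_ /= sub0r normrN lee_fin => /ltW; apply: le_trans.
    exact: ler_norm.
  by have [U0 [_ hU0]] := mq _ hq; exists U0.
have [N1 hN1] := nat_large (U0 / h + 1).
have [N2 hN2] := nat_large (a 0%N * 2 / e + 1).
exists (maxn (maxn N1 N2) 1) => n; rewrite !geq_max => /andP[/andP[/hN1 n1 /hN2 n2] n_gt0].
pose T := n.+1%:R * h; have T0 : 0 < T by rewrite mulr_gt0.
have UT : U0 < T.
  rewrite -ltr_pdivrMr // -natr1; move: n1; move: (U0 / h) => ? ?; lra.
pose b j := if (2 <= j)%N then a j.-1 else 0.
have b0 j : 0 <= b j by rewrite /b; case: ifP.
have sumb : \sum_(j < n) a j = a 0%N + \sum_(j < n.+1) b j.
  case: (n) n_gt0 => // m _; rewrite big_ord_recl; congr (_ + _).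
  rewrite 2!big_ord_recl /b /= !add0r; apply: eq_bigr => j _.
  by rewrite /bump /= !add1n.
have int1 : (\int[mu]_(x in `[(2 * h)%R, T]) (step n.+1 b x)%:E = (h * \sum_(j < n.+1) b j)%:E)%E.
  apply: integral_step_eq => // j jn bj x /=; rewrite !in_itv /= => /andP[x1 x2].
  have j2 : (2 <= j)%N by move: bj; rewrite /b; case: leqP => //; rewrite eqxx.
  apply/andP; split.
    by apply: le_trans x1; rewrite ler_pM2r // ler_nat.
  by apply: (le_trans (ltW x2)); rewrite ler_pM2r // ler_nat.
have int2 : (\int[mu]_(x in `[(2 * h)%R, T]) (step n.+1 b x)%:E <=
    \int[mu]_(x in `[(2 * h)%R, T]) q x)%E.
  apply: ge0_le_lower_integral => s /=; rewrite in_itv /= => /andP[s1 s2].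
    by rewrite lee_fin step_ge0.
  have s0 : 0 <= s by apply: le_trans s1; rewrite mulr_ge0 // ltW.
  have [j js] := block_of h0 s0.
  have q0 : (0 <= q s)%E.
    apply: le_trans (pq s s s1 _); first by rewrite lee_fin; have /andP[] := pB s s0.
    by rewrite lexx andbT lerBlDr lerDl mulr_ge0 // ltW.
  case: (ltnP j n.+1) => jn; last first.
    rewrite step_out // => i iN is_; move: jn; rewrite (block_inj h0 js is_).
    by rewrite leqNgt iN.
  rewrite (step_at _ jn js) /b; case: (leqP 2 j) => // j2.
  have jS : (j.-1.+1 = j)%N by rewrite prednK // ltnW.
  case/andP: js => js1 js2.
  have pj t : block h j.-1 t -> ((p t)%:E <= q s)%E.
    rewrite /block jS => /andP[t1 t2]; apply: pq => //; rewrite (le_trans t2 js1) andbT.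
    have jE : j.+1%:R * h = j.-1%:R * h + 2 * h by rewrite -{1}jS -natr1 -natr1; ring.
    rewrite jE in js2; rewrite lerBlDr; apply: (le_trans (ltW js2)).
    by rewrite lerD2r.
  case: (q s) q0 pj => [y| |] // y0 pj; last by rewrite leey.
  rewrite lee_fin; apply: ge_sup => // _ [t jt <-].
  by rewrite -lee_fin pj.
have int3 := hU0 T UT.
have int20 : (0 <= \int[mu]_(s in `[(2 * h)%R, T]) q s)%E.
  by apply: le_trans int2; rewrite int1 lee_fin mulr_ge0 ?(ltW h0) // sumr_ge0.
have int4 : ((T^-1)%:E * (h * \sum_(j < n.+1) b j)%:E <= (e / 2)%:E)%E.
  apply: le_trans int3; rewrite -int1; apply: lee_wpmul2l => //.
  by rewrite lee_fin invr_ge0 ltW.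
move: int4; rewrite -EFinM lee_fin ler_pdivrMl // /T mulrAC [X in _ <= X]mulrC ler_pM2l // => sb.
rewrite sumb.
have a0n : a 0%N + e / 2 <= e / 2 * n%:R.
  have : a 0%N * 2 / e + 1 <= n%:R by [].
  have -> : a 0%N + e / 2 = e / 2 * (a 0%N * 2 / e + 1) by field; rewrite gt_eqF.
  by move=> ?; rewrite ler_pM2l.
move: sb a0n; rewrite -natr1 mulrDl mul1r; move: (\sum_(j < n.+1) b j) => sb.
have -> : e * n%:R = n%:R * (e / 2) + e / 2 * n%:R by field.
by move=> *; lra.
Qed.

End MeanNull.

(** * Convolution with the solution operator *)

Section ContOn.
Variables (R : realType) (X : completeNormedModType R[i]).
Implicit Types (u v : R -> X) (A B : set R).

Lemma cont_onD A u v : cont_on A u -> cont_on A v -> cont_on A (fun t => u t + v t).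
Proof.
move=> cu cv t0 At0 e e0; have e20 : 0 < e / 2 by rewrite divr_gt0.
have [d1 d10 hd1] := cu t0 At0 _ e20; have [d2 d20 hd2] := cv t0 At0 _ e20.
exists (Num.min d1 d2) => [|t At]; rewrite lt_min ?d10 // => /andP[t1 t2].
have -> : u t + v t - (u t0 + v t0) = (u t - u t0) + (v t - v t0) by rewrite opprD addrACA.
by apply: (le_lt_trans (nrmD _ _)); rewrite (splitr e) ltrD ?hd1 ?hd2.
Qed.

Lemma cont_onN A u : cont_on A u -> cont_on A (fun t => - u t).
Proof.
move=> cu t0 At0 e e0; have [d d0 hd] := cu t0 At0 _ e0.
by exists d => // t At td; rewrite -opprD nrmN; exact: hd.
Qed.

Lemma cont_on_cst A (x : X) : cont_on A (fun=> x).
Proof. by move=> t0 _ e e0; exists 1 => // t _ _; rewrite subrr nrm0. Qed.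

Lemma cont_on_comp A B u (k : R -> R) : cont_on B u -> (forall t, A t -> B (k t)) ->
  (forall s t, `|k s - k t| <= `|s - t|) -> cont_on A (fun t => u (k t)).
Proof.
move=> cu AB k1 t0 At0 e e0; have [d d0 hd] := cu _ (AB _ At0) _ e0.
by exists d => // t At td; apply: hd; [exact: AB | exact: le_lt_trans (k1 _ _) td].
Qed.

Lemma cont_on_unif_lim A u :
  (forall e, 0 < e -> exists2 v, cont_on A v & forall t, A t -> nrm (u t - v t) <= e) ->
  cont_on A u.
Proof.
move=> hu t0 At0 e e0; have e40 : 0 < e / 4 by rewrite divr_gt0.
have [v cv uv] := hu _ e40; have [d d0 hd] := cv t0 At0 _ e40.
exists d => // t At td; have h1 := uv _ At; have h2 := uv _ At0; have h3 := hd _ At td.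
apply: (le_lt_trans (nrm_dist (v t) _ _)).
have := nrm_dist (v t0) (v t) (u t0); rewrite (nrmB (v t0)).
move: h1 h2 h3; move: (nrm _) (nrm _) (nrm _) (nrm _) => *; lra.
Qed.

Lemma min0_lip (s t : R) : `|Num.min s 0 - Num.min t 0| <= `|s - t|.
Proof.
have := ler_norm (s - t); have := ler_norm (- (s - t)); rewrite normrN ler_norml.
by move: `|s - t| => n *; case: (leP s 0) => ?; case: (leP t 0) => ?; apply/andP; split; lra.
Qed.

Lemma max0_lip (s t : R) : `|Num.max s 0 - Num.max t 0| <= `|s - t|.
Proof.
have := ler_norm (s - t); have := ler_norm (- (s - t)); rewrite normrN ler_norml.
by move: `|s - t| => n *; case: (leP s 0) => ?; case: (leP t 0) => ?; apply/andP; split; lra.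
Qed.

End ContOn.

Section Convolution.
Variables (R : realType) (X : completeNormedModType R[i]).
Variables (S : R -> {linear X -> X}) (k G : R -> R) (K k0 : R).
Hypothesis S_cont : forall x, cont_on `[0, +oo[ (fun t => S t x).
Hypothesis S_le : forall t x, 0 <= t -> nrm (S t x) <= k t * nrm x.
Hypothesis k_ge0 : forall t, 0 <= t -> 0 <= k t.
Hypothesis k_le : forall t, 0 <= t -> k t <= k0.
Hypothesis G_ge : forall u v, 0 <= u -> u <= v -> (v - u) * k v <= G v - G u.
Hypothesis G_le : forall u v, 0 <= u -> u <= v -> G v - G u <= K.
Implicit Types (h x : R -> X).

Lemma k0_ge0 : 0 <= k0. Proof. exact: le_trans (k_ge0 (lexx 0)) (k_le (lexx 0)). Qed.

Lemma G_mono u v : 0 <= u -> u <= v -> G u <= G v.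
Proof.
move=> u0 uv; rewrite -subr_ge0; apply: le_trans (G_ge u0 uv).
by rewrite mulr_ge0 ?subr_ge0 // k_ge0 // (le_trans u0).
Qed.

Lemma K_ge0 : 0 <= K.
Proof. by rewrite -(subrr (G 0)); exact: G_le. Qed.

(** [G] is nondecreasing and bounded, hence nearly constant far away. *)
Lemma G_tail e : 0 < e -> exists2 T, 0 <= T & forall u v, T <= u -> u <= v -> G v - G u <= e.
Proof.
move=> e0; pose V := [set G t | t in [set t | 0 <= t]].
have Vs : has_sup V.
  split; first by exists (G 0), 0 => /=.
  by exists (G 0 + K) => _ [t /= t0 <-]; rewrite -lerBlDl G_le.
have [_ [T /= T0 <-] hT] := sup_adherent e0 Vs.
exists T => // u v Tu uv.
have u0 : 0 <= u by apply: le_trans Tu.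
have h1 : G v <= sup V.
  by apply: ub_le_sup; [case: Vs | exists v => //=; exact: le_trans uv].
have h2 := G_mono T0 Tu; lra.
Qed.

(** Strong continuity and local boundedness of [S] give joint continuity. *)
Lemma S_comp_cont (A : set R) x : A `<=` [set t | 0 <= t] -> cont_on A x ->
  cont_on A (fun v => S v (x v)).
Proof.
move=> A0 cx t0 At0 e e0; have e20 : 0 < e / 2 by rewrite divr_gt0.
have k1 : 0 < k0 + 1 by have := k0_ge0; lra.
have ek : 0 < e / 2 / (k0 + 1) by rewrite divr_gt0.
have [|d1 d10 hd1] := S_cont (x t0) (t0 := t0) _ e20.
  by rewrite /= in_itv /= andbT; exact: A0.
have [d2 d20 hd2] := cx t0 At0 _ ek.
exists (Num.min d1 d2); first by rewrite lt_min d10.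
move=> t At; rewrite lt_min => /andP[t1 t2].
have tt : 0 <= t := A0 _ At.
apply: (le_lt_trans (nrm_dist (S t (x t0)) _ _)); rewrite (splitr e) ler_ltD //; last first.
  by apply: hd1; rewrite //= in_itv /= tt.
rewrite -linearB; apply: (le_trans (S_le _ tt)).
apply: (@le_trans _ _ ((k0 + 1) * (e / 2 / (k0 + 1)))).
  by apply: ler_pM; rewrite ?nrm_ge0 ?k_ge0 //; [have := k_le tt; lra | exact/ltW/hd2].
by rewrite mulrC divfK // gt_eqF.
Qed.

(** [G] dominates the Riemann sums of [k] tagged at right ends, so these are the tags
    to choose. *)
Lemma S_int_le x a b m y : 0 <= a -> (forall v, a <= v <= b -> nrm (x v) <= m) ->
  is_rint (fun v => S v (x v)) a b y -> nrm y <= m * (G b - G a).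
Proof.
move=> a0 xm hy; have [ab _] := hy.
have m0 : 0 <= m by apply: le_trans (xm a _); rewrite ?nrm_ge0 // lexx ab.
rewrite mulrBr; apply: (is_rint_le (g := fun v => k v * m) (G := fun v => m * G v) _ _ hy).
  move=> s /[dup] sab /andP[as_ _]; have s0 : 0 <= s by apply: le_trans as_.
  by apply: (le_trans (S_le _ s0)); rewrite ler_wpM2l ?k_ge0 // xm.
move=> u v au uv _; exists v; first by rewrite uv lexx.
by rewrite /= -mulrBr mulrA [leLHS]mulrC ler_wpM2l // G_ge // (le_trans a0).
Qed.

Lemma S_int_le_length x a b m y : 0 <= a -> (forall v, a <= v <= b -> nrm (x v) <= m) ->
  is_rint (fun v => S v (x v)) a b y -> nrm y <= k0 * m * (b - a).
Proof.
move=> a0 xm hy; rewrite mulrBr.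
apply: (is_rint_le (g := fun v => k0 * m) (G := fun v => k0 * m * v) _ _ hy).
  move=> s /[dup] sab /andP[as_ _]; have s0 : 0 <= s by apply: le_trans as_.
  by apply: (le_trans (S_le _ s0)); apply: ler_pM; rewrite ?k_ge0 ?nrm_ge0 ?k_le ?xm.
by move=> u v _ uv _; exists v; [rewrite uv lexx|rewrite /= -mulrBr mulrC].
Qed.

(** The convolution is written with the time variable in the integrand [h]: its
    increments then only involve those of [h]. *)
Definition Sconv h (t : R) : X :=
  xget 0 [set y | is_rint (fun v => S v (h (t - v))) 0 t y].

Lemma Sconv_integrand_cont h t : cont_on `[0, +oo[ h ->
  cont_on `[0, t] (fun v => S v (h (t - v))).
Proof.
move=> ch; apply: S_comp_cont; first by move=> v /=; rewrite in_itv /= => /andP[].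
apply: (cont_on_comp (k := fun v => t - v) ch).
  by move=> v /=; rewrite !in_itv /= andbT subr_ge0 => /andP[].
move=> s s'; have -> : t - s - (t - s') = - (s - s') by ring.
by rewrite normrN.
Qed.

Lemma SconvP h t : cont_on `[0, +oo[ h -> 0 <= t ->
  is_rint (fun v => S v (h (t - v))) 0 t (Sconv h t).
Proof.
move=> ch t0; have [y hy] := is_rint_exists t0 (Sconv_integrand_cont (t := t) ch).
by rewrite /Sconv; case: xgetP => [z -> //|/(_ y)].
Qed.

Lemma Sconv_le h t m : cont_on `[0, +oo[ h -> 0 <= t ->
  (forall s, 0 <= s <= t -> nrm (h s) <= m) -> nrm (Sconv h t) <= m * K.
Proof.
move=> ch t0 hm; have m0 : 0 <= m by apply: le_trans (hm 0 _); rewrite ?nrm_ge0 // lexx t0.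
apply: (@le_trans _ _ (m * (G t - G 0))); last by rewrite ler_wpM2l // G_le.
apply: (S_int_le (lexx 0) _ (SconvP ch t0)).
by move=> v /andP[v0 vt]; apply: hm; rewrite subr_ge0 vt lerBlDr lerDl.
Qed.

Lemma Sconv0 h : cont_on `[0, +oo[ h -> Sconv h 0 = 0.
Proof.
move=> ch; apply: nrm_eq0; apply/eqP; rewrite eq_le nrm_ge0 andbT.
have := S_int_le (m := nrm (h 0)) (lexx 0) _ (SconvP ch (lexx 0)).
rewrite subrr mulr0; apply=> v /andP[v0 v1].
by have -> : v = 0 by [apply/eqP; rewrite eq_le v0 v1]; rewrite subrr.
Qed.

Lemma SconvB_le h1 h2 t m : cont_on `[0, +oo[ h1 -> cont_on `[0, +oo[ h2 -> 0 <= t ->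
  (forall s, 0 <= s <= t -> nrm (h1 s - h2 s) <= m) ->
  nrm (Sconv h1 t - Sconv h2 t) <= m * K.
Proof.
move=> c1 c2 t0 hm; have m0 : 0 <= m by apply: le_trans (hm 0 _); rewrite ?nrm_ge0 // lexx t0.
have h := is_rintB (SconvP c1 t0) (SconvP c2 t0).
have {}h : is_rint (fun v => S v (h1 (t - v) - h2 (t - v))) 0 t (Sconv h1 t - Sconv h2 t).
  by apply: eq_is_rint h => s _; rewrite linearB.
apply: (@le_trans _ _ (m * (G t - G 0))); last by rewrite ler_wpM2l // G_le.
apply: (S_int_le (lexx 0) _ h).
by move=> v /andP[v0 vt]; apply: hm; rewrite subr_ge0 vt lerBlDr lerDl.
Qed.

(** The increment splits into the convolution with the increment of [h] and an
    integral over the last stretch of length [w]. *)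
Lemma Sconv_shift h t w : cont_on `[0, +oo[ h -> 0 <= t -> 0 <= w ->
  exists y1 y2, [/\ is_rint (fun v => S v (h (t + w - v) - h (t - v))) 0 t y1,
    is_rint (fun v => S v (h (t + w - v))) t (t + w) y2 &
    Sconv h (t + w) - Sconv h t = y1 + y2].
Proof.
move=> ch t0 w0; have tw : t <= t + w by rewrite lerDl.
have tw0 : 0 <= t + w by apply: addr_ge0.
have cc := Sconv_integrand_cont (t := t + w) ch.
have c1 : cont_on `[0, t] (fun v => S v (h (t + w - v))).
  by apply: cont_onS cc => v /=; rewrite !in_itv /= => /andP[-> /le_trans ->].
have c2 : cont_on `[t, t + w] (fun v => S v (h (t + w - v))).
  by apply: cont_onS cc => v /=; rewrite !in_itv /= => /andP[/(le_trans t0) -> ->].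
have [z hz] := is_rint_exists t0 c1; have [y2 hy2] := is_rint_exists tw c2.
exists (z - Sconv h t), y2; split=> //.
  have h1 := is_rintB hz (SconvP ch t0).
  by apply: eq_is_rint h1 => s _; rewrite linearB.
by rewrite (is_rint_chasles t0 tw cc hz hy2 (SconvP ch tw0)) addrAC.
Qed.

(** By [Sconv_shift], the first part is small by uniform continuity of [h] and the
    second one because it is an integral over a short interval. *)
Lemma Sconv_cont h H : cont_on `[0, +oo[ h -> (forall s, 0 <= s -> nrm (h s) <= H) ->
  cont_on `[0, +oo[ (Sconv h).
Proof.
move=> ch hH t0; rewrite /= in_itv /= andbT => t00 e e0.
have e20 : 0 < e / 2 by rewrite divr_gt0.
have H0 : 0 <= H by apply: le_trans (hH 0 _); rewrite ?nrm_ge0.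
have ku := k0_ge0; have Ku := K_ge0.
have chT : cont_on `[0, t0 + 1] h.
  by apply: cont_onS ch => s /=; rewrite !in_itv /= => /andP[->].
have e1 : 0 < e / 2 / (K + 1) by rewrite divr_gt0 //; lra.
have [d d0 hd] := unif_cont chT e1.
have kH : 0 < k0 * H + 1 by have : 0 <= k0 * H by [apply: mulr_ge0]; lra.
pose d1 := Num.min (Num.min d 1) (e / 2 / (k0 * H + 1)).
have d10 : 0 < d1 by rewrite !lt_min d0 ltr01 divr_gt0.
exists d1 => // t; rewrite /= in_itv /= andbT => tt.
rewrite !lt_min => /andP[/andP[td t1] tk].
suff main a w : 0 <= a -> 0 <= w -> a + w <= t0 + 1 -> w < d -> w < e / 2 / (k0 * H + 1) ->
    nrm (Sconv h (a + w) - Sconv h a) < e.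
  case: (leP t0 t) => tt0.
    move: td t1 tk; rewrite ger0_norm ?subr_ge0 // => td t1 tk.
    by have := main t0 (t - t0); have -> : t0 + (t - t0) = t by [ring]; apply=> //; rewrite ?subr_ge0 //; lra.
  move: td t1 tk; rewrite distrC gtr0_norm ?subr_gt0 // => td t1 tk.
  rewrite nrmB; have := main t (t0 - t); have -> : t + (t0 - t) = t0 by [ring]; apply=> //; lra.
move=> a0 w0 aw wd wk.
have [y1 [y2 [hy1 hy2 ->]]] := Sconv_shift ch a0 w0.
apply: (le_lt_trans (nrmD _ _)); rewrite (splitr e) ltrD //.
  apply: (@le_lt_trans _ _ (e / 2 / (K + 1) * K)).
    apply: (@le_trans _ _ (e / 2 / (K + 1) * (G a - G 0))).
      apply: (S_int_le (lexx 0) _ hy1).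
      move=> v /andP[v0 va]; apply/ltW/hd; rewrite ?in_itv /=; try (apply/andP; split; lra).
      by have -> : a + w - v - (a - v) = w by [ring]; rewrite ger0_norm.
    by rewrite ler_wpM2l ?G_le // ltW.
  by rewrite mulrAC ltr_pdivrMr ?ltr_pM2l //; lra.
apply: (@le_lt_trans _ _ (k0 * H * w)).
  have -> : w = a + w - a by ring.
  apply: (S_int_le_length a0 _ hy2) => v /andP[v1 v2].
  by apply: hH; rewrite subr_ge0.
have : w * (k0 * H + 1) < e / 2 by rewrite -ltr_pdivlMr.
rewrite mulrDr mulr1 [k0 * H * w]mulrC; move: (w * (k0 * H)) => *; lra.
Qed.

End Convolution.

(** * Composition with histories *)

Section Histories.
Variables (R : realType) (X : completeNormedModType R[i]) (r : R).
Hypothesis r0 : 0 < r.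
Implicit Types (u psi : R -> X).

Lemma hist_norm_le psi m : (forall th : R, - r <= th <= 0 -> nrm (psi th) <= m) ->
  hist_norm r psi <= m.
Proof.
move=> hm; apply: ge_sup.
  by exists (nrm (psi 0)), 0 => //=; rewrite in_itv /= lexx andbT oppr_le0 ltW.
by move=> _ [th /= + <-]; rewrite in_itv; exact: hm.
Qed.

Lemma nrm_le_hist_norm psi m th : (forall th : R, - r <= th <= 0 -> nrm (psi th) <= m) ->
  - r <= th <= 0 -> nrm (psi th) <= hist_norm r psi.
Proof.
move=> hm hth; apply: ub_le_sup; last by exists th.
by exists m => _ [t /= + <-]; rewrite in_itv; exact: hm.
Qed.

Lemma hist_spaceP u (t : R) : cont_on `[- r, +oo[ u -> 0 <= t -> hist_space r (hist u t).
Proof.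
move=> cu t0; apply/within_cont_on; apply: (cont_on_comp cu).
  by move=> s /=; rewrite !in_itv /= andbT => /andP[s1 _]; lra.
by move=> s s'; have -> : t + s - (t + s') = s - s' by ring.
Qed.

Lemma hist_space_cst (x : X) : hist_space r (fun=> x).
Proof. by apply/within_cont_on; exact: cont_on_cst. Qed.

Section Composition.
Variables (F : R -> (R -> X) -> X) (La KF : R).
Hypothesis F_cont : continuous_hist r F.
Hypothesis La0 : 0 <= La.
Hypothesis F_lip : forall (t : R) psi1 psi2, 0 <= t -> hist_space r psi1 -> hist_space r psi2 ->
  nrm (F t psi1 - F t psi2) <= La * hist_norm r (fun th => psi1 th - psi2 th).
Hypothesis F_0 : forall t : R, 0 <= t -> nrm (F t (fun=> 0)) <= KF.

(** The uniform continuity of [u] on compacts makes t |-> hist u t continuous for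
    the sup norm. *)
Lemma comp_hist_cont u : cont_on `[- r, +oo[ u ->
  cont_on `[0, +oo[ (fun t => F t (hist u t)).
Proof.
move=> cu t0; rewrite /= in_itv /= andbT => t00 e e0.
have [d d0 hd] := F_cont t00 (hist_spaceP cu t00) e0.
have cuT : cont_on `[- r, t0 + 1] u.
  by apply: cont_onS cu => s /=; rewrite !in_itv /= => /andP[->].
have d20 : 0 < d / 2 by rewrite divr_gt0.
have [d' d'0 hd'] := unif_cont cuT d20.
exists (Num.min (Num.min d 1) d'); first by rewrite !lt_min d0 ltr01.
move=> t; rewrite /= in_itv /= andbT => tt; rewrite !lt_min => /andP[/andP[t1 t2] t3].
apply: hd => //; first exact: hist_spaceP.
apply: (@le_lt_trans _ _ (d / 2)); last lra.
apply: hist_norm_le => th /andP[th1 th2]; apply/ltW/hd'.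
- by rewrite in_itv /=; move: t2; rewrite ltr_norml => /andP[? ?]; apply/andP; split; lra.
- by rewrite in_itv /=; apply/andP; split; lra.
- by have -> : t + th - (t0 + th) = t - t0 by ring.
Qed.

Lemma comp_hist_lip u1 u2 (t m : R) : cont_on `[- r, +oo[ u1 -> cont_on `[- r, +oo[ u2 -> 0 <= t ->
  (forall s : R, t - r <= s <= t -> nrm (u1 s - u2 s) <= m) ->
  nrm (F t (hist u1 t) - F t (hist u2 t)) <= La * m.
Proof.
move=> c1 c2 t0 hm; apply: (le_trans (F_lip t0 (hist_spaceP c1 t0) (hist_spaceP c2 t0))).
rewrite ler_wpM2l //; apply: hist_norm_le => th /andP[th1 th2]; apply: hm.
by apply/andP; split; lra.
Qed.

Lemma lipschitz_growth psi (m t : R) : hist_space r psi -> 0 <= t ->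
  (forall th : R, - r <= th <= 0 -> nrm (psi th) <= m) -> nrm (F t psi) <= KF + La * m.
Proof.
move=> hpsi t0 hm; rewrite -(subrK (F t (fun=> 0)) (F t psi)).
apply: (le_trans (nrmD _ _)); rewrite addrC lerD ?F_0 //.
have hF := F_lip t0 hpsi (@hist_space_cst 0).
apply: (le_trans hF); rewrite ler_wpM2l //.
by apply: hist_norm_le => th; rewrite subr0; exact: hm.
Qed.

Lemma comp_hist_le u (B t : R) : cont_on `[- r, +oo[ u -> 0 <= t ->
  (forall s : R, - r <= s -> nrm (u s) <= B) -> nrm (F t (hist u t)) <= KF + La * B.
Proof.
move=> cu t0 uB; apply: lipschitz_growth => // [|th /andP[th1 _]].
  exact: hist_spaceP.
by apply: uB; lra.
Qed.

Variable w : R.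
Hypothesis w0 : 0 < w.
Hypothesis F_null : forall L : R, 0 < L -> mean_null r (fun s => ereal_sup
  [set ereal_sup [set (nrm (F (tau + w) x - F tau x))%:E |
                    x in [set x | hist_space r x /\ hist_norm r x <= L]]
  | tau in `[s - r, s]]).

(** The history of a bounded function stays in a fixed ball, over which the
    hypothesis takes a supremum. *)
Lemma shift_time_null u B : cont_on `[- r, +oo[ u ->
  (forall s : R, - r <= s -> nrm (u s) <= B) ->
  block_null (r / 2) (fun s => nrm (F (s + w) (hist u (s + w)) - F s (hist u (s + w)))).
Proof.
move=> cu uB; have r20 : 0 < r / 2 by rewrite divr_gt0.
have hs (s : R) : 0 <= s -> hist_space r (hist u (s + w)).
  by move=> s0; apply: hist_spaceP => //; rewrite addr_ge0 // ltW.
have nB (s : R) : 0 <= s -> hist_norm r (hist u (s + w)) <= B.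
  move=> s0; apply: hist_norm_le => th /andP[th1 _]; apply: uB; rewrite /hist.
  by apply: (le_trans th1); rewrite lerDr addr_ge0 // ltW.
have [L L0 BL] : exists2 L : R, 0 < L & B <= L.
  by exists (Num.max B 1); rewrite ?lt_max ?ltr01 ?orbT // le_max lexx.
have rE : 2 * (r / 2) = r by field.
have := F_null L0; rewrite -{1}rE.
apply: (@block_null_of_mean _ _ r20 _ _ (2 * (KF + La * B))).
  move=> s s0; rewrite nrm_ge0 /=; apply: (le_trans (nrmD _ _)); rewrite nrmN.
  have sw : 0 <= s + w by rewrite addr_ge0 // ltW.
  have h1 := comp_hist_le cu sw uB.
  have h2 : nrm (F s (hist u (s + w))) <= KF + La * B.
    apply: lipschitz_growth => //; first exact: hs.
    move=> th /andP[th1 _]; apply: uB; apply: (le_trans th1).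
    by rewrite lerDr addr_ge0 // ltW.
  move: h1 h2; move: (nrm _) (nrm _) (KF + _) => *; lra.
move=> s t; rewrite rE => sr /andP[t1 t2].
apply: (@le_trans _ _ (ereal_sup [set (nrm (F (t + w) x - F t x))%:E |
                    x in [set x | hist_space r x /\ hist_norm r x <= L]])).
  have t0 : 0 <= t by lra.
  by apply: ereal_sup_ubound; exists (hist u (t + w)) => //=; split; [exact: hs|exact: le_trans (nB _ t0) BL].
by apply: ereal_sup_ubound; exists t => //=; rewrite in_itv /= t1.
Qed.

End Composition.

Variable w : R.
Hypothesis w0 : 0 < w.

(** The norm of a difference of histories is a supremum over a bounded past. The
    windows reaching below time 0 are set apart: they only concern a bounded
    interval of times. *)
Lemma hist_increment_null u B : (forall s : R, - r <= s -> nrm (u s) <= B) ->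
  block_null (r / 2) (fun s => nrm (u (s + w) - u s)) ->
  block_null (r / 2) (fun s => hist_norm r (fun th => hist u (s + w) th - hist u s th)).
Proof.
move=> uB bu; have r20 : 0 < r / 2 by rewrite divr_gt0.
have B0 : 0 <= B by apply: le_trans (uB 0 _); rewrite ?nrm_ge0 // oppr_le0 ltW.
pose W s := hist_norm r (fun th => hist u (s + w) th - hist u s th).
have WB (s : R) : 0 <= s -> W s <= B + B.
  move=> s0; apply: hist_norm_le => th /andP[th1 th2]; apply: (le_trans (nrmD _ _)).
  rewrite nrmN /hist; apply: lerD; apply: uB; apply: (le_trans th1); rewrite lerDr //.
  by rewrite addr_ge0 // ltW.
apply: (@block_null_le _ _ r20 _ (fun s => (if s < r then 0 else W s) + (if s < r then B + B else 0))).
  by move=> s s0; case: ltP => sr; rewrite ?add0r ?addr0 // WB.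
apply: block_nullD.
  apply: (block_null_causal r20 bu) => e e0; exists 2%N, 1; split=> // t m t0 m0 hm.
  case: ltP => tr; first by rewrite addr_ge0 ?mulr_ge0 // ltW.
  apply: (@le_trans _ _ m); last by rewrite mul1r lerDl ltW.
  apply: hist_norm_le => th /andP[th1 th2]; rewrite /hist.
  have -> : t + w + th = t + th + w by ring.
  by apply: hm; [lra | apply/andP; split; lra].
apply: (@block_null_cvg0 _ _ r20 _ (B + B)) => [s _|e e0].
  by case: ltP => _ //; exact: addr_ge0.
by exists r => s sr; rewrite ltNge sr /= ltW.
Qed.

End Histories.

(** * The Volterra equation *)

Section Bounded.
Variables (R : realType) (X : completeNormedModType R[i]).

Lemma nrm_lip (x y : X) : `|nrm x - nrm y| <= nrm (x - y).
Proof.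
have h1 : nrm x <= nrm (x - y) + nrm y by rewrite -{1}(subrK y x) nrmD.
have h2 : nrm y <= nrm (x - y) + nrm x by rewrite nrmB -{1}(subrK x y) nrmD.
by rewrite ler_norml; move: h1 h2; move: (nrm _) (nrm _) (nrm _) => *; apply/andP; split; lra.
Qed.

Lemma cont_on_bounded (a b : R) (u : R -> X) : a <= b -> cont_on `[a, b] u ->
  exists B, forall s : R, a <= s <= b -> nrm (u s) <= B.
Proof.
move=> ab cu.
have cn : {within `[a, b], continuous (fun t => nrm (u t))}.
  rewrite subspace_continuousP => t0 At0; apply/cvgrPdist_lt => e e0.
  have [d d0 hd] := cu t0 At0 _ e0; rewrite near_withinE.
  apply/nbhs_ballP; exists d => //= t; rewrite -ball_normE /ball_ /= distrC => td At.
  by rewrite distrC; apply: le_lt_trans (nrm_lip _ _) _; exact: hd.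
have [c _ hc] := EVT_max ab cn.
by exists (nrm (u c)) => s sab; apply: hc; rewrite in_itv.
Qed.

End Bounded.

Section Volterra.
Variables (R : realType) (X : completeNormedModType R[i]).
Variables (S : R -> {linear X -> X}) (k G : R -> R) (K k0 : R).
Hypothesis S_cont : forall x, cont_on `[0, +oo[ (fun t => S t x).
Hypothesis S_le : forall (t : R) x, 0 <= t -> nrm (S t x) <= k t * nrm x.
Hypothesis S_0 : forall x, S 0 x = x.
Hypothesis k_ge0 : forall t : R, 0 <= t -> 0 <= k t.
Hypothesis k_le : forall t : R, 0 <= t -> k t <= k0.
Hypothesis k_cvg0 : forall e : R, 0 < e -> exists T : R, forall t, T <= t -> k t <= e.
Hypothesis G_ge : forall u v : R, 0 <= u -> u <= v -> (v - u) * k v <= G v - G u.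
Hypothesis G_le : forall u v : R, 0 <= u -> u <= v -> G v - G u <= K.
Variables (r w : R) (phi : R -> X) (f g : R -> (R -> X) -> X) (Lf Lg Kf Kg : R).
Hypotheses (r0 : 0 < r) (w0 : 0 < w) (phi_cont : cont_on `[- r, 0] phi).
Hypotheses (f_cont : continuous_hist r f) (g_cont : continuous_hist r g).
Hypotheses (Lf0 : 0 <= Lf) (Lg0 : 0 <= Lg).
Hypothesis f_lip : forall (t : R) psi1 psi2, 0 <= t -> hist_space r psi1 -> hist_space r psi2 ->
  nrm (f t psi1 - f t psi2) <= Lf * hist_norm r (fun th => psi1 th - psi2 th).
Hypothesis g_lip : forall (t : R) psi1 psi2, 0 <= t -> hist_space r psi1 -> hist_space r psi2 ->
  nrm (g t psi1 - g t psi2) <= Lg * hist_norm r (fun th => psi1 th - psi2 th).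
Hypothesis f_0 : forall t : R, 0 <= t -> nrm (f t (fun=> 0)) <= Kf.
Hypothesis g_0 : forall t : R, 0 <= t -> nrm (g t (fun=> 0)) <= Kg.
Hypothesis f_null : forall L : R, 0 < L -> mean_null r (fun s => ereal_sup
  [set ereal_sup [set (nrm (f (tau + w) x - f tau x))%:E |
                    x in [set x | hist_space r x /\ hist_norm r x <= L]]
  | tau in `[s - r, s]]).
Hypothesis g_null : forall L : R, 0 < L -> mean_null r (fun s => ereal_sup
  [set ereal_sup [set (nrm (g (tau + w) x - g tau x))%:E |
                    x in [set x | hist_space r x /\ hist_norm r x <= L]]
  | tau in `[s - r, s]]).
Hypothesis q_lt1 : Lg + Lf * K < 1.
Implicit Types u : R -> X.

Let r20 : 0 < r / 2. Proof. by rewrite divr_gt0. Qed.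

Definition admissible (B : R) u := [/\ cont_on `[- r, +oo[ u,
  forall s : R, - r <= s -> nrm (u s) <= B & forall s : R, - r <= s <= 0 -> u s = phi s].

Definition null_increment u := block_null (r / 2) (fun s => nrm (u (s + w) - u s)).

Definition shifted_datum : X := phi 0 - g 0 phi.

Definition rhs u (t : R) : X :=
  S t shifted_datum + g t (hist u t) + Sconv S (fun s => f s (hist u s)) t.

(** Equal to [phi] on [-r, 0] and to [rhs u] on [0, oo[, since [rhs u 0 = phi 0];
    as a sum of two functions of min t 0 and max t 0, it is continuous without a
    gluing argument. *)
Definition volterra u (t : R) : X :=
  phi (Num.min t 0) + (rhs u (Num.max t 0) - phi 0).

Lemma volterra_pos u (t : R) : 0 <= t -> volterra u t = rhs u t.
Proof.
by move=> t0; rewrite /volterra (min_idPr t0) (max_idPl t0) addrC subrK.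
Qed.

(** This is where [S 0 = id] is used. *)
Lemma rhs_0 B u : admissible B u -> rhs u 0 = phi 0.
Proof.
move=> [cu uB uphi]; rewrite /rhs S_0 (Sconv0 S_cont S_le k_ge0 k_le G_ge) ?addr0; last exact: (comp_hist_cont r0 f_cont cu).
suff -> : g 0 (hist u 0) = g 0 phi by rewrite subrK.
apply/eqP; rewrite -subr_eq0; apply/eqP/nrm_small => e e0.
have hphi : hist_space r phi by apply/within_cont_on.
have z0 : 0 <= 0 :> R by [].
apply: (le_trans (g_lip z0 (hist_spaceP cu z0) hphi)).
apply: (@le_trans _ _ (Lg * 0)); last by rewrite mulr0 ltW.
rewrite ler_wpM2l //; apply: hist_norm_le => // th hth.
by rewrite /hist add0r uphi // subrr nrm0.
Qed.

Lemma volterra_neg B u (t : R) : admissible B u -> - r <= t <= 0 -> volterra u t = phi t.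
Proof.
move=> au /andP[_ t0]; rewrite /volterra (min_idPl t0) (max_idPr t0) (rhs_0 au).
by rewrite subrr addr0.
Qed.

Lemma rhs_cont B u : admissible B u -> cont_on `[0, +oo[ (rhs u).
Proof.
move=> [cu uB _]; apply: cont_onD; first by apply: cont_onD => //; exact: (comp_hist_cont r0 g_cont cu).
apply: (Sconv_cont S_cont S_le k_ge0 k_le G_ge G_le (H := Kf + Lf * B)).
  exact: (comp_hist_cont r0 f_cont cu).
by move=> s s0; apply: (comp_hist_le r0 Lf0 f_lip f_0).
Qed.

Lemma volterra_cont B u : admissible B u -> cont_on `[- r, +oo[ (volterra u).
Proof.
move=> au; apply: cont_onD.
  apply: (cont_on_comp (k := fun t => Num.min t 0) phi_cont _ (@min0_lip R)) => t.
  by rewrite /= !in_itv /= andbT le_min => ->; rewrite oppr_le0 (ltW r0) ge_min lexx orbT.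
apply: cont_onD; last by apply: cont_onN; exact: cont_on_cst.
apply: (cont_on_comp (k := fun t => Num.max t 0) (rhs_cont au) _ (@max0_lip R)) => t _.
by rewrite /= in_itv /= andbT le_max lexx orbT.
Qed.

Lemma volterra_adm B u : admissible B u -> exists B', admissible B' (volterra u).
Proof.
move=> au; have [cu uB _] := au.
have r0' : - r <= 0 by rewrite oppr_le0 ltW.
have [P hP] := cont_on_bounded r0' phi_cont.
exists (P + (k0 * nrm shifted_datum + (Kg + Lg * B) + (Kf + Lf * B) * K + nrm (phi 0))).
split=> [|t rt|t]; [exact: volterra_cont au| |exact: (volterra_neg au)].
apply: (le_trans (nrmD _ _)); rewrite lerD //.
  by apply: hP; rewrite le_min rt oppr_le0 (ltW r0) ge_min lexx orbT.
apply: (le_trans (nrmD _ _)); rewrite nrmN lerD2r.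
have t0 : 0 <= Num.max t 0 by rewrite le_max lexx orbT.
move: (Num.max t 0) t0 => {rt}t t0.
apply: (le_trans (nrmD _ _)); apply: lerD; first apply: (le_trans (nrmD _ _)); first apply: lerD.
- by apply: (le_trans (S_le _ t0)); rewrite ler_wpM2r ?nrm_ge0 // k_le.
- exact: (comp_hist_le r0 Lg0 g_lip g_0).
- apply: (Sconv_le S_cont S_le k_ge0 k_le G_ge G_le) => //.
    exact: (comp_hist_cont r0 f_cont cu).
  by move=> s /andP[s0 _]; apply: (comp_hist_le r0 Lf0 f_lip f_0).
Qed.

(** The terms in [S t] cancel; [g] contributes Lg and the convolution Lf times the
    integral of the kernel. *)
Lemma volterra_contract B1 B2 u1 u2 (m : R) : admissible B1 u1 -> admissible B2 u2 -> 0 <= m ->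
  (forall s : R, - r <= s -> nrm (u1 s - u2 s) <= m) ->
  forall t : R, - r <= t -> nrm (volterra u1 t - volterra u2 t) <= (Lg + Lf * K) * m.
Proof.
move=> [c1 b1 _] [c2 b2 _] m0 hm t rt.
rewrite /volterra opprD addrACA subrr add0r opprB addrA subrK.
have t0 : 0 <= Num.max t 0 by rewrite le_max lexx orbT.
move: (Num.max t 0) t0 => {rt}t t0.
have -> : rhs u1 t - rhs u2 t = (g t (hist u1 t) - g t (hist u2 t)) +
    (Sconv S (fun s => f s (hist u1 s)) t - Sconv S (fun s => f s (hist u2 s)) t).
  rewrite /rhs opprD addrACA; congr (_ + _).
  by rewrite opprD addrACA subrr add0r.
rewrite mulrDl; apply: (le_trans (nrmD _ _)); apply: lerD.
  by apply: (comp_hist_lip r0 Lg0 g_lip) => // s /andP[s1 _]; apply: hm; lra.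
rewrite mulrAC; apply: (SconvB_le S_cont S_le k_ge0 k_le G_ge G_le) => //;
  try exact: (comp_hist_cont r0 f_cont).
move=> s /andP[s0 _].
by apply: (comp_hist_lip r0 Lf0 f_lip) => // x /andP[x1 _]; apply: hm; lra.
Qed.

(** ** The increments of [volterra u] *)

(** F (s + w, u_(s+w)) - F (s, u_s) is the sum of an increment in time at fixed
    history and of an increment in history at fixed time. *)
Lemma comp_increment_null B u (F : R -> (R -> X) -> X) (L KF : R) :
  continuous_hist r F -> 0 <= L ->
  (forall (t : R) psi1 psi2, 0 <= t -> hist_space r psi1 -> hist_space r psi2 ->
    nrm (F t psi1 - F t psi2) <= L * hist_norm r (fun th => psi1 th - psi2 th)) ->
  (forall t : R, 0 <= t -> nrm (F t (fun=> 0)) <= KF) ->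
  (forall L : R, 0 < L -> mean_null r (fun s => ereal_sup
    [set ereal_sup [set (nrm (F (tau + w) x - F tau x))%:E |
                    x in [set x | hist_space r x /\ hist_norm r x <= L]]
    | tau in `[s - r, s]])) ->
  admissible B u -> null_increment u ->
  block_null (r / 2) (fun s => nrm (F (s + w) (hist u (s + w)) - F s (hist u s))).
Proof.
move=> F_cont L0 F_lip F_0 F_null [cu uB _] nu.
have b1 := shift_time_null r0 L0 F_lip F_0 w0 F_null cu uB.
have b2 := hist_increment_null r0 w0 uB nu.
have {}b2 : block_null (r / 2) (fun s => L * hist_norm r (fun th => hist u (s + w) th - hist u s th)).
  apply: (block_null_causal r20 b2) => e e0; exists 0%N, L; split=> // t m t0 m0 hm.
  apply: (@le_trans _ _ (L * m)); last by rewrite lerDl ltW.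
  by rewrite ler_wpM2l // hm // mul0r subr0 lexx.
apply: (block_null_le r20 _ (block_nullD b1 b2)) => s s0.
apply: (le_trans (nrm_dist (F s (hist u (s + w))) _ _)); rewrite lerD2l.
by apply: F_lip => //; apply: hist_spaceP => //; rewrite addr_ge0 // ltW.
Qed.

(** The integral over the last stretch tends to 0. In the other one, the kernel has
    a small tail: up to a small error only the increments of [h] over a bounded past
    count. *)
Lemma Sconv_increment_null h (H : R) : cont_on `[0, +oo[ h ->
  (forall s : R, 0 <= s -> nrm (h s) <= H) ->
  block_null (r / 2) (fun s => nrm (h (s + w) - h s)) ->
  block_null (r / 2) (fun s => nrm (Sconv S h (s + w) - Sconv S h s)).
Proof.
move=> ch hH nh.
have H0 : 0 <= H by apply: le_trans (hH 0 _); rewrite ?nrm_ge0.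
have tail := G_tail k_ge0 G_ge G_le; have Gm := G_mono k_ge0 G_ge.
have KK : 0 <= K by rewrite -(subrr (G 0)); exact: G_le.
have ex (s : R) : exists y : X * X, 0 <= s ->
   [/\ is_rint (fun v => S v (h (s + w - v) - h (s - v))) 0 s y.1,
    is_rint (fun v => S v (h (s + w - v))) s (s + w) y.2 &
    Sconv S h (s + w) - Sconv S h s = y.1 + y.2].
  case: (leP 0 s) => s0; last by exists (0, 0).
  have [y1 [y2 hy]] := Sconv_shift S_cont S_le k_ge0 k_le ch s0 (ltW w0).
  by exists (y1, y2).
have {ex} /choice [y hy] := ex.
apply: (@block_null_le _ _ r20 _ (fun s => nrm (y s).1 + nrm (y s).2)).
  by move=> s s0; have [_ _ ->] := hy s s0; exact: nrmD.
have n2 (s : R) : 0 <= s -> nrm (y s).2 <= H * (G (s + w) - G s).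
  move=> s0; have [_ h2 _] := hy s s0; apply: (S_int_le S_le k_ge0 G_ge s0 _ h2).
  by move=> v /andP[_ v2]; apply: hH; rewrite subr_ge0.
have ws (s : R) : s <= s + w by rewrite lerDl ltW.
apply: block_nullD; last first.
  apply: (@block_null_cvg0 _ _ r20 _ (H * K)) => [s s0|e e0].
    by apply: (le_trans (n2 s s0)); rewrite ler_wpM2l // G_le.
  have H1 : 0 < H + 1 by rewrite ltr_wpDl.
  have eH : 0 < e / (H + 1) by rewrite divr_gt0.
  have [T T0 hT] := tail _ eH; exists T => s Ts.
  apply: (le_trans (n2 s (le_trans T0 Ts))).
  apply: (@le_trans _ _ ((H + 1) * (e / (H + 1)))); last by rewrite mulrC divfK // gt_eqF.
  apply: ler_pM => //; last exact: hT.
    by rewrite subr_ge0 Gm // (le_trans T0).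
  by rewrite lerDl.
apply: (block_null_causal r20 nh) => e e0.
have H1 : 0 < H + H + 1 by rewrite ltr_wpDl // addr_ge0.
have eH : 0 < e / (H + H + 1) by rewrite divr_gt0.
have [T T0 hT] := tail _ eH.
have [N hN] := nat_large (T / (r / 2)).
have {}hN : T <= N%:R * (r / 2) by rewrite -ler_pdivrMr // hN.
have Nr0 : 0 <= N%:R * (r / 2) by apply: le_trans hN.
exists N, K; split=> // t m t0 m0 hm.
have [h1 _ _] := hy t t0.
have near (v : R) : 0 <= v -> v <= t -> v <= N%:R * (r / 2) -> nrm (h (t + w - v) - h (t - v)) <= m.
  move=> v0 vt vN; have -> : t + w - v = t - v + w by ring.
  by apply: hm; [rewrite subr_ge0|rewrite lerD2l lerN2 vN lerBlDr lerDl].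
case: (leP t (N%:R * (r / 2))) => tN.
  apply: (@le_trans _ _ (m * (G t - G 0))).
    apply: (S_int_le S_le k_ge0 G_ge (lexx 0) _ h1) => v /andP[v0 vt].
    by apply: near => //; exact: le_trans tN.
  apply: (@le_trans _ _ (K * m)); last by rewrite lerDl ltW.
  by rewrite mulrC ler_wpM2r // G_le.
move: (N%:R * _) Nr0 hN near tN => c c_ge0 Tc near ct.
have cc : cont_on `[0, t] (fun v => S v (h (t + w - v) - h (t - v))).
  apply: (S_comp_cont S_cont S_le k_ge0 k_le).
    by move=> v /=; rewrite in_itv /= => /andP[].
  apply: cont_onD; last apply: cont_onN.
    apply: (cont_on_comp (k := fun v => t + w - v) ch) => [v|v v'].
      by rewrite /= !in_itv /= andbT => /andP[_ vt]; rewrite subr_ge0 (le_trans vt).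
    have -> : t + w - v - (t + w - v') = - (v - v') by ring.
    by rewrite normrN.
  apply: (cont_on_comp (k := fun v => t - v) ch) => [v|v v'].
    by rewrite /= !in_itv /= andbT subr_ge0 => /andP[].
  have -> : t - v - (t - v') = - (v - v') by ring.
  by rewrite normrN.
have [|z1 hz1] := @is_rint_exists R X (fun v => S v (h (t + w - v) - h (t - v))) 0 c c_ge0.
  apply: cont_onS cc => v /=; rewrite !in_itv /= => /andP[-> /le_trans ->] //; exact: ltW.
have [|z2 hz2] := @is_rint_exists R X (fun v => S v (h (t + w - v) - h (t - v))) c t (ltW ct).
  by apply: cont_onS cc => v /=; rewrite !in_itv /= => /andP[/(le_trans c_ge0) -> ->].
rewrite (is_rint_chasles c_ge0 (ltW ct) cc hz1 hz2 h1).
apply: (le_trans (nrmD _ _)); apply: lerD.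
  apply: (@le_trans _ _ (m * (G c - G 0))); last by rewrite mulrC ler_wpM2r // G_le.
  apply: (S_int_le S_le k_ge0 G_ge (lexx 0) _ hz1) => v /andP[v0 vc].
  by apply: near => //; rewrite (le_trans vc) // ltW.
apply: (@le_trans _ _ ((H + H) * (G t - G c))).
  apply: (S_int_le S_le k_ge0 G_ge c_ge0 _ hz2) => v /andP[vc vt].
  apply: (le_trans (nrmD _ _)); rewrite nrmN lerD // hH ?subr_ge0 //.
  by rewrite (le_trans vt).
apply: (@le_trans _ _ ((H + H + 1) * (e / (H + H + 1)))); last by rewrite mulrC divfK // gt_eqF.
apply: ler_pM; first exact: addr_ge0.
- by rewrite subr_ge0 Gm // ltW.
- by rewrite lerDl.
- by apply: hT => //; exact: ltW.
Qed.

(** Besides the contributions of [f] and [g] there is that of S t c, which tends to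
    0 with the kernel. *)
Lemma volterra_null B u : admissible B u -> null_increment u -> null_increment (volterra u).
Proof.
move=> au nu; have [cu uB _] := au.
have bg := comp_increment_null g_cont Lg0 g_lip g_0 g_null au nu.
have bf := comp_increment_null f_cont Lf0 f_lip f_0 f_null au nu.
have cf := comp_hist_cont r0 f_cont cu.
have fB (s : R) (s0 : 0 <= s) := comp_hist_le r0 Lf0 f_lip f_0 cu s0 uB.
have {}bf := Sconv_increment_null cf fB bf.
pose n := nrm shifted_datum; have n0 : 0 <= n by apply: nrm_ge0.
have kk : 0 <= k0 by apply: le_trans (k_le (lexx 0)); exact: k_ge0.
have bS : block_null (r / 2) (fun s => k (s + w) * n + k s * n).
  have sw (s : R) : 0 <= s -> 0 <= s + w by move=> s0; rewrite addr_ge0 // ltW.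
  apply: (@block_null_cvg0 _ _ r20 _ (k0 * n + k0 * n)) => [s s0|e e0].
    by rewrite lerD // ler_wpM2r // k_le // sw.
  have n1 : 0 < n + n + 1 by rewrite ltr_wpDl // addr_ge0.
  have en : 0 < e / (n + n + 1) by rewrite divr_gt0.
  have [T hT] := k_cvg0 en; exists (Num.max T 0) => s; rewrite ge_max => /andP[Ts s0].
  apply: (@le_trans _ _ (e / (n + n + 1) * (n + n + 1))); last by rewrite divfK // gt_eqF.
  have h1 := hT s Ts; have h2 : k (s + w) <= e / (n + n + 1).
    by apply: hT; rewrite (le_trans Ts) // lerDl ltW.
  have h3 := ler_wpM2r n0 h1; have h4 := ler_wpM2r n0 h2.
  by rewrite !mulrDr mulr1 -[leLHS]addr0 lerD ?(ltW en) // lerD.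
apply: (block_null_le r20 _ (block_nullD bS (block_nullD bg bf))) => s s0.
have sw : 0 <= s + w by rewrite addr_ge0 // ltW.
rewrite !volterra_pos // /rhs opprD addrACA.
apply: (le_trans (nrmD _ _)); rewrite addrA lerD2r.
rewrite opprD addrACA; apply: (le_trans (nrmD _ _)); rewrite lerD2r.
by apply: (le_trans (nrmD _ _)); rewrite nrmN lerD // S_le.
Qed.

(** ** Picard iteration *)

Lemma q_ge0 : 0 <= Lg + Lf * K.
Proof. by rewrite addr_ge0 // mulr_ge0 // (K_ge0 G_le). Qed.

Lemma geometric_small (q c e : R) : 0 <= q -> q < 1 -> 0 < e ->
  exists N, forall n, (N <= n)%N -> q ^+ n * c < e.
Proof.
move=> q0 q1 e0; have nq : `|q| < 1 by rewrite ger0_norm.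
have cz : q ^+ n * c @[n --> \oo] --> (0 : R).
  by rewrite -[X in _ --> X](mul0r c); apply: cvgMl; exact: cvg_expr.
move/cvgrPdist_lt : cz => /(_ _ e0) [N _ hN].
exists N => n /hN /=; rewrite sub0r normrN; apply: le_lt_trans; exact: ler_norm.
Qed.

Definition picard (n : nat) : R -> X := iter n volterra (fun t => phi (Num.min t 0)).

Lemma picard_adm n : exists B, admissible B (picard n).
Proof.
elim: n => [|n [B hB]]; last exact: (volterra_adm hB).
have r0' : - r <= 0 by rewrite oppr_le0 ltW.
have [P hP] := cont_on_bounded r0' phi_cont; exists P; split.
- apply: (cont_on_comp (k := fun t => Num.min t 0) phi_cont _ (@min0_lip R)) => t.
  by rewrite /= !in_itv /= andbT le_min => ->; rewrite r0' ge_min lexx orbT.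
- by move=> s rs; apply: hP; rewrite le_min rs r0' ge_min lexx orbT.
- by move=> s /andP[_ s0]; rewrite /= (min_idPl s0).
Qed.

Lemma picard_null n : null_increment (picard n).
Proof.
elim: n => [|n IH]; last by have [B hB] := picard_adm n; exact: (volterra_null hB).
apply: (@block_null_cvg0 _ _ r20 _ 0) => [s s0|e e0].
  have sw : 0 <= s + w by rewrite addr_ge0 // ltW.
  by rewrite /= (min_idPr s0) (min_idPr sw) subrr nrm0.
exists 0 => s s0; have sw : 0 <= s + w by rewrite addr_ge0 // ltW.
by rewrite /= (min_idPr s0) (min_idPr sw) subrr nrm0 ltW.
Qed.

(** The iterates converge uniformly at a geometric rate, so that continuity,
    boundedness, the initial history and null increments all pass to the limit. *)
Lemma fixed_point_exists : exists B u, [/\ admissible B u, null_increment u &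
  forall t : R, - r <= t -> volterra u t = u t].
Proof.
set q := Lg + Lf * K; have q0 : 0 <= q := q_ge0; have q1 : q < 1 := q_lt1.
have [B0 a0] := picard_adm 0; have [B1 a1] := picard_adm 1.
pose d := B1 + B0.
have r0' : - r <= 0 by rewrite oppr_le0 ltW.
have Bpos B u : admissible B u -> 0 <= B.
  by move=> [_ uB _]; apply: le_trans (uB 0 r0'); exact: nrm_ge0.
have d0 : 0 <= d by rewrite addr_ge0 ?(Bpos _ _ a0) ?(Bpos _ _ a1).
have step n (t : R) : - r <= t -> nrm (picard n.+1 t - picard n t) <= q ^+ n * d.
  elim: n t => [|n IH] t rt.
    rewrite expr0 mul1r; apply: (le_trans (nrmD _ _)); rewrite nrmN.
    by have [_ b0 _] := a0; have [_ b1 _] := a1; rewrite lerD ?b0 ?b1.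
  have [C aC] := picard_adm n.+1; have [C' aC'] := picard_adm n.
  rewrite exprS -mulrA; apply: (volterra_contract aC aC') => //.
  by rewrite mulr_ge0 // exprn_ge0.
pose c := d / (1 - q); have q1' : 0 < 1 - q by rewrite subr_gt0.
have c0' : 0 <= c by rewrite divr_ge0 // ltW.
have dc : q * c + d = c by rewrite /c; field; rewrite gt_eqF.
have far n m (t : R) : - r <= t -> nrm (picard (m + n) t - picard n t) <= q ^+ n * c.
  elim: m n => [|m IH] n rt; first by rewrite add0n subrr nrm0 mulr_ge0 ?exprn_ge0.
  apply: (le_trans (nrm_dist (picard n.+1 t) _ _)).
  rewrite -[in leRHS]dc mulrDr mulrA -exprSr lerD ?step //.
  by rewrite addSnnS; exact: IH.
have cauchy (t : R) : - r <= t -> forall e : R, 0 < e ->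
    exists N, forall n m, (N <= n)%N -> (N <= m)%N -> nrm (picard n t - picard m t) < e.
  move=> rt e e0; have e20 : 0 < e / 2 by rewrite divr_gt0.
  have [N hN] := geometric_small c q0 q1 e20; exists N => n m Nn Nm.
  apply: (le_lt_trans (nrm_dist (picard N t) _ _)); rewrite (splitr e) (nrmB (picard N t)).
  have hN' := hN N (leqnn N).
  by apply: ltrD; [rewrite -(subnK Nn)|rewrite -(subnK Nm)]; apply: le_lt_trans (far _ _ _ rt) hN'.
have lim (t : R) : exists l, - r <= t -> forall e : R, 0 < e ->
    exists N, forall n, (N <= n)%N -> nrm (picard n t - l) < e.
  case: (boolP (- r <= t)) => rt; last by exists 0.
  by have [l hl] := nrm_complete (cauchy t rt); exists l.
have {lim} /choice [u hu] := lim.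
have ud n (t : R) : - r <= t -> nrm (u t - picard n t) <= q ^+ n * c.
  move=> rt; apply: le_eps => e e0; have [N hN] := hu t rt _ e0.
  have hN' := ltW (hN (N + n)%N (leq_addr _ _)); have hf := far n N t rt.
  apply: (le_trans (nrm_dist (picard (N + n) t) _ _)).
  by rewrite addrC lerD // nrmB.
have au : admissible (B0 + c) u.
  split.
  - apply: cont_on_unif_lim => e e0; have [N hN] := geometric_small c q0 q1 e0.
    have [C [cC _ _]] := picard_adm N; exists (picard N) => // t.
    rewrite /= in_itv /= andbT => rt.
    exact: le_trans (ud N t rt) (ltW (hN N (leqnn N))).
  - move=> s rs; have [_ b0 _] := a0; have h1 := ud 0%N s rs; rewrite expr0 mul1r in h1.
    rewrite -(subrK (picard 0 s) (u s)) addrC; apply: (le_trans (nrmD _ _)).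
    by rewrite lerD ?b0.
  - move=> s /[dup] rs /andP[rs' _]; apply/eqP; rewrite -subr_eq0; apply/eqP/nrm_small => e e0.
    have [N hN] := geometric_small c q0 q1 e0.
    have [C [_ _ pC]] := picard_adm N; rewrite -(pC s rs).
    exact: le_trans (ud N s rs') (ltW (hN N (leqnn N))).
exists (B0 + c), u; split=> //.
  apply: block_null_approx => // e e0; have e20 : 0 < e / 2 by rewrite divr_gt0.
  have [N hN] := geometric_small c q0 q1 e20; have hN' := ltW (hN N (leqnn N)).
  exists (fun s => nrm (picard N (s + w) - picard N s)); first exact: picard_null.
  move=> s s0; have rs : - r <= s by apply: le_trans s0.
  have rsw : - r <= s + w by rewrite (le_trans rs) // lerDl ltW.
  have h1 := le_trans (ud N _ rs) hN'; have h2 := le_trans (ud N _ rsw) hN'.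
  have -> : u (s + w) - u s = (picard N (s + w) - picard N s) +
     ((u (s + w) - picard N (s + w)) - (u s - picard N s)).
    by rewrite sub_sub [RHS]addrC subrK.
  apply: (le_trans (nrmD _ _)); rewrite lerD2l (splitr e).
  by apply: (le_trans (nrmD _ _)); rewrite nrmN lerD.
move=> t rt; apply/eqP; rewrite -subr_eq0; apply/eqP/nrm_small => e e0.
have e20 : 0 < e / 2 by rewrite divr_gt0.
have [N hN] := geometric_small c q0 q1 e20.
have [C aC] := picard_adm N.
apply: (le_trans (nrm_dist (picard N.+1 t) _ _)).
rewrite (splitr e); apply: lerD; last first.
  by rewrite nrmB; exact: le_trans (ud N.+1 t rt) (ltW (hN N.+1 (leqnSn N))).
have qc : 0 <= q ^+ N * c by rewrite mulr_ge0 // exprn_ge0.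
apply: (le_trans (volterra_contract au aC qc (ud N) rt)).
by rewrite mulrA -exprS ltW // hN.
Qed.

Lemma fixed_point_unique B1 B2 u1 u2 : admissible B1 u1 -> admissible B2 u2 ->
  (forall t : R, - r <= t -> volterra u1 t = u1 t) ->
  (forall t : R, - r <= t -> volterra u2 t = u2 t) ->
  forall t : R, - r <= t -> u1 t = u2 t.
Proof.
move=> a1 a2 f1 f2.
have r0' : - r <= 0 by rewrite oppr_le0 ltW.
have Bpos B u : admissible B u -> 0 <= B.
  by move=> [_ uB _]; apply: le_trans (uB 0 r0'); exact: nrm_ge0.
set q := Lg + Lf * K; have q0 : 0 <= q := q_ge0; have q1 : q < 1 := q_lt1.
have B0 : 0 <= B1 + B2 by rewrite addr_ge0 ?(Bpos _ _ a1) ?(Bpos _ _ a2).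
have h n (t : R) : - r <= t -> nrm (u1 t - u2 t) <= q ^+ n * (B1 + B2).
  elim: n t => [|n IH] t rt.
    rewrite expr0 mul1r; apply: (le_trans (nrmD _ _)); rewrite nrmN.
    by have [_ b1 _] := a1; have [_ b2 _] := a2; rewrite lerD ?b1 ?b2.
  rewrite -(f1 t rt) -(f2 t rt) exprS -mulrA.
  by apply: (volterra_contract a1 a2) => //; rewrite mulr_ge0 // exprn_ge0.
move=> t rt; apply/eqP; rewrite -subr_eq0; apply/eqP/nrm_small => e e0.
have [N hN] := geometric_small (B1 + B2) q0 q1 e0.
exact: le_trans (h N t rt) (ltW (hN N (leqnn N))).
Qed.

(** ** Mild solutions are the fixed points *)

Lemma fixed_point_mild B u : admissible B u -> (forall t : R, - r <= t -> volterra u t = u t) ->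
  mild_solution r S f g phi u.
Proof.
move=> au fu; have [cu uB uphi] := au; split.
- split; first by apply/within_cont_on.
  by exists B.
- by move=> th hth; rewrite /hist add0r uphi.
move=> t t0; have rt : - r <= t by apply: le_trans t0; rewrite oppr_le0 ltW.
have cf := comp_hist_cont r0 f_cont cu.
exists (Sconv S (fun s => f s (hist u s)) t).
  have h := is_rint_rev (SconvP S_cont S_le k_ge0 k_le cf t0).
  apply: eq_is_rint h => s _; by have -> : t - (t - s) = s by ring.
by rewrite -{1}(fu t rt) volterra_pos.
Qed.

(** The integrals of the definition and of [Sconv] correspond by reversal of time,
    and integrals are unique. *)
Lemma mild_fixed_point u : mild_solution r S f g phi u ->
  exists2 B, admissible B u & forall t : R, - r <= t -> volterra u t = u t.
Proof.
move=> [[/within_cont_on cu [B uB]] uphi um].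
have au : admissible B u.
  by split=> // s hs; rewrite -(uphi s hs) /hist add0r.
exists B => // t rt; case: (leP t 0) => t0.
  have [_ _ up] := au; rewrite (volterra_neg au) ?rt //.
  by rewrite up // rt.
have cf := comp_hist_cont r0 f_cont cu.
rewrite volterra_pos ?ltW //; have [I hI ->] := um t (ltW t0).
rewrite /rhs; congr (_ + _).
apply: (is_rint_unique (SconvP S_cont S_le k_ge0 k_le cf (ltW t0))).
have h := is_rint_rev hI; apply: eq_is_rint h => s _.
by have -> : t - (t - s) = s by ring.
Qed.

(** The supremum over the window ending at s is the norm of a difference of
    histories. *)
Lemma null_increment_PSAPr B u : admissible B u -> null_increment u -> PSAPr w r u.
Proof.
move=> [cu uB _] nu; have r0' : - r <= 0 by rewrite oppr_le0 ltW.
split; first split; first split.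
- apply/within_cont_on; apply: cont_onS cu => s /=; rewrite !in_itv /= !andbT.
  exact: le_trans.
- by exists B => t t0; apply: uB; exact: le_trans t0.
- apply: (mean_null_of_blocks r20) => // [s _|e e0]; first by rewrite lee_fin nrm_ge0.
  have [b [b0 hb mb]] := nu e e0; exists b; split=> // j s _ js.
  by rewrite lee_fin; exact: hb.
apply: (mean_null_of_blocks r20); first exact: ltW.
  move=> s rs; apply: (@le_trans _ _ (nrm (u (s + w) - u s))%:E).
    by rewrite lee_fin nrm_ge0.
  by apply: ereal_sup_ubound; exists s => //=; rewrite in_itv /= lexx andbT lerBlDr lerDl ltW.
move=> e e0; have [b [b0 hb mb]] := hist_increment_null r0 w0 uB nu e0.
exists b; split=> // j s rs js; apply: ge_ereal_sup => _ [t /= + <-].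
rewrite in_itv /= => /andP[t1 t2]; rewrite lee_fin; apply: le_trans (hb j s js).
have s0 : 0 <= s by apply: le_trans rs; exact: ltW.
have -> : u (t + w) - u t = hist u (s + w) (t - s) - hist u s (t - s).
  by rewrite /hist; congr (u _ - u _); ring.
apply: (@nrm_le_hist_norm _ _ r (fun th => hist u (s + w) th - hist u s th) (B + B) (t - s)).
  move=> th /andP[th1 _]; apply: (le_trans (nrmD _ _)); rewrite nrmN lerD // /hist uB //.
    by apply: (le_trans th1); rewrite lerDr addr_ge0 // ltW.
  by apply: (le_trans th1); rewrite lerDr.
by rewrite subr_le0 t2 andbT lerBrDr addrC.
Qed.

End Volterra.

(** * The constants of the equation *)

Section Constants.
Variable R : realType.

Lemma kernel_le (c m al t : R) : 0 <= c -> 0 <= m -> c / (1 + m * t `^ al) <= c.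
Proof.
move=> c0 m0; have p : 0 <= m * t `^ al by rewrite mulr_ge0 // powR_ge0.
by rewrite ler_pdivrMr ?ltr_wpDr // ler_peMr // lerDl.
Qed.

Lemma kernel_cvg0 (c m al e : R) : 0 <= c -> 0 < m -> 1 < al -> 0 < e ->
  exists T : R, forall t, T <= t -> c / (1 + m * t `^ al) <= e.
Proof.
move=> c0 m0 al1 e0; exists (Num.max 1 (c / e / m)) => t; rewrite ge_max => /andP[t1 t2].
have tp : t <= t `^ al by apply: le1r_powR => //; exact: ltW.
have p : 0 <= m * t `^ al by rewrite mulr_ge0 ?powR_ge0 // ltW.
have h : c / e <= m * t `^ al.
  by rewrite [m * _]mulrC -ler_pdivrMr //; exact: le_trans tp.
rewrite ler_pdivrMr ?ltr_wpDr // [e * _]mulrC -ler_pdivrMr //.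
by apply: (le_trans h); rewrite lerDr.
Qed.

Lemma le_Cb_norm (L : R -> R) (t : R) : Cb_nonneg L -> 0 <= t -> L t <= Cb_norm L.
Proof.
move=> [_ L0 [K hK]] t0; apply: (le_trans (ler_norm _)); apply: ub_le_sup.
  exists K => _ [s /= + <-]; rewrite in_itv /= andbT => s0.
  by rewrite ger0_norm ?L0 // hK.
by exists t => //=; rewrite in_itv /= t0.
Qed.

Lemma Cb_norm_ge0 (L : R -> R) : Cb_nonneg L -> 0 <= Cb_norm L.
Proof.
move=> hL; have z0 : (0 : R) <= 0 by [].
by apply: le_trans (le_Cb_norm hL z0); have [_ h _] := hL; exact: h.
Qed.

(** For unbounded [psi] the supremum takes its default value 0. *)
Lemma hist_norm_ge0 (X : completeNormedModType R[i]) (r : R) (psi : R -> X) :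
  0 < r -> 0 <= hist_norm r psi.
Proof.
move=> r0; have [hs|/sup_out hs] := pselect (has_sup [set nrm (psi th) | th in `[- r, 0]]); last first.
  by rewrite /hist_norm hs.
apply: (@le_trans _ _ (nrm (psi 0))); first exact: nrm_ge0.
apply: ub_le_sup; first by case: hs.
by exists 0 => //=; rewrite in_itv /= lexx andbT oppr_le0 ltW.
Qed.

End Constants.

Unset Implicit Arguments.

Theorem theorem3p1 (R : realType) (X : completeNormedModType R[i])
  (alpha r omega : R) (phi : R -> X)
  (D : set X) (A : X -> X) (mu theta M C : R) (S : R -> {linear X -> X})
  (f g : R -> (R -> X) -> X) (Lf Lg : R -> R) :
  1 < alpha < 2 -> 0 < r -> 0 < omega -> hist_space r phi ->
  dense D -> mu < 0 -> sectorial D A mu theta M ->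
  0 < theta <= pi * (1 - alpha / 2) ->
  solution_operator D A alpha S -> 0 < C ->
  (forall t, 0 <= t ->
    (opnorm (S t) <= (C * M / (1 + `|mu| * t `^ alpha))%:E)%E) ->
  PSAPr_hist omega r f -> PSAPr_hist omega r g ->
  Cb 0 (fun t => f t (fun=> 0)) -> Cb 0 (fun t => g t (fun=> 0)) ->
  Cb_nonneg Lf -> Cb_nonneg Lg ->
  (forall t psi1 psi2, 0 <= t -> hist_space r psi1 -> hist_space r psi2 ->
    nrm (g t psi1 - g t psi2) <= Lg t * hist_norm r (fun th => psi1 th - psi2 th)) ->
  (forall t psi1 psi2, 0 <= t -> hist_space r psi1 -> hist_space r psi2 ->
    nrm (f t psi1 - f t psi2) <= Lf t * hist_norm r (fun th => psi1 th - psi2 th)) ->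
  Cb_norm Lg + Cb_norm Lf *
    (C * M * `|mu| `^ (- alpha^-1) * pi / (alpha * sin (pi / alpha))) < 1 ->
  exists u : R -> X,
    [/\ mild_solution r S f g phi u,
        PSAPr omega r u &
        forall v, mild_solution r S f g phi v ->
          forall t, - r <= t -> v t = u t].
Proof.
move=> /andP[al1 _] r0 w0 phiP dD mu0 secA _ solS C0 opS [fC fN] [gC gN] [_ [Kf fK]] [_ [Kg gK]]
  LfP LgP gL fL small.
have M0 : 0 < M by have [_ _ [_ M0] _ _] := secA.
have CM : 0 < C * M by rewrite mulr_gt0.
have m0 : 0 < `|mu| by rewrite normr_gt0 lt_eqF.
pose k t : R := C * M / (1 + `|mu| * t `^ alpha).
have k_ge0 (t : R) : 0 <= t -> 0 <= k t.
  by move=> _; rewrite divr_ge0 ?(ltW CM) // addr_ge0 // mulr_ge0 ?powR_ge0.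
have k_le (t : R) : 0 <= t -> k t <= C * M by move=> _; apply: kernel_le; exact: ltW.
have k_cvg (e : R) : 0 < e -> exists T : R, forall t, T <= t -> k t <= e.
  by move=> e0; apply: kernel_cvg0 => //; exact: ltW.
have S_le (t : R) x : 0 <= t -> nrm (S t x) <= k t * nrm x.
  by move=> t0; apply: opnorm_le (opS t t0) _ => a y; rewrite linearZ.
have S_cont x : cont_on `[0, +oo[ (fun t => S t x).
  by apply/within_cont_on; have [_ h _] := solS; exact: h.
have S_0 x : S 0 x = x.
  apply: (solution_operator_0 (K := C * M) al1 dD mu0 secA solS) => t y t0.
  by apply: (le_trans (S_le _ _ t0)); rewrite ler_wpM2r ?nrm_ge0 // k_le.
have Lf0 := Cb_norm_ge0 LfP; have Lg0 := Cb_norm_ge0 LgP.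
(* the strict inequality leaves room for a kernel bound exceeding the integral *)
have [eps eps0 q1] : exists2 eps : R, 0 < eps &
  Cb_norm Lg + Cb_norm Lf *
    (C * M * (`|mu| `^ (- alpha^-1) * pi / (alpha * sin (pi / alpha)) + eps)) < 1.
  pose I := `|mu| `^ (- alpha^-1) * pi / (alpha * sin (pi / alpha)).
  have IE : C * M * `|mu| `^ (- alpha^-1) * pi / (alpha * sin (pi / alpha)) = C * M * I.
    by rewrite /I !mulrA.
  rewrite IE mulrA in small; rewrite -/I.
  pose b := Cb_norm Lf * (C * M); have b0 : 0 <= b by rewrite mulr_ge0 // ltW.
  have b1 : 0 < b + 1 by rewrite ltr_wpDl.
  have s0 : 0 < 1 - (Cb_norm Lg + b * I) by rewrite subr_gt0.
  exists ((1 - (Cb_norm Lg + b * I)) / (b + 1)); first by rewrite divr_gt0.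
  rewrite mulrA -/b mulrDr addrA -ltrBrDl mulrA ltr_pdivrMr // mulrC ltr_pM2l //.
  by rewrite ltrDl.
have [G0 [G0_ge G0_le]] := kernel_majorant al1 mu0 eps0.
pose G t := C * M * G0 t.
have G_ge (u v : R) : 0 <= u -> u <= v -> (v - u) * k v <= G v - G u.
  move=> u0 uv; rewrite -mulrBr /k mulrCA ler_pM2l //; exact: G0_ge.
have G_le (u v : R) : 0 <= u -> u <= v -> G v - G u <=
    C * M * (`|mu| `^ (- alpha^-1) * pi / (alpha * sin (pi / alpha)) + eps).
  by move=> u0 uv; rewrite -mulrBr ler_pM2l //; exact: G0_le.
have f_lip (t : R) psi1 psi2 : 0 <= t -> hist_space r psi1 -> hist_space r psi2 ->
    nrm (f t psi1 - f t psi2) <= Cb_norm Lf * hist_norm r (fun th => psi1 th - psi2 th).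
  move=> t0 h1 h2; apply: (le_trans (fL t _ _ t0 h1 h2)).
  by rewrite ler_wpM2r ?hist_norm_ge0 // le_Cb_norm.
have g_lip (t : R) psi1 psi2 : 0 <= t -> hist_space r psi1 -> hist_space r psi2 ->
    nrm (g t psi1 - g t psi2) <= Cb_norm Lg * hist_norm r (fun th => psi1 th - psi2 th).
  move=> t0 h1 h2; apply: (le_trans (gL t _ _ t0 h1 h2)).
  by rewrite ler_wpM2r ?hist_norm_ge0 // le_Cb_norm.
have phi_cont := (within_cont_on _ _).1 phiP.
have [B [u [au nu fu]]] := fixed_point_exists S_cont S_le S_0 k_ge0 k_le k_cvg G_ge G_le
  r0 w0 phi_cont fC gC Lf0 Lg0 f_lip g_lip fK gK fN gN q1.
exists u; split.
- exact: (fixed_point_mild S_cont S_le k_ge0 k_le r0 fC au fu).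
- exact: (null_increment_PSAPr r0 w0 au nu).
move=> v /(mild_fixed_point S_cont S_le S_0 k_ge0 k_le G_ge r0 phi_cont fC Lg0 g_lip) [B' av fv].
exact: (fixed_point_unique S_cont S_le k_ge0 k_le G_ge G_le r0 fC Lf0 Lg0 f_lip g_lip q1 av au fv fu).
Qed.
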